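(* Let $n\ge 1$ be an integer, let $Y$ be a metric space, let $p>2n+2$, and let $f\colon \mathbb{H}^n\to Y$ be a continuous mapping in the Sobolev space $W^{1,p}_{\mathrm{loc}}(\mathbb{H}^n;Y)$. Let $\mathbb{V}$ be a horizontal subgroup of $\mathbb{H}^n$ of dimension $m$, $1\le m\le n$, with vertical complement $\mathbb{V}^\perp$, and let $$\alpha\in\left[m,\frac{pm}{p-(2n+2-m)}\right].$$ Then $$\dim_{\mathbb{R}^{2n+1}}\{a\in\mathbb{V}^\perp:\ \dim f(a*\mathbb{V})\ge\alpha\}\le\beta(p,m,\alpha),$$ where $$\beta(p,m,\alpha)=\begin{cases}(2n+1-m)-\frac{p}{2}\left(1-\frac{m}{\alpha}\right), & \alpha\in\left[m,\frac{pm}{p-2}\right],\\[4pt] (2n+2-m)-p\left(1-\frac{m}{\alpha}\right), & \alpha\in\left[\frac{pm}{p-2},\frac{pm}{p-(2n+2-m)}\right].\end{cases}$$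
   Context: The Heisenberg group $\mathbb{H}^n$ is $\mathbb{R}^{2n+1}$ with points $a=(z,t)$, $z=(x_1,y_1,\dots,x_n,y_n)\in\mathbb{R}^{2n}$, $t\in\mathbb{R}$, and group law $(z,t)*(z',t')=(z+z',\,t+t'+2\omega(z,z'))$, where $\omega(z,z')=\sum_{i=1}^n(x_iy_i'-x_i'y_i)$. It is equipped with the left-invariant metric $d_{\mathbb{H}^n}(a,a')=\|a^{-1}*a'\|$, where $\|(z,t)\|=(\|z\|_{\mathbb{R}^{2n}}^4+|t|^2)^{1/4}$ (Korányi norm), and with the $(2n+2)$-dimensional Hausdorff measure $\mathcal{H}^{2n+2}_{\mathbb{H}^n}$ of this metric (a constant multiple of Lebesgue measure). A horizontal (homogeneous) subgroup of dimension $m$ is a set $\mathbb{V}=V\times\{0\}$, where $V\subseteq\mathbb{R}^{2n}$ is an $m$-dimensional linear subspace that is isotropic, i.e. $\omega|_{V\times V}=0$. Its vertical complement is $\mathbb{V}^\perp=V^\perp\times\mathbb{R}$, where $V^\perp$ is the Euclidean orthogonal complement of $V$ in $\mathbb{R}^{2n}$. For $a\in\mathbb{V}^\perp$, $a*\mathbb{V}=\{a*v:v\in\mathbb{V}\}$ is the left coset. A continuous map $f\colon\mathbb{H}^n\to Y$ is in $W^{1,p}_{\mathrm{loc}}(\mathbb{H}^n;Y)$ if it has an upper gradient $g\colon\mathbb{H}^n\to[0,\infty]$ that is locally $p$-integrable with respect to $\mathcal{H}^{2n+2}_{\mathbb{H}^n}$; that is, $g$ is a Borel function with $g^p$ locally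 integrable such that $d_Y(f(\gamma(0)),f(\gamma(1)))\le\int_\gamma g\,ds$ for every rectifiable path $\gamma\colon[0,1]\to\mathbb{H}^n$ ($ds$ is arclength with respect to $d_{\mathbb{H}^n}$). $\dim_{\mathbb{R}^{2n+1}}$ denotes Hausdorff dimension with respect to the Euclidean metric of $\mathbb{R}^{2n+1}$, and $\dim f(a*\mathbb{V})$ denotes Hausdorff dimension in $Y$. *)

(* Defs.v *)
From HB Require Import structures.
From mathcomp Require Import all_boot all_order all_algebra.
From mathcomp Require Import all_classical all_reals all_analysis.
From mathcomp Require Import measurable_realfun.
From mathcomp Require Import ring lra.

Set Implicit Arguments.
Unset Strict Implicit.
Unset Printing Implicit Defensive.

Import Order.TTheory GRing.Theory Num.Theory.
Import numFieldNormedType.Exports.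

Local Open Scope classical_set_scope.
Local Open Scope ring_scope.

(** * Hausdorff measure and dimension, for a distance [d : T -> T -> R] *)

Section hausdorff.
Local Open Scope ereal_scope.
Context {R : realType} {T : Type}.
Variable d : T -> T -> R.
Implicit Types (A : set T) (F : (set T)^nat) (s delta : R).

Definition diameter A : \bar R :=
  ereal_sup [set e | e = 0 \/ exists x y, [/\ A x, A y & e = (d x y)%:E]].

(* The empty set is treated apart because [poweR 0 0 = 1]. *)
Definition hausdorff_gauge s A : \bar R :=
  if `[< A !=set0 >] then poweR (diameter A) s else 0.

Definition hausdorff_cover delta A : set (set T)^nat :=
  [set F | (forall k, diameter (F k) <= delta%:E) /\ A `<=` \bigcup_k F k].

Definition hausdorff_premeasure s delta A : \bar R :=
  ereal_inf [set \sum_(k <oo) hausdorff_gauge s (F k) |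
             F in hausdorff_cover delta A].

Definition hausdorff_measure s A : \bar R :=
  ereal_sup [set hausdorff_premeasure s delta A |
             delta in [set delta | (0 < delta)%R]].

Definition hausdorff_dim A : \bar R :=
  ereal_inf [set s%:E | s in [set s | (0 <= s)%R /\ hausdorff_measure s A = 0]].

Lemma diameter0 : diameter set0 = 0.
Proof.
apply/eqP; rewrite eq_le; apply/andP; split.
  by apply: ge_ereal_sup => e /= [->//|[x [y [x0 _ _]]]]; case: x0.
by apply: ereal_sup_ubound; left.
Qed.

Lemma hausdorff_gauge0 s : hausdorff_gauge s set0 = 0.
Proof. by rewrite /hausdorff_gauge; case: asboolP => // -[]. Qed.

Lemma hausdorff_gauge_ge0 s A : 0 <= hausdorff_gauge s A.
Proof. by rewrite /hausdorff_gauge; case: ifP => // _; exact: poweR_ge0. Qed.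

Lemma hausdorff_premeasure_ge0 s delta A : 0 <= hausdorff_premeasure s delta A.
Proof.
apply: le_ereal_inf_tmp => _ [F _ <-].
by apply: nneseries_ge0 => k _ _; exact: hausdorff_gauge_ge0.
Qed.

Lemma le_hausdorff_premeasure s delta :
  {homo hausdorff_premeasure s delta : A B / A `<=` B >-> A <= B}.
Proof.
move=> A B AB; apply/ereal_inf_le_tmp => _ [F [dF BF] <-].
by exists F => //; split => //; exact: subset_trans BF.
Qed.

Lemma hausdorff_premeasure0 s delta : (0 < delta)%R ->
  hausdorff_premeasure s delta set0 = 0.
Proof.
move=> delta0; apply/eqP; rewrite eq_le hausdorff_premeasure_ge0 andbT.
apply: ereal_inf_lbound; exists (fun=> set0).
  by split=> // k; rewrite diameter0 lee_fin ltW.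
by rewrite eseries0// => k _ _; exact: hausdorff_gauge0.
Qed.

Lemma hausdorff_premeasure_sigma_subadditive s delta :
  sigma_subadditive (hausdorff_premeasure s delta).
Proof.
move=> A; set mu := hausdorff_premeasure s delta.
have mu0 : forall X, 0 <= mu X by exact: hausdorff_premeasure_ge0.
pose w := hausdorff_gauge s.
have w0 : forall X, 0 <= w X by exact: hausdorff_gauge_ge0.
have [[i ioo]|] := pselect (exists i, mu (A i) = +oo).
  rewrite (eseries_pinfty _ _ ioo) ?leey// => n _.
  by rewrite -ltNye (lt_le_trans _ (mu0 _)).
rewrite -forallNE => Aoo.
suff add2e (e : {posnum R}) :
    mu (\bigcup_n A n) <= \sum_(i <oo) mu (A i) + e%:num%:E.
  by apply/lee_addgt0Pr => _/posnumP[].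
rewrite (le_trans _ (epsilon_trick _ _ _))//.
pose P n F := hausdorff_cover delta (A n) F /\
  \sum_(k <oo) w (F k) <= mu (A n) + (e%:num / (2 ^ n.+1)%:R)%:E.
have [G PG] : {G : ((set T)^nat)^nat & forall n, P n (G n)}.
  apply: (@choice _ _ P) => n; rewrite /P /mu /hausdorff_premeasure.
  set S := (X in ereal_inf X); move infS : (ereal_inf S) => iS.
  case: iS infS => [r Sr|Soo|Soo].
  - have en1 : (0 < e%:num / (2 ^ n.+1)%:R)%R by [].
    have /(lb_ereal_inf_adherent en1) : ereal_inf S \is a fin_num by rewrite Sr.
    move=> [x [B [mB AnB muBx] xS]].
    by exists B; split => //; rewrite /w muBx -Sr; exact/ltW.
  - by have := Aoo n; rewrite /mu /hausdorff_premeasure Soo.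
  - by have := mu0 (A n); rewrite /mu /hausdorff_premeasure -/S Soo.
have wG0 x : 0 <= (w \o uncurry G) x by exact: w0.
apply: (@le_trans _ _ (\esum_(i in setT) (w \o uncurry G) i)).
  apply: ereal_inf_lbound => /=.
  have /card_esym/ppcard_eqP[f] := card_nat2.
  exists (uncurry G \o f).
    split => [i /=|t [i _]].
      by case: (f i) => a b /=; exact: (PG a).1.1.
    move=> /(PG i).1.2 -[j _ ?]; exists (f^-1%FUN (i, j)) => //=.
    by rewrite invK ?inE.
  rewrite -(esum_pred_image (w \o uncurry G) _ xpredT) ?[fun=> _]set_true//.
  by rewrite image_eq.
rewrite (_ : esum _ _ = \sum_(i <oo) \sum_(j <oo ) w (G i j)); last first.
  pose J : nat -> set (nat * nat) := fun i => [set (i, j) | j in setT].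
  rewrite (_ : setT = \bigcup_k J k); last first.
    by rewrite predeqE => -[a b]; split => // _; exists a => //; exists b.
  rewrite esum_bigcupT /=; last 2 first.
    - apply/trivIsetP => i j _ _ ij.
      rewrite predeqE => -[n m] /=; split => //= -[] [_] _ [<-{n} _].
      by move=> [m' _] [] /esym/eqP; rewrite (negbTE ij).
    - by move=> /= [n m].
  rewrite -(image_id [set: nat]) -fun_true esum_pred_image//; last first.
    by move=> n _; exact: esum_ge0.
  apply: eq_eseriesr => /= j _.
  rewrite -(esum_pred_image (w \o uncurry G) (pair j) predT)//=; last first.
    by move=> ? ? _ _; exact: (@can_inj _ _ _ snd).
  by congr esum; rewrite predeqE => -[a b]; split; move=> [i _ <-]; exists i.
by apply: lee_nneseries => [n _ _|n _]; [exact: nneseries_ge0|exact: (PG n).2].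
Qed.

Lemma hausdorff_measure0 s : hausdorff_measure s set0 = 0.
Proof.
apply/eqP; rewrite eq_le; apply/andP; split.
  by apply: ge_ereal_sup => _ [e /= e0 <-]; rewrite hausdorff_premeasure0.
by apply: ereal_sup_ubound; exists 1%R => //=; rewrite hausdorff_premeasure0.
Qed.

Lemma hausdorff_measure_ge0 s A : 0 <= hausdorff_measure s A.
Proof.
apply: le_ereal_sup_tmp; exists (hausdorff_premeasure s 1 A).
  by exists 1%R => /=.
exact: hausdorff_premeasure_ge0.
Qed.

Lemma le_hausdorff_measure s :
  {homo hausdorff_measure s : A B / A `<=` B >-> A <= B}.
Proof.
move=> A B AB; apply: ge_ereal_sup => _ [e /= e0 <-].
apply: (le_trans (le_hausdorff_premeasure s e AB)).
by apply: ereal_sup_ubound; exists e.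
Qed.

Lemma hausdorff_measure_sigma_subadditive s :
  sigma_subadditive (hausdorff_measure s).
Proof.
move=> A; apply: ge_ereal_sup => _ [e /= e0 <-].
apply: (le_trans (hausdorff_premeasure_sigma_subadditive s e A)).
apply: lee_nneseries => n _; first by move=> _; exact: hausdorff_premeasure_ge0.
by apply: ereal_sup_ubound; exists e.
Qed.

HB.instance Definition _ s := isOuterMeasure.Build R T (hausdorff_measure s)
  (hausdorff_measure0 s) (hausdorff_measure_ge0 s) (@le_hausdorff_measure s)
  (@hausdorff_measure_sigma_subadditive s).

End hausdorff.

(** * Rectifiable paths and line integrals in a metric space *)

Section paths.
Context {R : realType} {X : metricType R}.
Implicit Types (a b s t : R) (gamma : R -> X).

(* Metric counterpart of [variation]. *)
Definition path_variation a b gamma (l : seq R) : R :=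
  let F := gamma \o nth b (a :: l) in
  \sum_(0 <= k < size l) mdist (F k) (F k.+1).

Definition path_length a b gamma : \bar R :=
  ereal_sup [set (path_variation a b gamma l)%:E | l in itv_partition a b].

Definition rectifiable gamma : Prop :=
  {within `[0, 1], continuous gamma} /\ (path_length 0 1 gamma < +oo)%E.

(* The arclength parametrization: [gamma] at the first time at which the
   length run through reaches [s]. *)
Definition arclength_param gamma s : X :=
  gamma (inf [set t | 0 <= t <= 1 /\ (s%:E <= path_length 0 t gamma)%E]).

Definition path_integral (g : X -> \bar R) gamma : \bar R :=
  (\int[lebesgue_measure]_(s in `[0%R, fine (path_length 0 1 gamma)])
    g (arclength_param gamma s))%E.

End paths.

(** * The Heisenberg group *)

(* The coordinates of [z] are (x_1, y_1, ..., x_n, y_n): [mxvec_index i j] is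
   the row-major position of the entry (i, j) of an n x 2 matrix. *)
Definition heis (R : realType) (n : nat) : Type := ('rV[R]_(n * 2) * R)%type.

Section heisenberg.
Context {R : realType} {n : nat}.
Implicit Types (z w : 'rV[R]_(n * 2)) (a b c : heis R n).

Definition xcoord z (i : 'I_n) : R := z ord0 (mxvec_index i (0 : 'I_2)).
Definition ycoord z (i : 'I_n) : R := z ord0 (mxvec_index i (1 : 'I_2)).

Definition dotp z w : R := \sum_k z ord0 k * w ord0 k.
Definition enorm z : R := Num.sqrt (dotp z z).

Definition omega z w : R :=
  \sum_i (xcoord z i * ycoord w i - xcoord w i * ycoord z i).

Definition heis_mul a b : heis R n :=
  (a.1 + b.1, a.2 + b.2 + 2 * omega a.1 b.1).
Definition heis_inv a : heis R n := (- a.1, - a.2).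

Definition koranyi a : R := (enorm a.1 ^+ 4 + `|a.2| ^+ 2) `^ (4%:R^-1).
Definition heis_dist a b : R := koranyi (heis_mul (heis_inv a) b).

Definition euclid_dist a b : R :=
  Num.sqrt (enorm (a.1 - b.1) ^+ 2 + (a.2 - b.2) ^+ 2).

Lemma dotpE z w :
  dotp z w = \sum_i (xcoord z i * xcoord w i + ycoord z i * ycoord w i).
Proof.
rewrite /dotp (reindex _ (curry_mxvec_bij _ _)) /=.
rewrite (eq_bigr (fun p : 'I_n * 'I_2 =>
  z ord0 (mxvec_index p.1 p.2) * w ord0 (mxvec_index p.1 p.2))); last by case.
rewrite -(pair_bigA _ (fun i j =>
  z ord0 (mxvec_index i j) * w ord0 (mxvec_index i j))) /=.
apply: eq_bigr => i _; rewrite 2!big_ord_recl big_ord0 addr0.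
by congr (_ + z _ (mxvec_index _ _) * w _ (mxvec_index _ _)); exact/val_inj.
Qed.

Lemma dotp_ge0 z : 0 <= dotp z z.
Proof. by apply: sumr_ge0 => k _; rewrite -expr2 sqr_ge0. Qed.

Lemma dotp_eq0 z : dotp z z = 0 -> z = 0.
Proof.
move=> z0; apply/rowP => k; rewrite mxE; apply/eqP.
rewrite -sqrf_eq0 expr2; apply/eqP; apply: (psumr_eq0P _ z0) => // i _.
by rewrite -expr2 sqr_ge0.
Qed.

Lemma dotp_sqrD z w :
  dotp (z + w) (z + w) = dotp z z + dotp w w + 2 * dotp z w.
Proof.
rewrite /dotp mulr_sumr -!big_split /=; apply: eq_bigr => k _.
by rewrite !mxE; ring.
Qed.

Lemma dotpNN z : dotp (- z) (- z) = dotp z z.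
Proof. by apply: eq_bigr => k _; rewrite !mxE mulrNN. Qed.

Lemma omegaDl z z' w : omega (z + z') w = omega z w + omega z' w.
Proof.
rewrite /omega -big_split /=; apply: eq_bigr => i _.
by rewrite /xcoord /ycoord !mxE; ring.
Qed.

Lemma omegaDr z w w' : omega z (w + w') = omega z w + omega z w'.
Proof.
rewrite /omega -big_split /=; apply: eq_bigr => i _.
by rewrite /xcoord /ycoord !mxE; ring.
Qed.

Lemma omegaNl z w : omega (- z) w = - omega z w.
Proof.
rewrite /omega -sumrN; apply: eq_bigr => i _.
by rewrite /xcoord /ycoord !mxE; ring.
Qed.

Lemma omegaNr z w : omega z (- w) = - omega z w.
Proof.
rewrite /omega -sumrN; apply: eq_bigr => i _.
by rewrite /xcoord /ycoord !mxE; ring.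
Qed.

Lemma omegaC z w : omega z w = - omega w z.
Proof. by rewrite /omega -sumrN; apply: eq_bigr => i _; ring. Qed.

Lemma omegazz z : omega z z = 0.
Proof. by rewrite /omega big1// => i _; rewrite subrr. Qed.

Lemma dotp_omega_le z w :
  dotp z w ^+ 2 + omega z w ^+ 2 <= dotp z z * dotp w w.
Proof.
have [z0|zn0] := eqVneq (dotp z z) 0.
  have -> : dotp z w = 0.
    by rewrite (dotp_eq0 z0) /dotp big1// => k _; rewrite mxE mul0r.
  have -> : omega z w = 0.
    rewrite (dotp_eq0 z0) /omega big1// => i _.
    by rewrite /xcoord /ycoord !mxE; ring.
  by rewrite z0 mul0r expr0n addr0.
have zgt0 : 0 < dotp z z by rewrite lt_neqAle eq_sym zn0 dotp_ge0.
rewrite -subr_ge0 -(pmulr_rge0 _ zgt0).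
have lin (p q r s : R) :
    p * dotp w w + q * dotp z w + r * omega z w + s * dotp z z =
    \sum_i (p * (xcoord w i * xcoord w i + ycoord w i * ycoord w i)
           + q * (xcoord z i * xcoord w i + ycoord z i * ycoord w i)
           + r * (xcoord z i * ycoord w i - xcoord w i * ycoord z i)
           + s * (xcoord z i * xcoord z i + ycoord z i * ycoord z i)).
  by rewrite !dotpE /omega !mulr_sumr -!big_split.
set N := dotp z z; set D := dotp z w; set O := omega z w.
rewrite [leRHS](_ : _ = N ^+ 2 * dotp w w + (-2 * N * D) * D
  + (-2 * N * O) * O + (D ^+ 2 + O ^+ 2) * N); last by ring.
rewrite lin; apply: sumr_ge0 => i _.
set x := xcoord z i; set y := ycoord z i; set x' := xcoord w i.
set y' := ycoord w i.
rewrite [leRHS](_ : _ = (N * x' - D * x + O * y) ^+ 2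
  + (N * y' - D * y - O * x) ^+ 2); last by ring.
by rewrite addr_ge0 ?sqr_ge0.
Qed.

Lemma planar_triangle (p1 p2 q1 q2 u v : R) : 0 <= u -> 0 <= v ->
  p1 ^+ 2 + p2 ^+ 2 <= u ^+ 2 -> q1 ^+ 2 + q2 ^+ 2 <= v ^+ 2 ->
  (p1 + q1) ^+ 2 + (p2 + q2) ^+ 2 <= (u + v) ^+ 2.
Proof.
move=> u0 v0 pu qv.
have uv0 : 0 <= u * v by rewrite mulr_ge0.
have h : p1 * q1 + p2 * q2 <= u * v.
  apply: le_trans (ler_norm _) _.
  rewrite -(@ler_pXn2r _ 2)// ?nnegrE ?normr_ge0// real_normK ?num_real//.
  have s0 : 0 <= p1 ^+ 2 + p2 ^+ 2 by rewrite addr_ge0 ?sqr_ge0.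
  have t0 : 0 <= q1 ^+ 2 + q2 ^+ 2 by rewrite addr_ge0 ?sqr_ge0.
  have := ler_pM s0 t0 pu qv; have := sqr_ge0 (p1 * q2 - p2 * q1).
  by rewrite exprMn; nra.
nra.
Qed.

Lemma koranyi_ge0 a : 0 <= koranyi a.
Proof. exact: powR_ge0. Qed.

Lemma koranyi4 a : koranyi a ^+ 4 = dotp a.1 a.1 ^+ 2 + a.2 ^+ 2.
Proof.
have e4 : enorm a.1 ^+ 4 = dotp a.1 a.1 ^+ 2.
  by rewrite -[4%N]/(2 * 2)%N exprM sqr_sqrtr// dotp_ge0.
rewrite /koranyi e4 real_normK ?num_real// -powR_mulrn ?powR_ge0//.
by rewrite -powRrM mulVf ?pnatr_eq0// powRr1// addr_ge0 ?sqr_ge0.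
Qed.

Lemma koranyi_mul_le a b : koranyi (heis_mul a b) <= koranyi a + koranyi b.
Proof.
set A := koranyi a; set B := koranyi b.
have A0 : 0 <= A by exact: koranyi_ge0.
have B0 : 0 <= B by exact: koranyi_ge0.
rewrite -(@ler_pXn2r _ 4)// ?nnegrE ?koranyi_ge0 ?addr_ge0// koranyi4 /=.
rewrite dotp_sqrD.
have hA := koranyi4 a; have hB := koranyi4 b.
rewrite -/A in hA; rewrite -/B in hB.
have hS : dotp a.1 b.1 ^+ 2 + omega a.1 b.1 ^+ 2 <= (A * B) ^+ 2.
  apply: le_trans (dotp_omega_le _ _) _; rewrite exprMn; apply: ler_pM.
  - exact: dotp_ge0.
  - exact: dotp_ge0.
  - rewrite -(@ler_pXn2r _ 2)// ?nnegrE ?dotp_ge0 ?sqr_ge0// -exprM hA.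
    by rewrite lerDl sqr_ge0.
  - rewrite -(@ler_pXn2r _ 2)// ?nnegrE ?dotp_ge0 ?sqr_ge0// -exprM hB.
    by rewrite lerDl sqr_ge0.
rewrite [leRHS](_ : _ = ((A ^+ 2 + B ^+ 2) + 2 * (A * B)) ^+ 2); last by ring.
apply: planar_triangle.
- by rewrite addr_ge0 ?sqr_ge0.
- by rewrite !mulr_ge0.
- by apply: planar_triangle; rewrite ?sqr_ge0// -exprM ?hA ?hB.
- by nra.
Qed.

Lemma heis_distxx a : heis_dist a a = 0.
Proof.
suff : heis_dist a a ^+ 4 == 0 by rewrite expf_eq0 /= => /eqP.
apply/eqP; rewrite koranyi4 /= !addNr omegaNl omegazz /dotp big1 => [|k _]; last by rewrite mxE mul0r.
by rewrite oppr0 mulr0 addr0 expr0n addr0.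
Qed.

Lemma heis_dist_positivity a b : heis_dist a b = 0 -> a = b.
Proof.
move=> ab0; have := koranyi4 (heis_mul (heis_inv a) b).
rewrite -/(heis_dist a b) ab0 expr0n /= => /esym/eqP.
rewrite paddr_eq0 ?sqr_ge0// !sqrf_eq0 => /andP[/eqP/dotp_eq0 /eqP z0].
move: z0; rewrite addrC subr_eq0 => /eqP ba.
rewrite ba omegaNl omegazz oppr0 mulr0 addr0 addrC subr_eq0 => /eqP ba2.
by rewrite [a]surjective_pairing [b]surjective_pairing ba ba2.
Qed.

Lemma heis_dist_sym a b : heis_dist a b = heis_dist b a.
Proof.
rewrite /heis_dist.
have -> : heis_mul (heis_inv a) b = heis_inv (heis_mul (heis_inv b) a).
  rewrite /heis_mul /heis_inv /=; congr (_, _); first by rewrite opprD opprK addrC.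
  by rewrite !omegaNl (omegaC b.1); ring.
by rewrite /koranyi /enorm /= dotpNN normrN.
Qed.

Lemma heis_dist_triangle b a c : heis_dist a c <= heis_dist a b + heis_dist b c.
Proof.
rewrite /heis_dist.
have -> : heis_mul (heis_inv a) c =
    heis_mul (heis_mul (heis_inv a) b) (heis_mul (heis_inv b) c).
  rewrite /heis_mul /heis_inv /=; congr (_, _).
    by rewrite addrA addrK.
  by rewrite !(omegaDl, omegaDr, omegaNl, omegaNr, omegazz); ring.
exact: koranyi_mul_le.
Qed.

HB.instance Definition _ := Choice.copy (heis R n) ('rV[R]_(n * 2) * R)%type.
HB.instance Definition _ := isPointed.Build (heis R n) ((0, 0) : heis R n).
(* In particular the topology of [heis R n] is that of [heis_dist], which is
   also the Euclidean one. *)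
HB.instance Definition _ := isMetric.Build R (heis R n)
  heis_distxx heis_dist_positivity heis_dist_sym heis_dist_triangle.

(** ** Horizontal subgroups *)

Definition isotropic (V : {vspace 'rV[R]_(n * 2)}) : Prop :=
  forall z w, z \in V -> w \in V -> omega z w = 0.

Definition horizontal_subgroup (V : {vspace 'rV[R]_(n * 2)}) : set (heis R n) :=
  [set a | a.1 \in V /\ a.2 = 0].

Definition vertical_complement (V : {vspace 'rV[R]_(n * 2)}) :
  set (heis R n) := [set a | forall v, v \in V -> dotp a.1 v = 0].

Definition left_coset a (S : set (heis R n)) : set (heis R n) :=
  [set heis_mul a v | v in S].

(** ** Sobolev mappings *)

Definition heis_measure : set (heis R n) -> \bar R :=
  hausdorff_measure (@mdist R (heis R n)) (2 * n + 2)%N%:R.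

HB.instance Definition _ := OuterMeasure.on heis_measure.

(* Integral of [g] on [D]; the sigma-algebra is that of the sets measurable for
   the outer measure [heis_measure], which contains the Borel sets. *)
Definition heis_integral (D : set (heis R n)) (g : heis R n -> \bar R) : \bar R :=
  (\int[heis_measure : set (caratheodory_type heis_measure) -> \bar R]_(a in D)
    g a)%E.

Definition borel_fun (g : heis R n -> \bar R) : Prop :=
  measurable_fun setT (g : g_sigma_algebraType (@open (heis R n)) -> \bar R).

Definition locally_p_integrable (p : R) (g : heis R n -> \bar R) : Prop :=
  forall a, exists2 U, open_nbhs a U &
    (heis_integral U (fun b => poweR (g b) p) < +oo)%E.

Definition upper_gradient (Y : metricType R) (f : heis R n -> Y)
    (g : heis R n -> \bar R) : Prop :=
  [/\ borel_fun g, forall a, (0 <= g a)%E &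
      forall gamma : R -> heis R n, rectifiable gamma ->
        ((mdist (f (gamma 0%R)) (f (gamma 1%R)))%:E
          <= path_integral g gamma)%E].

Definition sobolev_loc (Y : metricType R) (p : R) (f : heis R n -> Y) : Prop :=
  exists2 g, upper_gradient f g & locally_p_integrable p g.

End heisenberg.

(* The two expressions agree at the common endpoint pm / (p - 2). *)
Definition beta {R : realType} (n : nat) (p : R) (m : nat) (alpha : R) : R :=
  if alpha <= p * m%:R / (p - 2)
  then (2 * n%:R + 1 - m%:R) - p / 2 * (1 - m%:R / alpha)
  else (2 * n%:R + 2 - m%:R) - p * (1 - m%:R / alpha).

(* Main.v *)
(** An upper gradient [g] controls [f] along horizontal segments, so right
    invariance of Haar measure gives a Poincare inequality for each right
    translation (vertical ones are commutators of horizontal ones) and, by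
    telescoping over halved radii, a Morrey estimate: [f] oscillates on a ball
    of radius [r] by at most a constant times [r ^ (1 - Q / p)] times the
    [1 / p]-th power of the integral of [g ^ p] over a larger ball, where
    [Q = 2n + 2]. Haar measure is dominated by the Hausdorff measure, so these
    integrals are locally finite.
    Cover a bounded piece of a coset by about [r ^ (- m)] balls of radius [r].
    If along some sequence [r -> 0] the integrals over these balls add up to
    less than [r ^ tau], then the Morrey estimate makes the image of the piece
    null for the Hausdorff measure of any exponent exceeding a bound that
    depends on [tau].
    The remaining cosets carry mass [r ^ tau] at every small scale. Cover
    their base points by cells of size [rho], where [r ^ 2 <= rho <= r]; the
    tubes attached to distinct cells overlap at most a constant times
    [(r / rho) ^ (2n - m)] times, so there are at most about
    [r ^ (- tau) * (r / rho) ^ (2n - m)] such cells. The choices [rho = r] and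
    [rho = r ^ 2] give the two expressions of [beta]. *)

Require Import Defs.
From HB Require Import structures.
From mathcomp Require Import all_boot all_order all_algebra.
From mathcomp Require Import all_classical all_reals all_analysis.
From mathcomp Require Import measurable_realfun.
From mathcomp Require Import ring lra.

Set Implicit Arguments.
Unset Strict Implicit.
Unset Printing Implicit Defensive.

Import Order.TTheory GRing.Theory Num.Theory.
Import numFieldNormedType.Exports.

Local Open Scope classical_set_scope.
Local Open Scope ring_scope.

(** * Geometry of the Heisenberg group *)

Section heis_geometry.
Context {R : realType} {n : nat}.
Implicit Types (z w : 'rV[R]_(n * 2)) (a b c x y : heis R n).

(** The distance is invariant on the left only: the right translation by [w] is no isometry, but it
    moves every point by exactly the norm of [w] and preserves Haar measure, and this is what the
    integral estimates use. Exponents, with Q = 2n + 2. At a good scale there are about r^(-m) balls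
    of masses G_i with sum at most r^tau, and their images have diameters about r^(1 - Q/p)
    G_i^(1/p). By concavity of G^(al/p) in G for al < p, the al-th powers of the diameters add up to
    about r^(al (1 - Q/p) + (tau + m) al/p - m). This tends to 0 when al > pm/(p - Q + tau + m), and
    equality at al = alpha gives the critical tau0 = Q - m - p (1 - m/alpha). The bad cells
    contribute r^(-tau) (r/rho)^(2n - m) rho^s. This tends to 0 for s > tau when rho = r, and for 2s
    > tau + 2n - m when rho = r^2; at tau0 these thresholds are the two branches of [beta]. The
    constraint r^2 <= rho reflects that a ball of radius r has height about r^2 along the sheared
    horizontal planes: such a height meets boundedly many vertical slots of size rho, so only
    horizontal directions cost a factor r/rho. *)

Lemma enorm_ge0 z : 0 <= enorm z.
Proof. exact: sqrtr_ge0. Qed.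

Lemma enorm_sqr z : enorm z ^+ 2 = dotp z z.
Proof. by rewrite sqr_sqrtr// dotp_ge0. Qed.

Lemma dotpC z w : dotp z w = dotp w z.
Proof. by apply: eq_bigr => k _; rewrite mulrC. Qed.

Lemma dotpZl (e : R) z u : dotp (e *: z) u = e * dotp z u.
Proof. by rewrite /dotp mulr_sumr; apply: eq_bigr => k _; rewrite mxE mulrA. Qed.

Lemma enormN z : enorm (- z) = enorm z.
Proof. by rewrite /enorm dotpNN. Qed.

Lemma enormZ (e : R) z : enorm (e *: z) = `|e| * enorm z.
Proof.
by rewrite /enorm dotpZl dotpC dotpZl mulrA -expr2 sqrtrM ?sqr_ge0// sqrtr_sqr.
Qed.

Lemma enorm0 : enorm (0 : 'rV[R]_(n * 2)) = 0.
Proof. by rewrite -(scale0r 0) enormZ normr0 mul0r. Qed.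

Lemma normr_dotp_le z w : `|dotp z w| <= enorm z * enorm w.
Proof.
rewrite -(@ler_pXn2r _ 2)// ?nnegrE ?mulr_ge0 ?enorm_ge0//.
rewrite exprMn !enorm_sqr real_normK ?num_real//.
by apply: le_trans (dotp_omega_le _ _); rewrite lerDl sqr_ge0.
Qed.

Lemma normr_omega_le z w : `|omega z w| <= enorm z * enorm w.
Proof.
rewrite -(@ler_pXn2r _ 2)// ?nnegrE ?mulr_ge0 ?enorm_ge0//.
rewrite exprMn !enorm_sqr real_normK ?num_real//.
by apply: le_trans (dotp_omega_le _ _); rewrite lerDr sqr_ge0.
Qed.

Lemma enormD z w : enorm (z + w) <= enorm z + enorm w.
Proof.
rewrite -(@ler_pXn2r _ 2)// ?nnegrE ?addr_ge0 ?enorm_ge0//.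
rewrite enorm_sqr dotp_sqrD -!enorm_sqr.
by have := le_trans (ler_norm _) (normr_dotp_le z w); lra.
Qed.

Lemma enorm_sum (I : finType) (F : I -> 'rV[R]_(n * 2)) :
  enorm (\sum_i F i) <= \sum_i enorm (F i).
Proof.
elim/big_ind2: _ => [|z u w v zu wv|//]; first by rewrite enorm0.
exact: le_trans (enormD _ _) (lerD zu wv).
Qed.

Lemma coord_le_enorm z k : `|z ord0 k| <= enorm z.
Proof.
rewrite -(@ler_pXn2r _ 2)// ?nnegrE ?enorm_ge0//.
rewrite real_normK ?num_real// enorm_sqr /dotp (bigD1 k)//= -expr2 lerDl.
by apply: sumr_ge0 => j _; rewrite -expr2 sqr_ge0.
Qed.

Lemma enorm_le_coord z (e : R) : (forall k, `|z ord0 k| <= e) ->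
  enorm z <= (n * 2)%:R * e.
Proof.
move=> ze; have [n0|n0] := posnP (n * 2)%N.
  suff -> : z = 0 by rewrite enorm0 n0 mul0r.
  by apply/rowP => k; case: k => k kn; exfalso; move: kn; rewrite n0.
have e0 : 0 <= e by exact: le_trans (normr_ge0 _) (ze (Ordinal n0)).
rewrite -(@ler_pXn2r _ 2)// ?nnegrE ?mulr_ge0 ?enorm_ge0//.
rewrite enorm_sqr /dotp exprMn (@le_trans _ _ (\sum_(k < n * 2) e ^+ 2))//.
  apply: ler_sum => k _; rewrite -expr2 -real_normK ?num_real//.
  by rewrite ler_pXn2r// ?nnegrE.
rewrite sumr_const card_ord -[_ *+ _]mulr_natl ler_wpM2r ?sqr_ge0//.
by rewrite -natrX ler_nat expnS expn1 leq_pmulr.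
Qed.

Lemma omegaZl (e : R) z w : omega (e *: z) w = e * omega z w.
Proof.
rewrite /omega mulr_sumr; apply: eq_bigr => i _.
by rewrite /xcoord /ycoord !mxE; ring.
Qed.

Lemma omegaZr (e : R) z w : omega z (e *: w) = e * omega z w.
Proof. by rewrite omegaC omegaZl omegaC mulrN opprK. Qed.

Definition omega_simp := (@omegaDl R n, @omegaDr R n, @omegaNl R n, @omegaNr R n,
  @omegazz R n, omegaZl, omegaZr).

Lemma omega0l w : omega (0 : 'rV[R]_(n * 2)) w = 0.
Proof. by rewrite -(scale0r 0) omegaZl mul0r. Qed.

Lemma omega0r w : omega w (0 : 'rV[R]_(n * 2)) = 0.
Proof. by rewrite omegaC omega0l oppr0. Qed.

Lemma heis_mulA a b c : heis_mul a (heis_mul b c) = heis_mul (heis_mul a b) c.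
Proof.
rewrite /heis_mul /=; congr (_, _); first by rewrite addrA.
by rewrite !omega_simp; ring.
Qed.

Lemma heis_mulVl a b : heis_mul (heis_inv a) (heis_mul a b) = b.
Proof.
rewrite /heis_mul /heis_inv /= [RHS]surjective_pairing.
congr (_, _); first by rewrite addKr.
by rewrite !omega_simp; ring.
Qed.

Lemma heis_mul0 a : heis_mul a (0, 0) = a.
Proof.
by rewrite /heis_mul /= omega0r mulr0 !addr0 -surjective_pairing.
Qed.

Lemma heis_dist_mul a x y : heis_dist (heis_mul a x) (heis_mul a y) = heis_dist x y.
Proof.
rewrite /heis_dist; congr koranyi.
rewrite /heis_mul /heis_inv /=; congr (_, _).
  by rewrite opprD addrACA addNr add0r.
by rewrite !omega_simp (omegaC x.1 a.1); ring.
Qed.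

Lemma heis_dist4 x y : heis_dist x y ^+ 4 =
  enorm (y.1 - x.1) ^+ 4 + (y.2 - x.2 - 2 * omega x.1 y.1) ^+ 2.
Proof.
rewrite /heis_dist koranyi4 /= -enorm_sqr -exprM omegaNl [- x.1 + _]addrC.
by congr (_ + _ ^+ 2); ring.
Qed.

Lemma heis_dist_ge0 x y : 0 <= heis_dist x y.
Proof. exact: powR_ge0. Qed.

Lemma enorm_le_heis_dist x y : enorm (y.1 - x.1) <= heis_dist x y.
Proof.
rewrite -(@ler_pXn2r _ 4)// ?nnegrE ?enorm_ge0 ?heis_dist_ge0//.
by rewrite heis_dist4 lerDl sqr_ge0.
Qed.

Lemma vert_le_heis_dist x y :
  `|y.2 - x.2 - 2 * omega x.1 y.1| <= heis_dist x y ^+ 2.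
Proof.
rewrite -(@ler_pXn2r _ 2)// ?nnegrE ?sqr_ge0// -exprM.
by rewrite heis_dist4 real_normK ?num_real// lerDr exprn_ge0// enorm_ge0.
Qed.

(** Converse of the two preceding bounds. The fourth power of the distance is at most 2 r^4, so the
    factor 2 is generous. *)
Lemma heis_dist_le x y (r : R) : 0 <= r -> enorm (y.1 - x.1) <= r ->
  `|y.2 - x.2 - 2 * omega x.1 y.1| <= r ^+ 2 -> heis_dist x y <= 2 * r.
Proof.
move=> r0 h1 h2.
rewrite -(@ler_pXn2r _ 4)// ?nnegrE ?mulr_ge0 ?heis_dist_ge0//.
rewrite heis_dist4 exprMn.
have : enorm (y.1 - x.1) ^+ 4 <= r ^+ 4 by rewrite ler_pXn2r ?nnegrE ?enorm_ge0.
have : (y.2 - x.2 - 2 * omega x.1 y.1) ^+ 2 <= r ^+ 4.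
  rewrite -[leLHS]real_normK ?num_real// -[4%N]/(2 * 2)%N exprM.
  by rewrite ler_pXn2r ?nnegrE ?sqr_ge0.
have : 0 <= r ^+ 4 by rewrite exprn_ge0.
by nra.
Qed.

(** Cosets of isotropic subspaces carry the Euclidean metric. This serves both for single segments
    and for the grids laid on a coset. *)
Lemma heis_dist_horizontal a z w : omega z w = 0 ->
  heis_dist (heis_mul a (z, 0)) (heis_mul a (w, 0)) = enorm (w - z).
Proof.
move=> zw0; rewrite heis_dist_mul.
apply/eqP; rewrite -(@eqrXn2 _ 4)// ?heis_dist_ge0 ?enorm_ge0//.
by rewrite heis_dist4 /= zw0 mulr0 !subr0 expr0n addr0.
Qed.

Lemma heis_dist_mulr a (w : heis R n) : heis_dist a (heis_mul a w) = koranyi w.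
Proof. by rewrite /heis_dist heis_mulVl. Qed.

End heis_geometry.

(** * Open sets and continuity expressed by the distance *)

Section metric_open.
Context {R : realType} {X : metricType R}.

Lemma metric_nbhsP (x : X) (A : set X) :
  nbhs x A <-> exists2 e : R, 0 < e & [set y | mdist x y < e] `<=` A.
Proof.
split=> [/nbhs_ballP[e /= e0 xeA]|[e e0 xeA]].
  by exists e => //; rewrite -ballEmdist.
by apply/nbhs_ballP; exists e => //; rewrite ballEmdist.
Qed.

Lemma metric_openP (A : set X) :
  open A <-> forall x, A x -> exists2 e : R, 0 < e & [set y | mdist x y < e] `<=` A.
Proof.
rewrite openE; split=> [oA x /oA /metric_nbhsP//|h x Ax].
exact/metric_nbhsP/h.
Qed.

Lemma open_mdist_lt (x : X) (r : R) : open [set y | mdist x y < r].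
Proof.
apply/metric_openP => y /= xyr; exists (r - mdist x y); first by rewrite subr_gt0.
move=> z /= yz; apply: le_lt_trans (metric_triangle _ y _) _.
by rewrite -ltrBrDl.
Qed.

Lemma metric_continuousP (u : X -> R) :
  (forall x e, 0 < e -> exists2 d : R, 0 < d &
    forall y, mdist x y < d -> `|u x - u y| < e) -> continuous u.
Proof.
move=> h x; apply/cvgrPdist_lt => e e0; have [d d0 xd] := h x e e0.
by apply/metric_nbhsP; exists d.
Qed.

Lemma metric_continuous_mdist (x0 : X) : continuous (mdist x0).
Proof.
apply: metric_continuousP => x e e0; exists e => // y xy.
rewrite ltr_norml; have := metric_triangle x0 x y.
by have := metric_triangle x0 y x; rewrite (metric_sym y x); lra.
Qed.

End metric_open.

(** * The Borel sigma-algebra of the group and its coordinates *)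

Notation heisB R n := (g_sigma_algebraType (@open (heis R n))).

Section heis_borel.
Context {R : realType} {n : nat}.
Implicit Types (x y : heis R n).

Lemma measurable_heis_open (U : set (heis R n)) :
  open U -> measurable (U : set (heisB R n)).
Proof. exact: sub_sigma_algebra. Qed.

Lemma measurable_heis_continuous (u : heis R n -> R) :
  continuous u -> measurable_fun setT (u : heisB R n -> R).
Proof.
move=> /continuousP cf; apply: (measurability _ (RGenOpens.measurableE R)).
move=> _ [_ [a [b ->] <-]]; rewrite setTI; apply: measurable_heis_open.
exact/cf/interval_open.
Qed.

Lemma continuous_coord (k : 'I_(n * 2)) :
  continuous (fun x : heis R n => x.1 ord0 k).
Proof.
apply: metric_continuousP => x e e0; exists e => // y xy.
apply: le_lt_trans xy; rewrite distrC.
have := enorm_le_heis_dist x y; apply: le_trans.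
by have := coord_le_enorm (y.1 - x.1) k; rewrite !mxE.
Qed.

(** The height is not Lipschitz: the second term is the shear [omega x.1 y.1], which equals
    [omega x.1 (y.1 - x.1)] and so is small with the distance, though only locally uniformly in
    [x]. *)
Lemma vert_dist_le x y :
  `|x.2 - y.2| <= heis_dist x y ^+ 2 + 2 * enorm x.1 * heis_dist x y.
Proof.
have h1 := vert_le_heis_dist x y.
have h2 := normr_omega_le x.1 (y.1 - x.1).
have h3 : enorm x.1 * enorm (y.1 - x.1) <= enorm x.1 * heis_dist x y.
  by rewrite ler_wpM2l ?enorm_ge0 ?enorm_le_heis_dist.
rewrite !omega_simp subr0 in h2.
move: h1 h2 h3; rewrite !ler_norml => /andP[? ?] /andP[? ?] ?.
by apply/andP; split; lra.
Qed.

Lemma continuous_vert : continuous (fun x : heis R n => x.2).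
Proof.
apply: metric_continuousP => x e e0.
have c0 : 0 < 1 + 2 * enorm x.1 by have := enorm_ge0 x.1; lra.
exists (Num.min 1 (e / (1 + 2 * enorm x.1))).
  by rewrite lt_min ltr01 divr_gt0.
move=> y; rewrite lt_min => /andP[d1 de].
apply: le_lt_trans (vert_dist_le x y) _.
move: de; rewrite ltr_pdivlMr//; have := heis_dist_ge0 x y.
by move: d1; rewrite -[mdist x y]/(heis_dist x y); set d := heis_dist x y; nra.
Qed.

(** A Euclidean cube, hence a product set. Cubes with rational data form a countable base and link
    the topology of the distance with the coordinates. *)
Definition heis_cube (q : heis R n) (e : R) : set (heis R n) :=
  [set x : heis R n | (forall k, `|x.1 ord0 k - q.1 ord0 k| < e) /\ `|x.2 - q.2| < e].

Lemma heis_cube_sub_ball x (r : R) : 0 < r -> exists2 e : R, 0 < e &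
  heis_cube x e `<=` [set y | heis_dist x y < r].
Proof.
(* [c * e] dominates both the horizontal deviation N e and the vertical one e + 2 |x| N e. The first
   must stay below [s] and the second below [s ^+ 2], whence the minimum. *)
move=> r0; pose N : R := (n * 2)%:R; pose c := 1 + N + 2 * enorm x.1 * N.
have N0 : 0 <= N by exact: ler0n.
have X0 : 0 <= enorm x.1 by exact: enorm_ge0.
have XN : 0 <= enorm x.1 * N by rewrite mulr_ge0.
have c0 : 0 < c by rewrite /c; lra.
pose s := r / 4.
have s0 : 0 < s by rewrite divr_gt0.
exists (Num.min s (s ^+ 2) / c).
  by rewrite divr_gt0// lt_min s0 exprn_gt0.
set e := _ / c; have ec : e * c = Num.min s (s ^+ 2) by rewrite divfK// gt_eqF.
have e0 : 0 < e by rewrite divr_gt0// lt_min s0 exprn_gt0.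
have es : e * c <= s by rewrite ec ge_min lexx.
have es2 : e * c <= s ^+ 2 by rewrite ec ge_min lexx orbT.
move=> y [ye1 ye2] /=.
have h1 : enorm (y.1 - x.1) <= N * e.
  by apply: enorm_le_coord => k; rewrite !mxE ltW.
have h2 := normr_omega_le x.1 (y.1 - x.1).
rewrite !omega_simp subr0 in h2.
have h3 : enorm x.1 * enorm (y.1 - x.1) <= enorm x.1 * (N * e).
  by rewrite ler_wpM2l.
apply: le_lt_trans (_ : 2 * s < r); last by rewrite /s; lra.
apply: heis_dist_le; first exact: ltW.
  apply: le_trans h1 _; apply: le_trans es.
  by rewrite /c; nra.
apply: le_trans es2; rewrite /c.
move: (ltW ye2) h2 h3; rewrite !ler_norml => /andP[? ?] /andP[? ?] ?.
by apply/andP; split; nra.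
Qed.

Lemma rat_approx (a e : R) : 0 < e -> exists q : rat, `|a - ratr q| < e.
Proof.
move=> e0; have /rat_in_itvoo[q] : a - e < a + e by lra.
rewrite in_itv /= => /andP[? ?]; exists q.
by rewrite ltr_norml; apply/andP; split; lra.
Qed.

Definition rat_heis (q : 'rV[rat]_(n * 2) * rat) : heis R n :=
  (\row_k ratr (q.1 ord0 k), ratr q.2).

Lemma rat_heis_approx x (e : R) : 0 < e -> exists q, heis_cube (rat_heis q) e x.
Proof.
move=> e0; have [f fe] := @choice _ _ (fun k q => `|x.1 ord0 k - ratr q| < e)
  (fun k => rat_approx (x.1 ord0 k) e0).
have [t te] := rat_approx x.2 e0.
exists (\row_k f k, t); split => //= k.
by rewrite !mxE.
Qed.

Lemma rat_heis_dense x (r : R) : 0 < r -> exists q, heis_dist (rat_heis q) x < r.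
Proof.
move=> /(heis_cube_sub_ball x)[e e0 xe]; have [q [q1 q2]] := rat_heis_approx x e0.
exists q; rewrite heis_dist_sym; apply: xe; split => [k|].
  by rewrite distrC.
by rewrite distrC.
Qed.

(** A rational cube of radius below e/2 that contains [x] lies in the cube of radius e about [x].
    The union runs over a countable index set. *)
Lemma heis_open_cubes (U : set (heis R n)) : open U ->
  U = \bigcup_(i in [set i : ('rV[rat]_(n * 2) * rat) * nat |
        heis_cube (rat_heis i.1) (i.2.+1%:R^-1) `<=` U])
      heis_cube (rat_heis i.1) (i.2.+1%:R^-1).
Proof.
move=> /metric_openP oU; apply/seteqP; split=> [x Ux|x [i /= iU]]; last exact: iU.
have [r r0 xrU] := oU x Ux; have [e e0 xe] := heis_cube_sub_ball x r0.
have [k ke] : exists k : nat, k.+1%:R^-1 < e / 2.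
  have e20 : 0 < e / 2 by rewrite divr_gt0.
  have [k _ kP] := near_infty_natSinv_lt (PosNum e20).
  by exists k; apply: (kP k); exact: leqnn.
have k0 : (0 : R) < k.+1%:R^-1 by rewrite invr_gt0.
have [q qx] := rat_heis_approx x k0; exists (q, k) => //=.
move: ke k0 qx; set h : R := k.+1%:R^-1 => ke k0 qx.
move=> y [qy1 qy2]; apply/xrU/xe; case: qx => qx1 qx2; split => [j|].
  have := qx1 j; have := qy1 j; rewrite !ltr_norml => /andP[? ?] /andP[? ?].
  by apply/andP; split; lra.
move: qx2 qy2; rewrite !ltr_norml => /andP[? ?] /andP[? ?].
by apply/andP; split; lra.
Qed.

(** Open sets being countable unions of cubes, the Borel sigma-algebra is generated by the
    coordinates. *)
Lemma measurable_fun_heisP d (T : measurableType d) (F : T -> heisB R n) :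
  (forall k, measurable_fun setT (fun t => (F t).1 ord0 k)) ->
  measurable_fun setT (fun t => (F t).2) -> measurable_fun setT F.
Proof.
move=> F1 F2; have := @measurability _ _ T (heisB R n) setT F (@open (heis R n)).
apply => //.
move=> _ [U oU <-]; rewrite setTI (heis_open_cubes oU) preimage_bigcup.
rewrite bigcup_mkcond; apply: countable_bigcupT_measurable => [|[q k]].
  exact: countableP.
case: ifP => // _.
have -> : F @^-1` heis_cube (rat_heis q) k.+1%:R^-1 =
    (\bigcap_(j in [set: 'I_(n * 2)])
      (fun t => (F t).1 ord0 j) @^-1` ball ((rat_heis q).1 ord0 j) k.+1%:R^-1) `&`
    (fun t => (F t).2) @^-1` ball (rat_heis q).2 k.+1%:R^-1.
  apply/seteqP; split => t /=.
    by case=> h1 h2; split => [j _|]; rewrite /ball/= distrC.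
  by case=> h1 h2; split => [j|]; rewrite distrC; [exact: h1|exact: h2].
apply: measurableI; last first.
  rewrite -[X in measurable X]setTI; apply: F2 => //; exact: measurable_ball.
apply: fin_bigcap_measurable => // j _.
rewrite -[X in measurable X]setTI; apply: F1 => //; exact: measurable_ball.
Qed.

Lemma measurable_coord (k : 'I_(n * 2)) :
  measurable_fun setT (fun x : heisB R n => x.1 ord0 k).
Proof. exact: measurable_heis_continuous (@continuous_coord k). Qed.

Lemma measurable_vert : measurable_fun setT (fun x : heisB R n => x.2).
Proof. exact: measurable_heis_continuous continuous_vert. Qed.

End heis_borel.

(** * Haar measure of the Heisenberg group *)

Section measure_tools.
Local Open Scope ereal_scope.
Context {R : realType}.

Lemma pushforward_measure d d' (T : measurableType d) (T' : measurableType d')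
    (m : {measure set T -> \bar R}) (f : T -> T') : measurable_fun setT f ->
  {mu : {measure set T' -> \bar R} | (forall A, mu A = m (f @^-1` A)) /\
    (forall h, measurable_fun setT h -> (forall y, 0 <= h y) ->
      \int[mu]_y h y = \int[m]_x h (f x))}.
Proof.
move=> mf; unshelve eexists [the {measure set T' -> \bar R} of pushforward m f].
  exact: mf.
split => // h mh h0.
by rewrite ge0_integral_pushforward// preimage_setT.
Qed.

Lemma measure_preserving_integral d (T : measurableType d)
    (m : {measure set T -> \bar R}) (f : T -> T) : measurable_fun setT f ->
  (forall A, measurable A -> m (f @^-1` A) = m A) ->
  forall h, measurable_fun setT h -> (forall y, 0 <= h y) ->
    \int[m]_x h (f x) = \int[m]_x h x.
Proof.
move=> mf fm h mh h0; have [mu [muE muI]] := pushforward_measure m mf.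
rewrite -muI//; apply: eq_measure_integral => A mA _.
by rewrite muE fm.
Qed.

End measure_tools.

Section sigma_finite_pack.
Local Open Scope ereal_scope.
Context d (T : measurableType d) {R : realType}.
Variables (mu : {measure set T -> \bar R}) (smu : sigma_finite setT mu).

(** The proof of sigma-finiteness is an argument so that the instances below can recover it from the
    term. *)
Definition sigma_finite_measure_of (_ : sigma_finite setT mu) : set T -> \bar R := mu.

Let mu0 : sigma_finite_measure_of smu set0 = 0.
Proof. exact: measure0. Qed.

Let mu_ge0 A : 0 <= sigma_finite_measure_of smu A.
Proof. exact: measure_ge0. Qed.

Let mu_sigma_additive : semi_sigma_additive (sigma_finite_measure_of smu).
Proof. exact: measure_semi_sigma_additive. Qed.

HB.instance Definition _ := isMeasure.Build _ _ _ (sigma_finite_measure_of smu)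
  mu0 mu_ge0 mu_sigma_additive.

HB.instance Definition _ := Measure_isSigmaFinite.Build _ _ _
  (sigma_finite_measure_of smu) smu.

End sigma_finite_pack.

(** * Lebesgue measure on tuples *)

Section lebesgue_tuple.
Local Open Scope ereal_scope.
Context {R : realType}.
Local Notation leb := (@lebesgue_measure R).
Local Notation T := (measurableTypeR R).

Lemma measurable_add (a : R) : measurable_fun setT (fun x : T => (x + a)%R : T).
Proof. exact: measurable_funD. Qed.

Lemma lebesgue_measure_translate (a : R) (A : set T) : measurable A ->
  leb ((fun x : T => (x + a)%R : T) @^-1` A) = leb A.
Proof.
move=> mA; have [mu [muE _]] := pushforward_measure leb (measurable_add a).
rewrite -muE; apply/esym/lebesgue_measure_unique => // _ [[c b]] _ <-.
rewrite muE (_ : _ @^-1` _ = `](c - a)%R, (b - a)%R]%classic); last first.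
  by apply/seteqP; split => x /=; rewrite !in_itv /= ltrBlDr lerBrDr.
rewrite lebesgue_measure_itv [RHS](lebesgue_measure_itv `](c - a)%R, (b - a)%R]) /= !lte_fin ltrD2r.
by case: ifP => // _; congr (_%:E); lra.
Qed.

Definition tuple_add N (w x : N.-tuple T) : N.-tuple T :=
  [tuple (tnth x i + tnth w i)%R | i < N].

Lemma measurable_tuple_add N (w : N.-tuple T) : measurable_fun setT (tuple_add w).
Proof.
apply/measurable_fun_tnthP => i; rewrite /comp /=.
under eq_fun do rewrite tnth_mktuple.
exact: measurable_funD (measurable_tnth i) (measurable_cst _).
Qed.

Definition tuple_box N (A : 'I_N -> set T) : set (N.-tuple T) :=
  [set x | forall i, A i (tnth x i)].

(** Specification that hides the construction: the volume of cube-like boxes normalises the measure,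
    translation invariance turns into invariance under the group. *)
Definition lebesgue_like N (mu : set (N.-tuple T) -> \bar R) : Prop :=
  (forall A (c : R), (0 <= c)%R -> (forall i, measurable (A i)) ->
     (forall i, leb (A i) = c%:E) -> mu (tuple_box A) = (c ^+ N)%:E) /\
  (forall w A, measurable A -> mu (tuple_add w @^-1` A) = mu A).

Lemma measurable_tuple_box N (A : 'I_N -> set T) :
  (forall i, measurable (A i)) -> measurable (tuple_box A).
Proof.
move=> mA; rewrite (_ : tuple_box A = \bigcap_(i in [set: 'I_N])
  ((fun x : N.-tuple T => tnth x i) @^-1` A i)); last first.
  by apply/seteqP; split => x /= h i => [_|]; exact: h.
apply: fin_bigcap_measurable => // i _; rewrite -[X in measurable X]setTI.
by apply: (@measurable_tnth _ T N i) => //; exact: mA.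
Qed.

Lemma lebesgue_like_sigma_finite N (mu : {measure set (N.-tuple T) -> \bar R}) :
  lebesgue_like mu -> sigma_finite setT mu.
Proof.
move=> [muE _]; pose B (k : nat) : set T := `[(- k%:R)%R, k%:R%R]%classic.
exists (fun k => tuple_box (fun=> B k)).
  apply/seteqP; split => // x _.
  exists (Num.bound (\sum_i `|tnth x i|)%R) => //= i; rewrite /B /= in_itv /=.
  rewrite -ler_norml; apply/ltW/(le_lt_trans _ (archi_boundP _)).
    rewrite (bigD1 i)//= lerDl; exact: sumr_ge0.
  exact: sumr_ge0.
move=> k; split; first by apply: measurable_tuple_box => i; exact: measurable_itv.
have BE (i : 'I_N) : leb (B k) = (k%:R *+ 2)%:E.
  rewrite /B lebesgue_measure_itv /= lte_fin -EFinB opprK -mulr2n.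
  case: ifP => // /negbT; rewrite -leNgt => h; congr EFin.
  by have := ler0n R k; lra.
have k0 : (0 <= k%:R *+ 2 :> R)%R by rewrite mulrn_wge0.
have mB (i : 'I_N) : measurable (B k) by exact: measurable_itv.
by rewrite (muE _ _ k0 mB BE) ltry.
Qed.

Lemma lebesgue_tuple_exists N :
  {mu : {sigma_finite_measure set (N.-tuple T) -> \bar R} | lebesgue_like mu}.
Proof.
suff [mu lmu] : {mu : {measure set (N.-tuple T) -> \bar R} | lebesgue_like mu}.
  by exists (sigma_finite_measure_of (lebesgue_like_sigma_finite lmu)).
elim: N => [|N [mu lmu]].
  (* In dimension 0 the only box is the whole one-point space, of measure [c ^+ 0 = 1]. *)
  exists (@dirac _ (0.-tuple T) [tuple] R); split => [A c _ mA _|w A mA].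
    by rewrite expr0 /= diracE mem_set// => -[].
  rewrite (_ : tuple_add w @^-1` A = A)//.
  by apply/seteqP; split => x; rewrite /= !(tuple0 (tuple_add _ _)) !(tuple0 x).
pose mu' := sigma_finite_measure_of (lebesgue_like_sigma_finite lmu).
pose P := leb \x mu'.
pose f (p : T * N.-tuple T) : N.+1.-tuple T := [the N.+1.-tuple T of p.1 :: p.2].
have mf : measurable_fun setT f by exact: measurable_cons.
have [nu [nuE _]] := pushforward_measure P mf.
exists nu; split => [A c c0 mA Ac|w A mA]; rewrite !nuE.
  rewrite (_ : f @^-1` _ = A ord0 `*` tuple_box (fun i => A (lift ord0 i))).
    transitivity (leb (A ord0) * mu (tuple_box (fun i => A (lift ord0 i)))).
      by apply: product_measure1E => //; exact: measurable_tuple_box.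
    by rewrite Ac (lmu.1 _ c)// exprS EFinM.
  apply/seteqP; split => [[a t] h|[a t] [/= h1 h2] i].
    split => [|i /=]; first exact: (h ord0).
    by have := h (lift ord0 i); rewrite /f tnthS.
  case: (unliftP ord0 i) => [j ->|->]; last exact: h1.
  by rewrite /f tnthS; exact: h2.
have mX : measurable (f @^-1` A) by rewrite -[X in measurable X]setTI; exact: mf.
pose w0 := tnth w ord0; pose w' : N.-tuple T := [tuple of behead w].
pose s (p : T * N.-tuple T) := ((p.1 + w0)%R : T, tuple_add w' p.2).
have ms : measurable_fun setT s.
  apply/measurable_fun_pairP; split.
    exact: measurable_funD.
  exact: measurableT_comp (measurable_tuple_add w') measurable_snd.
have [nu' [nu'E _]] := pushforward_measure P ms.
rewrite (_ : f @^-1` (tuple_add w @^-1` A) = s @^-1` (f @^-1` A)); last first.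
  apply/seteqP; split => -[a t] /=; rewrite (_ : tuple_add w (f (a, t)) = f (s (a, t)))//;
    (apply: eq_from_tnth => i; rewrite tnth_mktuple /f;
     case: (unliftP ord0 i) => [j ->|-> //]; rewrite !tnthS tnth_mktuple;
     congr (_ + _)%R; rewrite /w' [in LHS](tuple_eta w) tnthS //).
(* Invariance need only be checked on rectangles: the image of the product measure under the
   translation [s] is then the product measure by uniqueness. *)
rewrite -nu'E; apply/esym; apply: product_measure_unique => // B C mB mC.
rewrite nu'E (_ : s @^-1` _ = ((fun x : T => (x + w0)%R : T) @^-1` B) `*` (tuple_add w' @^-1` C))//.
transitivity (leb ((fun x : T => (x + w0)%R : T) @^-1` B) * mu (tuple_add w' @^-1` C)).
  apply: product_measure1E.
    by rewrite -[X in measurable X]setTI; exact: measurable_add.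
  by have /(_ measurableT _ mC) := measurable_tuple_add w'; rewrite setTI.
by rewrite lebesgue_measure_translate// lmu.2.
Qed.

End lebesgue_tuple.

Section shear.
Local Open Scope ereal_scope.
Context {R : realType} (N : nat).
Local Notation leb := (@lebesgue_measure R).
Local Notation T := (measurableTypeR R).
Variables (mu : {measure set (N.-tuple T) -> \bar R}) (lmu : lebesgue_like mu).

(* Left and right translations of the group are, in coordinates, a translation
   of the horizontal part followed by such a vertical shear. *)
Lemma shear_preserving (w : N.-tuple T) (c : N.-tuple T -> R) (X : set (N.-tuple T * T)) :
  measurable X ->
  (mu \x leb) [set p | X (tuple_add w p.1, (p.2 + c p.1)%R)] = (mu \x leb) X.
Proof.
move=> mX; rewrite /product_measure1.
transitivity (\int[mu]_x (leb \o xsection X) (tuple_add w x)).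
  apply: eq_integral => x _ /=.
  rewrite -[RHS](lebesgue_measure_translate (c x)); last exact: (measurable_xsection _ mX).
  by congr (leb _); apply/seteqP; split => t; rewrite /xsection /= !inE.
apply: measure_preserving_integral => //.
- exact: measurable_tuple_add.
- exact: lmu.2.
- exact: measurable_fun_xsection.
Qed.

End shear.

(** * Bi-invariant Haar measure, normalised on boxes *)

Section heis_lebesgue.
Local Open Scope ereal_scope.
Context {R : realType} {n : nat}.
Local Notation leb := (@lebesgue_measure R).
Local Notation T := (measurableTypeR R).
Implicit Types (x y w : heis R n).

(** The left translate by [y] of the parabolic box with sides 2r and height 2r^2 at the origin. It
    replaces the ball because its Haar measure is explicit. *)
Definition heis_box y (r : R) : set (heis R n) :=
  [set x : heis R n | (forall k, `|x.1 ord0 k - y.1 ord0 k| <= r)%R /\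
    (`|x.2 - y.2 - 2 * omega y.1 x.1| <= r ^+ 2)%R].

(** The exponent of [r] is the homogeneous dimension: [n * 2] horizontal sides and a height that
    scales like [r ^+ 2]. *)
Definition heis_lebesgue (L : set (heisB R n) -> \bar R) : Prop :=
  [/\ forall y (r : R), (0 <= r)%R ->
        L (heis_box y r) = (2 ^+ (n * 2).+1 * r ^+ (n * 2).+2)%:E,
      forall w (A : set (heisB R n)), measurable A -> L (heis_mul w @^-1` A) = L A &
      forall w (A : set (heisB R n)), measurable A -> L (heis_mul^~ w @^-1` A) = L A].

Lemma measurable_fun_omegal d (T' : measurableType d) (F : T' -> heisB R n) w :
  measurable_fun setT F -> measurable_fun setT (fun t => omega (F t).1 w.1).
Proof.
move=> mF; apply: measurable_sum => i; apply: measurable_funB.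
  apply: measurable_funM => //.
  exact: measurableT_comp (measurable_coord _) mF.
apply: measurable_funM => //.
exact: measurableT_comp (measurable_coord _) mF.
Qed.

Lemma measurable_fun_omegar d (T' : measurableType d) (F : T' -> heisB R n) w :
  measurable_fun setT F -> measurable_fun setT (fun t => omega w.1 (F t).1).
Proof.
move=> mF; under eq_fun do rewrite omegaC.
by apply: measurableT_comp => //; exact: measurable_fun_omegal.
Qed.

Lemma measurable_fun_omega d (T' : measurableType d) (F G : T' -> heisB R n) :
  measurable_fun setT F -> measurable_fun setT G ->
  measurable_fun setT (fun t => omega (F t).1 (G t).1).
Proof.
move=> mF mG; apply: measurable_sum => i; apply: measurable_funB;
  apply: measurable_funM; exact: measurableT_comp (measurable_coord _) _.
Qed.

Lemma measurable_fun_heis_mul d (T' : measurableType d) (F G : T' -> heisB R n) :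
  measurable_fun setT F -> measurable_fun setT G ->
  measurable_fun setT (fun t => heis_mul (F t) (G t) : heisB R n).
Proof.
move=> mF mG; apply: measurable_fun_heisP => [k|] /=.
  under eq_fun do rewrite mxE.
  by apply: measurable_funD; exact: measurableT_comp (measurable_coord _) _.
apply: measurable_funD; first by apply: measurable_funD;
  exact: measurableT_comp measurable_vert _.
by apply: measurable_funM => //; exact: measurable_fun_omega.
Qed.

Lemma measurable_heis_box y (r : R) : measurable (heis_box y r : set (heisB R n)).
Proof.
rewrite (_ : heis_box y r = (\bigcap_(k in [set: 'I_(n * 2)])
    ((fun x : heisB R n => x.1 ord0 k - y.1 ord0 k)%R @^-1` `[(- r)%R, r])) `&`
    ((fun x : heisB R n => x.2 - y.2 - 2 * omega y.1 x.1)%R @^-1`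
      `[(- r ^+ 2)%R, (r ^+ 2)%R])); last first.
  apply/seteqP; split => x /= [h1 h2]; split.
  - by move=> k _ /=; rewrite in_itv /= -ler_norml.
  - by rewrite in_itv /= -ler_norml.
  - by move=> k; have := h1 k I; rewrite /= in_itv /= -ler_norml.
  - by move: h2; rewrite in_itv /= -ler_norml.
apply: measurableI.
  apply: fin_bigcap_measurable => // k _; rewrite -[X in measurable X]setTI.
  apply: measurable_funB => //; exact: measurable_coord.
rewrite -[X in measurable X]setTI.
apply: measurable_funB => //; first by apply: measurable_funB => //; exact: measurable_vert.
by apply: measurable_funM => //; exact: measurable_fun_omegar.
Qed.

Lemma heis_box_inv_mul y (r : R) x :
  heis_box (0, 0)%R r (heis_mul (heis_inv y) x) <-> heis_box y r x.
Proof.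
have e2 : ((heis_mul (heis_inv y) x).2 - 0 - 2 * omega (0 : 'rV[R]_(n * 2))
    (heis_mul (heis_inv y) x).1 = x.2 - y.2 - 2 * omega y.1 x.1)%R.
  by rewrite /= omega0l omegaNl; ring.
have e1 k : ((heis_mul (heis_inv y) x).1 ord0 k - (0 : 'rV[R]_(n * 2)) ord0 k =
    x.1 ord0 k - y.1 ord0 k)%R by rewrite !mxE; ring.
split => -[h1 h2]; (split=> [k|]; last by rewrite ?e2 // -e2).
  by rewrite -e1; exact: h1.
by rewrite e1; exact: h1.
Qed.

Lemma heis_lebesgue_exists :
  {L : {sigma_finite_measure set (heisB R n) -> \bar R} | heis_lebesgue L}.
Proof.
have [mu lmu] := @lebesgue_tuple_exists R (n * 2).
pose P := mu \x leb.
pose f (p : (n * 2).-tuple T * T) : heisB R n := (\row_k tnth p.1 k, p.2)%R.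
pose g (x : heis R n) : (n * 2).-tuple T := [tuple x.1 ord0 k | k < n * 2]%R.
have mf : measurable_fun setT f.
  apply: measurable_fun_heisP => [k|]; last exact: measurable_snd.
  rewrite (_ : (fun _ => _) = (fun p => tnth p.1 k)); last first.
    by apply/funext => p; rewrite /f /= mxE.
  exact: measurableT_comp (measurable_tnth k) measurable_fst.
have gf (s : (n * 2).-tuple T) (t : R) : g (f (s, t)) = s.
  by apply: eq_from_tnth => k; rewrite tnth_mktuple /f /= mxE.
have fD (s : (n * 2).-tuple T) w (t t' : R) : (f (tuple_add (g w) s, t)).1 = ((f (s, t')).1 + w.1)%R.
  by apply/rowP => k; rewrite /f /= !mxE !tnth_mktuple.
have [nu [nuE _]] := pushforward_measure P mf.
have Lr w (A : set (heisB R n)) : measurable A -> nu (heis_mul^~ w @^-1` A) = nu A.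
  move=> mA; rewrite !nuE.
  have mX : measurable (f @^-1` A) by rewrite -[X in measurable X]setTI; exact: mf.
  have sh := shear_preserving lmu (g w)
    (fun t => w.2 + 2 * omega (f (t, 0%R)).1 w.1)%R mX.
  etransitivity; last exact: sh.
  congr (_ _); apply/seteqP; split => -[s t] /=;
    by rewrite /heis_mul /= -(fD _ _ t 0%R) addrA.
have Ll w (A : set (heisB R n)) : measurable A -> nu (heis_mul w @^-1` A) = nu A.
  move=> mA; rewrite !nuE.
  have mX : measurable (f @^-1` A) by rewrite -[X in measurable X]setTI; exact: mf.
  have sh := shear_preserving lmu (g w)
    (fun t => w.2 + 2 * omega w.1 (f (t, 0%R)).1)%R mX.
  etransitivity; last exact: sh.
  congr (_ _); apply/seteqP; split => -[s t] /=;
    by rewrite /heis_mul /= [(w.1 + _)%R]addrC -(fD _ _ t 0%R) [(w.2 + t)%R]addrC addrA.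
have nu_box y (r : R) : (0 <= r)%R ->
    nu (heis_box y r) = (2 ^+ (n * 2).+1 * r ^+ (n * 2).+2)%:E.
  (* Left invariance moves the box to the origin, where the shear vanishes and the box is a genuine
     product. *)
  move=> r0; rewrite -(Ll y); last exact: measurable_heis_box.
  rewrite (_ : _ @^-1` _ = heis_box (0, 0)%R r); last first.
    apply/seteqP; split => x /=.
      by move=> /heis_box_inv_mul; rewrite heis_mulVl.
    by move=> h; apply/heis_box_inv_mul; rewrite heis_mulVl.
  rewrite nuE (_ : f @^-1` _ = tuple_box (fun=> `[(- r)%R, r]%classic) `*`
      `[(- r ^+ 2)%R, (r ^+ 2)%R]%classic); last first.
    apply/seteqP; split => -[s t] [/= h1 h2]; split => [k|] /=.
    - by have := h1 k; rewrite !mxE subr0 /= in_itv /= -ler_norml.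
    - by move: h2; rewrite omega0l mulr0 !subr0 in_itv /= -ler_norml.
    - by have := h1 k; rewrite !mxE subr0 /= in_itv /= -ler_norml.
    - by move: h2; rewrite omega0l mulr0 !subr0 in_itv /= -ler_norml.
  have lebE (s : R) : (0 <= s)%R -> leb `[(- s)%R, s] = (2 * s)%:E.
    move=> s0; rewrite lebesgue_measure_itv /= lte_fin -EFinB.
    by case: ifP => [_|/negbT]; [congr EFin; lra|rewrite -leNgt => h; congr EFin; lra].
  transitivity (mu (tuple_box (fun=> `[(- r)%R, r]%classic)) *
      leb `[(- r ^+ 2)%R, (r ^+ 2)%R]).
    by apply: product_measure1E => //; apply: measurable_tuple_box => i.
  rewrite lebE ?sqr_ge0// (lmu.1 _ (2 * r)%R)//; last 2 first.
    by rewrite mulr_ge0.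
    by move=> _; exact: lebE.
  by rewrite -EFinM exprMn !exprS; congr EFin; ring.
have nu_sf : sigma_finite setT nu.
  exists (fun k => heis_box (0, 0)%R k%:R).
    apply/seteqP; split => // x _.
    pose s := (\sum_k `|x.1 ord0 k| + `|x.2|)%R.
    have s0 : (0 <= s)%R by rewrite addr_ge0// sumr_ge0.
    exists (Num.bound s).+1 => //=.
    have sb := archi_boundP s0.
    have b1 : ((Num.bound s)%:R <= (Num.bound s).+1%:R :> R)%R by rewrite ler_nat.
    have b2 : (1 <= (Num.bound s).+1%:R :> R)%R by rewrite ler1n.
    split => [k|] /=; rewrite ?mxE ?omega0l ?mulr0 !subr0.
      suff : (`|x.1 ord0 k| <= s)%R by lra.
      by rewrite /s (bigD1 k)//= -addrA lerDl addr_ge0// sumr_ge0.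
    suff : (`|x.2| <= s)%R by nra.
    by rewrite /s lerDr sumr_ge0.
  by move=> k; split; [exact: measurable_heis_box|rewrite nu_box// ltry].
by exists (sigma_finite_measure_of nu_sf); split.
Qed.

End heis_lebesgue.

(** * A Morrey estimate for functions with an upper gradient *)

Section integral_tools.
Local Open Scope ereal_scope.
Context {R : realType}.

Section one_measure.
Context d (T : measurableType d) (m : {measure set T -> \bar R}).
Implicit Types (D : set T) (f h : T -> \bar R).

Lemma ge0_le_integralT D f h : measurable D -> measurable_fun setT f ->
  measurable_fun setT h -> (forall x, 0 <= f x) -> (forall x, D x -> f x <= h x) ->
  \int[m]_(x in D) f x <= \int[m]_(x in D) h x.
Proof.
move=> mD mf mh f0 fh; apply: ge0_le_integral => //.
- exact: measurable_funTS.
- exact: measurable_funTS.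
Qed.

Lemma ge0_subset_integralT D E f : measurable D -> measurable E ->
  measurable_fun setT f -> (forall x, 0 <= f x) -> D `<=` E ->
  \int[m]_(x in D) f x <= \int[m]_(x in E) f x.
Proof.
by move=> mD mE mf f0 DE; apply: ge0_subset_integral => //; exact: measurable_funTS.
Qed.

Lemma ge0_integralDT D f h : measurable D -> measurable_fun setT f ->
  measurable_fun setT h -> (forall x, 0 <= f x) -> (forall x, 0 <= h x) ->
  \int[m]_(x in D) (f x + h x) = \int[m]_(x in D) f x + \int[m]_(x in D) h x.
Proof.
by move=> mD mf mh f0 h0; apply: ge0_integralD => //; exact: measurable_funTS.
Qed.

Lemma preserving_integral_preimage (phi : T -> T) D h : measurable_fun setT phi ->
  (forall A, measurable A -> m (phi @^-1` A) = m A) ->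
  measurable D -> measurable_fun setT h -> (forall y, 0 <= h y) ->
  \int[m]_(x in phi @^-1` D) h (phi x) = \int[m]_(x in D) h x.
Proof.
move=> mphi phim mD mh h0.
rewrite integral_mkcond [RHS]integral_mkcond.
rewrite -(measure_preserving_integral (h := h \_ D) mphi phim).
- apply: eq_integral => x _; rewrite /patch.
  by rewrite (_ : (x \in phi @^-1` D) = (phi x \in D))//; apply/idP/idP; rewrite !inE.
- by apply/(measurable_restrictT _ mD); exact: measurable_funTS.
- by move=> y; rewrite /patch; case: ifP.
Qed.

End one_measure.

Section two_measures.
Context d1 d2 (T1 : measurableType d1) (T2 : measurableType d2).
Variables (m1 : {sigma_finite_measure set T1 -> \bar R})
  (m2 : {sigma_finite_measure set T2 -> \bar R}).
Variables (D1 : set T1) (D2 : set T2) (f : T1 -> T2 -> \bar R).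
Hypotheses (mD1 : measurable D1) (mD2 : measurable D2).
Hypothesis mf : measurable_fun setT (fun p => f p.1 p.2).
Hypothesis f0 : forall x y, 0 <= f x y.

Lemma measurable_fun_tonelli_in :
  measurable_fun setT (fun x => \int[m2]_(y in D2) f x y).
Proof.
pose h := (fun p : T1 * T2 => f p.1 p.2) \_ (setT `*` D2).
have mX : measurable ([set: T1] `*` D2) by exact: measurableX.
have mh : measurable_fun setT h.
  by apply/(measurable_restrictT _ mX); exact: measurable_funTS.
have h0 p : 0 <= h p by rewrite /h /patch; case: ifP.
have := measurable_fun_fubini_tonelli_F (m2 := m2) h mh h0.
congr (measurable_fun _ _); apply/funext => x; rewrite /fubini_F [RHS]integral_mkcond.
apply: eq_integral => y _; rewrite /h /patch.
by rewrite (_ : ((x, y) \in setT `*` D2) = (y \in D2))//; apply/idP/idP;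
  rewrite !inE => // -[].
Qed.

Lemma tonelli_in :
  \int[m1]_(x in D1) \int[m2]_(y in D2) f x y =
  \int[m2]_(y in D2) \int[m1]_(x in D1) f x y.
Proof.
pose h := (fun p : T1 * T2 => f p.1 p.2) \_ (D1 `*` D2).
have mX : measurable (D1 `*` D2) by exact: measurableX.
have mh : measurable_fun setT h.
  by apply/(measurable_restrictT _ mX); exact: measurable_funTS.
have h0 p : 0 <= h p by rewrite /h /patch; case: ifP.
have hE x y : h (x, y) = if (x \in D1) && (y \in D2) then f x y else 0.
  rewrite /h /patch (_ : ((x, y) \in D1 `*` D2) = (x \in D1) && (y \in D2))//.
  by apply/idP/andP; rewrite !inE.
transitivity (\int[m1]_x \int[m2]_y h (x, y)).
  rewrite integral_mkcond; apply: eq_integral => x _; rewrite {1}/patch.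
  case: ifPn => xD.
    by rewrite integral_mkcond; apply: eq_integral => y _; rewrite hE xD /patch.
  by rewrite integral0_eq// => y _; rewrite hE (negbTE xD).
rewrite (fubini_tonelli h mh h0) [RHS]integral_mkcond.
apply: eq_integral => y _; rewrite [RHS]/patch.
case: ifPn => yD.
  rewrite [RHS]integral_mkcond; apply: eq_integral => x _.
  by rewrite hE yD andbT /patch.
by rewrite integral0_eq// => x _; rewrite hE (negbTE yD) andbF.
Qed.

End two_measures.

End integral_tools.

Definition heis_ball {R : realType} {n : nat} (x : heis R n) (r : R) : set (heis R n) :=
  [set y | heis_dist x y < r].

Section unit_vectors.
Context {R : realType} {n : nat}.
Implicit Types (i : 'I_n).

Definition xvec i : 'rV[R]_(n * 2) := mxvec (delta_mx i (0 : 'I_2)).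
Definition yvec i : 'rV[R]_(n * 2) := mxvec (delta_mx i (1 : 'I_2)).

Lemma xcoord_xvec i j : xcoord (xvec i) j = (j == i)%:R.
Proof. by rewrite /xcoord mxvecE mxE eqxx andbT. Qed.

Lemma ycoord_xvec i j : ycoord (xvec i) j = 0.
Proof. by rewrite /ycoord mxvecE mxE andbF. Qed.

Lemma xcoord_yvec i j : xcoord (yvec i) j = 0.
Proof. by rewrite /xcoord mxvecE mxE andbF. Qed.

Lemma ycoord_yvec i j : ycoord (yvec i) j = (j == i)%:R.
Proof. by rewrite /ycoord mxvecE mxE eqxx andbT. Qed.

Lemma enorm_xvec i : enorm (xvec i) = 1.
Proof.
rewrite /enorm dotpE (bigD1 i)//= xcoord_xvec ycoord_xvec eqxx big1 => [|j /negbTE ji].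
  by rewrite mulr0 mulr1 !addr0 sqrtr1.
by rewrite xcoord_xvec ycoord_xvec ji !mulr0 addr0.
Qed.

Lemma enorm_yvec i : enorm (yvec i) = 1.
Proof.
rewrite /enorm dotpE (bigD1 i)//= xcoord_yvec ycoord_yvec eqxx big1 => [|j /negbTE ji].
  by rewrite mulr0 mulr1 addr0 add0r sqrtr1.
by rewrite xcoord_yvec ycoord_yvec ji !mulr0 addr0.
Qed.

Lemma omega_xvec_yvec i : omega (xvec i) (yvec i) = 1.
Proof.
rewrite /omega (bigD1 i)//= xcoord_xvec ycoord_yvec xcoord_yvec eqxx big1 => [|j /negbTE ji].
  by rewrite mul0r mulr1 subr0 addr0.
by rewrite xcoord_xvec ycoord_yvec xcoord_yvec ji !mul0r subr0.
Qed.

End unit_vectors.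

(** * Poincare inequalities for right translations *)

Section poincare.
Local Open Scope ereal_scope.
Context {R : realType} {n : nat}.
Local Notation leb := (@lebesgue_measure R).
Implicit Types (x y w : heis R n) (z e : 'rV[R]_(n * 2)).

Lemma measurable_heis_ball x r : measurable (heis_ball x r : set (heisB R n)).
Proof. by apply: measurable_heis_open; exact: open_mdist_lt. Qed.

Lemma measurable_heis_mulr w :
  measurable_fun setT (heis_mul^~ w : heisB R n -> heisB R n).
Proof. by apply: measurable_fun_heis_mul => //; exact: measurable_cst. Qed.

Lemma measurable_heis_mull w :
  measurable_fun setT (heis_mul w : heisB R n -> heisB R n).
Proof. by apply: measurable_fun_heis_mul => //; exact: measurable_cst. Qed.

Variable L : {sigma_finite_measure set (heisB R n) -> \bar R}.
Hypothesis HL : heis_lebesgue L.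

Variables (g : heisB R n -> \bar R) (u : heis R n -> R).
Hypotheses (mg : measurable_fun setT g) (g0 : forall x, 0 <= g x).
Hypothesis cu : continuous u.
Hypothesis ug : forall x e (l : R), enorm e = 1%R -> (0 <= l)%R ->
  `|u x - u (heis_mul x (l *: e, 0%R))|%:E <=
    \int[leb]_(s in `[0%R, l]) g (heis_mul x (s *: e, 0%R)).

Let mu : measurable_fun setT (u : heisB R n -> R).
Proof. exact: measurable_heis_continuous. Qed.

Let mdu d (T : measurableType d) (F G : T -> heisB R n) :
  measurable_fun setT F -> measurable_fun setT G ->
  measurable_fun setT (fun t => `|u (F t) - u (G t)|%:E).
Proof.
move=> mF mG; apply/measurable_EFinP; apply: measurableT_comp => //.
by apply: measurable_funB; exact: measurableT_comp mu _.
Qed.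

(** [l] stands for the length of a horizontal path from the origin to [w]; translated to start at
    [x], such a path ends at [heis_mul x w] and stays within distance [l] of [x]. *)
Definition shift_poincare w (l : R) : Prop := forall x0 r,
  \int[L]_(x in heis_ball x0 r) `|u x - u (heis_mul x w)|%:E <=
  l%:E * \int[L]_(x in heis_ball x0 (r + l)) g x.

(** The upper gradient inequality is integrated over [x] and the two integrals are exchanged. For
    fixed [s] the right translation by [s *: e] preserves [L] and sends the ball of radius [r] into
    that of radius [r + l], so every [s] contributes the same bound. *)
Lemma shift_poincare_segment e (l : R) : enorm e = 1%R -> (0 <= l)%R ->
  shift_poincare (l *: e, 0%R) l.
Proof.
move=> e1 l0 x0 r.
have mse : measurable_fun setT (fun s : measurableTypeR R => (s *: e, 0%R) : heisB R n).
  apply: measurable_fun_heisP => [k|] /=; last exact: measurable_cst.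
  under eq_fun do rewrite mxE.
  by apply: measurable_funM.
pose gseg (x : heisB R n) (s : measurableTypeR R) := g (heis_mul x (s *: e, 0%R)).
have mgs : measurable_fun setT (fun p : heisB R n * measurableTypeR R => gseg p.1 p.2).
  apply: measurableT_comp mg _; apply: measurable_fun_heis_mul => //.
  exact: measurableT_comp mse measurable_snd.
have mB := measurable_heis_ball.
apply: (@le_trans _ _ (\int[L]_(x in heis_ball x0 r)
    \int[leb]_(s in `[0%R, l]) g (heis_mul x (s *: e, 0%R)))).
  apply: ge0_le_integralT => //.
  - by apply: mdu => //; exact: measurable_heis_mulr.
  - exact: (@measurable_fun_tonelli_in R _ _ (heisB R n) (measurableTypeR R) leb
      _ gseg (measurable_itv `[0%R, l]) mgs (fun _ _ => g0 _)).
  - by move=> x _; exact: ug.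
rewrite (@tonelli_in R _ _ (heisB R n) (measurableTypeR R) L leb _ _ gseg (mB _ _)
  (measurable_itv `[0%R, l]) mgs (fun _ _ => g0 _)).
set I := \int[L]_(x in _) g x.
apply: (@le_trans _ _ (\int[leb]_(s in `[0%R, l]) cst I s)); last first.
  have lE : leb `[0%R, l] = l%:E.
    rewrite lebesgue_measure_itv /= lte_fin; case: ifP => [_|/negbT].
      by rewrite -EFinB subr0.
    by rewrite -leNgt => l0'; rewrite (_ : l = 0%R)//; lra.
  rewrite (@integral_cst _ (measurableTypeR R))//.
  by rewrite [X in I * X](_ : _ = l%:E)// muleC.
apply: ge0_le_integral => //.
- by move=> s _; apply: integral_ge0 => x _; exact: g0.
- apply: measurable_funTS.
  apply: (@measurable_fun_tonelli_in R _ _ (measurableTypeR R) (heisB R n) L _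
    (fun s x => gseg x s) (mB _ _)) => //.
    exact: measurableT_comp mgs (@measurable_swap _ _ _ _).
  by move=> s x; exact: g0.
move=> s; rewrite /= in_itv /= => /andP[s0 sl].
pose w : heis R n := (s *: e, 0%R).
rewrite /I -(@preserving_integral_preimage _ _ _ L (heis_mul^~ w) _ g)//.
- apply: ge0_subset_integralT => //.
  + rewrite -[X in measurable X]setTI; exact: measurable_heis_mulr.
  + by apply: measurableT_comp mg _; exact: measurable_heis_mulr.
  + by move=> x; exact: g0.
  + move=> x; rewrite /heis_ball /= => x0x.
    apply: le_lt_trans (heis_dist_triangle x _ _) _.
    have xw : heis_dist x (heis_mul x w) = s.
      rewrite -{1}[x]heis_mul0 /w heis_dist_horizontal ?omega0l// subr0 enormZ e1.
      by rewrite mulr1 ger0_norm.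
    by rewrite xw; lra.
- exact: measurable_heis_mulr.
- by case: HL => _ _; exact.
Qed.

Lemma shift_poincare_le w (l l' : R) : (0 <= l)%R -> (l <= l')%R ->
  shift_poincare w l -> shift_poincare w l'.
Proof.
move=> l0 ll' h x0 r; apply: le_trans (h x0 r) _.
apply: (@le_trans _ _ (l%:E * \int[L]_(x in heis_ball x0 (r + l')) g x)).
  apply: lee_wpmul2l; first by rewrite lee_fin.
  apply: ge0_subset_integralT => //; try exact: measurable_heis_ball.
  by move=> x; rewrite /heis_ball /=; lra.
by apply: lee_wpmul2r; [exact: integral_ge0|rewrite lee_fin].
Qed.

(** Concatenation of paths: [u] is compared at the intermediate point [heis_mul x w1], and right
    translation by [w1], which enlarges the ball by at most [l1], brings the second comparison back
    to the hypothesis on [w2]. *)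
Lemma shift_poincare_mul w1 w2 (l1 l2 : R) : (0 <= l1)%R -> (0 <= l2)%R ->
  (koranyi w1 <= l1)%R -> shift_poincare w1 l1 -> shift_poincare w2 l2 ->
  shift_poincare (heis_mul w1 w2) (l1 + l2).
Proof.
move=> l10 l20 w1l h1 h2 x0 r.
have mB := measurable_heis_ball.
have mr := measurable_heis_mulr.
have m1 : measurable_fun setT (fun x : heisB R n => `|u x - u (heis_mul x w1)|%:E).
  exact: mdu.
have m2 : measurable_fun setT (fun x : heisB R n => `|u x - u (heis_mul x w2)|%:E).
  exact: mdu.
pose h x := `|u (heis_mul x w1) - u (heis_mul (heis_mul x w1) w2)|%:E.
have mh : measurable_fun setT (h : heisB R n -> _).
  by apply: mdu => //; apply: measurable_fun_heis_mul => //; exact: measurable_cst.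
apply: (@le_trans _ _ (\int[L]_(x in heis_ball x0 r)
    (`|u x - u (heis_mul x w1)|%:E + h x))).
  apply: ge0_le_integralT => //.
  - exact: mdu.
  - exact: emeasurable_funD.
  - move=> x _; rewrite /h heis_mulA -EFinD lee_fin.
    exact: ler_distD.
rewrite ge0_integralDT//.
have -> : (l1 + l2)%:E * \int[L]_(x in heis_ball x0 (r + (l1 + l2))) g x =
    l1%:E * \int[L]_(x in heis_ball x0 (r + (l1 + l2))) g x +
    l2%:E * \int[L]_(x in heis_ball x0 (r + (l1 + l2))) g x.
  by rewrite EFinD ge0_muleDl ?lee_fin.
apply: leeD.
  apply: le_trans (h1 x0 r) _; apply: lee_wpmul2l; first by rewrite lee_fin.
  apply: ge0_subset_integralT => //.
  by move=> x; rewrite /heis_ball /=; lra.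
rewrite addrA; apply: le_trans (h2 x0 (r + l1)%R).
rewrite -(@preserving_integral_preimage _ _ _ L (heis_mul^~ w1) _
  (fun x => `|u x - u (heis_mul x w2)|%:E))//.
- apply: ge0_subset_integralT => //.
  + by rewrite -[X in measurable X]setTI; exact: mr.
  + by move=> x; rewrite lee_fin.
  + move=> x; rewrite /heis_ball /= => x0x.
    apply: le_lt_trans (heis_dist_triangle x _ _) _.
    by rewrite heis_dist_mulr; lra.
- by case: HL => _ _; exact.
- by move=> x; rewrite lee_fin.
Qed.

Hypothesis n0 : (0 < n)%N.

Lemma koranyi_horizontal z : koranyi (z, 0%R) = enorm z.
Proof.
have := heis_dist_horizontal (0, 0)%R (omega0l z).
by rewrite subr0 heis_mul0 heis_dist_mulr.
Qed.

(* The commutator of [a *: e1] and [a *: e2] is vertical, of height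
   [4 * a ^+ 2 * omega e1 e2]. *)
Lemma shift_poincare_vertical (t : R) :
  shift_poincare (0%R, t) (2 * Num.sqrt `|t|).
Proof.
pose i := Ordinal n0; pose a := (Num.sqrt `|t| / 2)%R.
(* The sign of [t] is realised by reversing [e2], which reverses the orientation of the commutator
   loop. *)
pose s : R := (if 0 <= t then 1 else -1)%R.
have s1 : `|s|%R = 1%R by rewrite /s; case: ifP; rewrite ?normrN normr1.
have ts : t = (4 * a ^+ 2 * s)%R.
  have -> : (4 * a ^+ 2 = `|t|)%R.
    by rewrite /a expr_div_n sqr_sqrtr// -natrX; field.
  rewrite /s; case: (leP 0%R t) => t0; first by rewrite ger0_norm// mulr1.
  by rewrite ltr0_norm// mulrN1 opprK.
have a0 : (0 <= a)%R by rewrite divr_ge0// sqrtr_ge0.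
pose e1 : 'rV[R]_(n * 2) := xvec i; pose e2 : 'rV[R]_(n * 2) := (s *: yvec i)%R.
have e11 : enorm e1 = 1%R by exact: enorm_xvec.
have e21 : enorm e2 = 1%R by rewrite enormZ s1 enorm_yvec mulr1.
have e12 : omega e1 e2 = s by rewrite omegaZr omega_xvec_yvec mulr1.
clearbody e1 e2.
have seg e : enorm e = 1%R -> shift_poincare (a *: e, 0%R) a.
  by move=> ?; exact: shift_poincare_segment.
have kor e : enorm e = 1%R -> (koranyi (a *: e, 0%R) <= a)%R.
  by move=> e1'; rewrite koranyi_horizontal enormZ e1' mulr1 ger0_norm.
have h : shift_poincare (heis_mul (a *: e1, 0%R) (heis_mul (a *: e2, 0%R)
    (heis_mul (a *: (- e1), 0%R) (a *: (- e2), 0%R)))) (a + (a + (a + a))).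
  by do 3 (apply: shift_poincare_mul;
    rewrite ?addr_ge0//; [by apply: kor; rewrite ?enormN|by apply: seg; rewrite ?enormN|]);
    apply: seg; rewrite ?enormN.
move: h; congr (shift_poincare _ _); last by rewrite /a; field.
rewrite /heis_mul /=; congr (_, _).
  by rewrite !scalerN; apply/rowP => k; rewrite !mxE; ring.
rewrite ts !omega_simp (omegaC e2 e1) e12; ring.
Qed.

Lemma sqrt_vert_le_koranyi w : (Num.sqrt `|w.2| <= koranyi w)%R.
Proof.
rewrite -(@ler_pXn2r _ 4)// ?nnegrE ?sqrtr_ge0 ?koranyi_ge0//.
rewrite koranyi4 -[4%N]/(2 * 2)%N exprM sqr_sqrtr// real_normK ?num_real//.
by rewrite lerDr sqr_ge0.
Qed.

Lemma enorm_le_koranyi w : (enorm w.1 <= koranyi w)%R.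
Proof.
rewrite -(@ler_pXn2r _ 4)// ?nnegrE ?enorm_ge0 ?koranyi_ge0// koranyi4.
by rewrite -enorm_sqr -exprM lerDl sqr_ge0.
Qed.

Lemma shift_poincare_any w : shift_poincare w (3 * koranyi w).
Proof.
have h : shift_poincare w (enorm w.1 + 2 * Num.sqrt `|w.2|).
  have {1}-> : w = heis_mul (w.1, 0%R) (0%R, w.2).
    by rewrite /heis_mul /= addr0 omega0r mulr0 addr0 add0r -surjective_pairing.
  apply: shift_poincare_mul.
  - exact: enorm_ge0.
  - by rewrite mulr_ge0// sqrtr_ge0.
  - by rewrite koranyi_horizontal.
  (* A zero vector has no direction to normalise; it is written as a segment of length 0 along an
     arbitrary unit vector. *)
  - rewrite /=; have [->|w0] := eqVneq w.1 0%R.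
      rewrite enorm0 -(scale0r (xvec (Ordinal n0))).
      by apply: shift_poincare_segment => //; exact: enorm_xvec.
    have e0 : enorm w.1 != 0%R.
      apply: contra_neq w0 => w0; apply: dotp_eq0.
      by rewrite -enorm_sqr w0 expr0n.
    have {1}-> : w.1 = (enorm w.1 *: ((enorm w.1)^-1 *: w.1))%R.
      by rewrite scalerA divff// scale1r.
    apply: shift_poincare_segment; last exact: enorm_ge0.
    by rewrite enormZ ger0_norm ?invr_ge0 ?enorm_ge0// mulVf.
  - exact: shift_poincare_vertical.
apply: shift_poincare_le h.
  by rewrite addr_ge0 ?enorm_ge0// mulr_ge0// sqrtr_ge0.
by have := sqrt_vert_le_koranyi w; have := enorm_le_koranyi w; lra.
Qed.

End poincare.

Section boxes_and_balls.
Context {R : realType} {n : nat}.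
Hypothesis n0 : (0 < n)%N.
Implicit Types (x y w : heis R n).
Local Notation N := ((n * 2)%:R : R).

Lemma one_le_N : 1 <= N.
Proof. by rewrite ler1n muln_gt0 n0. Qed.

Lemma heis_box_dist x (r : R) y : 0 <= r -> heis_box x r y ->
  heis_dist x y <= 2 * (N * r).
Proof.
move=> r0 [h1 h2]; have N1 := one_le_N.
apply: heis_dist_le; first by rewrite mulr_ge0.
  by apply: enorm_le_coord => k; rewrite !mxE; exact: h1.
by apply: le_trans h2 _; rewrite ler_pXn2r ?nnegrE ?mulr_ge0// ler_peMl.
Qed.

Lemma heis_dist_box x (r : R) y : heis_dist x y <= r -> heis_box x r y.
Proof.
move=> xyr; split => [k|].
  have := coord_le_enorm (y.1 - x.1) k; rewrite !mxE => /le_trans; apply.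
  exact: le_trans (enorm_le_heis_dist _ _) xyr.
apply: le_trans (vert_le_heis_dist _ _) _.
by rewrite ler_pXn2r ?nnegrE ?heis_dist_ge0// (le_trans _ xyr)// heis_dist_ge0.
Qed.

Lemma koranyiE w : koranyi w = heis_dist (0, 0) w.
Proof.
rewrite -(heis_dist_mulr (0, 0)); congr heis_dist.
by rewrite /heis_mul /= omega0l mulr0 addr0 !add0r -surjective_pairing.
Qed.

End boxes_and_balls.

(** * From mean oscillation on boxes to a pointwise bound *)

Section morrey.
Local Open Scope ereal_scope.
Context {R : realType} {n : nat}.
Hypothesis n0 : (0 < n)%N.
Implicit Types (x y w : heis R n).
Local Notation N := ((n * 2)%:R : R).
Local Notation Q := (n * 2).+2.
Let kappa : R := (2 ^+ (n * 2).+1)%R.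

Variable L : {sigma_finite_measure set (heisB R n) -> \bar R}.
Hypothesis HL : heis_lebesgue L.
Variable p : R.
Hypothesis Qp : (Q%:R < p)%R.

Variables (g : heisB R n -> \bar R) (u : heis R n -> R).
Hypotheses (mg : measurable_fun setT g) (g0 : forall x, 0 <= g x).
Hypothesis cu : continuous u.
Hypothesis ug : forall x e (l : R), enorm e = 1%R -> (0 <= l)%R ->
  `|u x - u (heis_mul x (l *: e, 0%R))|%:E <=
    \int[lebesgue_measure]_(s in `[0%R, l]) g (heis_mul x (s *: e, 0%R)).

Let mu : measurable_fun setT (u : heisB R n -> R).
Proof. exact: measurable_heis_continuous. Qed.

Let mdu d (T : measurableType d) (F G : T -> heisB R n) :
  measurable_fun setT F -> measurable_fun setT G ->
  measurable_fun setT (fun t => `|u (F t) - u (G t)|%:E).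
Proof.
move=> mF mG; apply/measurable_EFinP; apply: measurableT_comp => //.
by apply: measurable_funB; exact: measurableT_comp mu _.
Qed.

Let mbox := @measurable_heis_box R n.
Let mball := @measurable_heis_ball R n.
Let N1 : (1 <= N)%R := @one_le_N R n n0.

(** With y = x w, the inner variable becomes a displacement [w] in a box [W] that does not depend on
    [x]. After exchanging the integrals, [shift_poincare_any] applies for each [w]. *)
Lemma box_double_integral x0 (r : R) : (0 < r)%R ->
  \int[L]_(x in heis_box x0 r) \int[L]_(y in heis_box x0 r) `|u x - u y|%:E <=
  (24 * N ^+ 2 * r * (kappa * (4 * N * r) ^+ Q))%:E *
    \int[L]_(x in heis_ball x0 (4 * N * r + 24 * N ^+ 2 * r)) g x.
Proof.
move=> r0; have [Lbox Ll Lr] := HL.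
have Nr0 : (0 < N * r)%R by rewrite mulr_gt0// (lt_le_trans _ N1).
(* Two points of the box are within 2Nr of [x0], so [w] has norm at most 4Nr and lies in [W].
   Conversely points of [W] have norm at most 2N(4Nr), and the factor 3 of [shift_poincare_any]
   gives [l]. *)
pose l := (24 * N ^+ 2 * r)%R.
have l0 : (0 <= l)%R by rewrite mulr_ge0 ?(ltW r0)// mulr_ge0// sqr_ge0.
pose D := heis_box x0 r; pose W : set (heis R n) := heis_box (0, 0)%R (4 * N * r)%R.
have mD : measurable (D : set (heisB R n)) by exact: mbox.
have mW : measurable (W : set (heisB R n)) by exact: mbox.
pose h (x w : heisB R n) := `|u x - u (heis_mul x w)|%:E.
have mh : measurable_fun setT (fun q : heisB R n * heisB R n => h q.1 q.2).
  by apply: mdu => //; exact: measurable_fun_heis_mul.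
have h0 x w : 0 <= h x w by rewrite lee_fin.
have mh1 w : measurable_fun setT (h^~ w).
  by apply: mdu => //; exact: measurable_heis_mulr.
have mh2 x : measurable_fun setT (h x).
  by apply: mdu => //; exact: measurable_heis_mull.
have mu2 : measurable_fun setT (fun q : heisB R n * heisB R n => `|u q.1 - u q.2|%:E).
  exact: mdu.
have mu1 x : measurable_fun setT (fun y : heisB R n => `|u x - u y|%:E).
  exact: mdu.
apply: (@le_trans _ _ (\int[L]_(x in D) \int[L]_(w in W) h x w)).
  apply: ge0_le_integral => //.
  - by move=> x _; apply: integral_ge0 => y _; rewrite lee_fin.
  - apply: measurable_funTS.
    exact: (@measurable_fun_tonelli_in R _ _ (heisB R n) (heisB R n) L _
      (fun x y => `|u x - u y|%:E) mD mu2 (fun _ _ => normr_ge0 _)).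
  - apply: measurable_funTS.
    exact: (@measurable_fun_tonelli_in R _ _ (heisB R n) (heisB R n) L _ h mW mh h0).
  move=> x Dx; rewrite -(@preserving_integral_preimage _ _ _ L (heis_mul x) _
    (fun y => `|u x - u y|%:E))//.
  - apply: ge0_subset_integralT => //.
    + by rewrite -[X in measurable X]setTI; exact: measurable_heis_mull.
    + exact: mh2.
    move=> w /= Dw; apply: heis_dist_box; rewrite -koranyiE -(heis_dist_mulr x).
    apply: le_trans (heis_dist_triangle x0 _ _) _; rewrite heis_dist_sym.
    have := heis_box_dist n0 (ltW r0) Dx; have := heis_box_dist n0 (ltW r0) Dw.
    lra.
  - exact: measurable_heis_mull.
  - exact: Ll.
rewrite (@tonelli_in R _ _ (heisB R n) (heisB R n) L L _ _ h mD mW mh h0).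
set I := \int[L]_(x in _) g x.
apply: (@le_trans _ _ (\int[L]_(w in W) cst (l%:E * I) w)); last first.
  have LW : L W = (kappa * (4 * N * r) ^+ Q)%:E.
    by apply: Lbox; rewrite -mulrA mulr_ge0// ltW.
  rewrite integral_cst// [X in _ * X](_ : _ = (kappa * (4 * N * r) ^+ Q)%:E)//.
  by rewrite muleC muleA -EFinM [X in X%:E * _ <= _]mulrC.
apply: ge0_le_integral => //.
- by move=> w _; exact: integral_ge0.
- apply: measurable_funTS.
  apply: (@measurable_fun_tonelli_in R _ _ (heisB R n) (heisB R n) L _ (fun w x => h x w) mD) => //.
  exact: measurableT_comp mh (@measurable_swap _ _ _ _).
move=> w Ww.
have wl : (3 * koranyi w <= l)%R.
  rewrite koranyiE.
  have := heis_box_dist n0 (_ : 0 <= 4 * N * r)%R Ww.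
  rewrite -mulrA mulr_ge0 ?(ltW Nr0)// => /(_ isT); rewrite /l; nra.
have hw := @shift_poincare_any R n L HL g u mg g0 cu ug n0 w.
have k0 : (0 <= 3 * koranyi w)%R by rewrite mulr_ge0// koranyi_ge0.
apply: le_trans (shift_poincare_le mg g0 k0 wl hw x0 (4 * N * r)%R).
apply: ge0_subset_integralT => //.
move=> x Dx; rewrite /heis_ball /=.
by have := heis_box_dist n0 (ltW r0) Dx; lra.
Qed.

Lemma heis_ball_measure x (r : R) : (0 <= r)%R ->
  L (heis_ball x r) <= (kappa * r ^+ Q)%:E.
Proof.
move=> r0; have [Lbox _ _] := HL; rewrite -(Lbox x)//.
apply: le_measure; rewrite ?inE; [exact: mball|exact: mbox|].
by move=> y /ltW; exact: heis_dist_box.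
Qed.

Let p0 : (0 < p)%R. Proof. exact: le_lt_trans Qp. Qed.
Let p1 : (1 <= p)%R. Proof. by apply: le_trans (ltW Qp); rewrite ler1n. Qed.

(* Young's inequality with a free threshold [t] replaces Hoelder's. *)
Lemma young_poweR (a : \bar R) (t : R) : (0 < t)%R -> 0 <= a ->
  a <= t%:E + (t / t `^ p)%:E * poweR a p.
Proof.
move=> t0; have tp0 : (0 < t `^ p)%R by exact: powR_gt0.
case: a => [v| |] //; last first.
  by rewrite poweRyr ?gt_eqF// gt0_muley ?lte_fin ?divr_gt0// addey.
rewrite lee_fin => v0; rewrite -EFinM -EFinD lee_fin.
have [vt|tv] := leP v t.
  by apply: le_trans vt _; rewrite lerDl mulr_ge0 ?powR_ge0// ltW// divr_gt0.
apply: (@le_trans _ _ (t / t `^ p * v `^ p)%R); last by rewrite lerDr ltW.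
have -> : (t / t `^ p * v `^ p = t * (v / t) `^ p)%R.
  rewrite powRM ?invr_ge0 ?(ltW t0)// -(powR_inv1 (ltW t0)).
  by rewrite -powRrM mulN1r powRN; ring.
rewrite -ler_pdivrMl// mulrC -[leLHS]powRr1; last by rewrite divr_ge0// ltW.
by apply: ler_powR => //; rewrite ler_pdivlMr// mul1r ltW.
Qed.

Let mgp : measurable_fun setT (fun x : heisB R n => poweR (g x) p).
Proof. exact: measurableT_comp (measurable_poweR p) mg. Qed.

Lemma ball_integral_le x (r G t : R) : (0 <= r)%R -> (0 < t)%R ->
  \int[L]_(y in heis_ball x r) poweR (g y) p <= G%:E ->
  \int[L]_(y in heis_ball x r) g y <= (t * (kappa * r ^+ Q) + t / t `^ p * G)%:E.
Proof.
move=> r0 t0 hG.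
have tp0 : (0 <= t / t `^ p)%R by rewrite divr_ge0 ?powR_ge0// ltW.
apply: (@le_trans _ _ (\int[L]_(y in heis_ball x r)
    (cst t%:E y + (t / t `^ p)%:E * poweR (g y) p))).
  apply: ge0_le_integralT => //.
  - by apply: emeasurable_funD => //; exact: measurable_funeM.
  - by move=> y _; exact: young_poweR.
rewrite ge0_integralDT//; last 3 first.
- exact: measurable_funeM.
- by move=> y; rewrite lee_fin ltW.
- by move=> y; rewrite mule_ge0 ?lee_fin// poweR_ge0.
rewrite EFinD; apply: leeD.
  rewrite integral_cst//.
  by rewrite EFinM; apply: lee_wpmul2l; [rewrite lee_fin ltW|exact: heis_ball_measure].
rewrite ge0_integralZl_EFin//.
- by rewrite [leRHS]EFinM; apply: lee_wpmul2l; rewrite ?lee_fin.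
- by move=> y _; exact: poweR_ge0.
- exact: measurable_funTS.
Qed.

(** [B0] is the dilation of the ball in [box_double_integral]. [C1] multiplies the prefactor found
    there by the two equal-order terms of [ball_integral_le], and [sg] is the resulting Hoelder
    exponent. *)
Let B0 : R := (4 * N + 24 * N ^+ 2)%R.
Let C1 : R := (24 * N ^+ 2 * (kappa * (4 * N) ^+ Q) * (kappa * B0 ^+ Q + 1))%R.
Let q : R := (Q%:R / p)%R.
Let sg : R := (1 - q)%R.

Let B0_ge0 : (0 <= B0)%R.
Proof. by rewrite /B0 addr_ge0// mulr_ge0// ?sqr_ge0. Qed.

Let kappa0 : (0 < kappa)%R. Proof. exact: exprn_gt0. Qed.

Let C1_ge0 : (0 <= C1)%R.
Proof.
have k0 := ltW kappa0; rewrite /C1; apply: mulr_ge0; first apply: mulr_ge0.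
- by rewrite mulr_ge0 ?sqr_ge0.
- by rewrite mulr_ge0// exprn_ge0// mulr_ge0.
- by rewrite addr_ge0// mulr_ge0// exprn_ge0.
Qed.

Let sg_gt0 : (0 < sg)%R.
Proof. by rewrite /sg /q subr_gt0 ltr_pdivrMr// mul1r. Qed.

Lemma box_double_integral_le x0 (r G : R) : (0 < r)%R -> (0 < G)%R ->
  \int[L]_(y in heis_ball x0 (B0 * r)) poweR (g y) p <= G%:E ->
  \int[L]_(x in heis_box x0 r) \int[L]_(y in heis_box x0 r) `|u x - u y|%:E <=
  (C1 * G `^ p^-1 * (r ^+ Q * r ^+ Q * r `^ sg))%:E.
Proof.
move=> r0 G0 hG; apply: le_trans (box_double_integral x0 r0) _.
rewrite -[(4 * N * r + _)%R]mulrDl -/B0.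
(* The threshold that balances Young's inequality: t^p = G / r^Q makes both terms multiples of t
   r^Q. *)
pose t := (G `^ p^-1 * r `^ (- q))%R.
have t0 : (0 < t)%R by rewrite mulr_gt0// powR_gt0.
have tp : (t `^ p = G / r ^+ Q)%R.
  rewrite /t powRM ?powR_ge0// -!powRrM mulVf ?gt_eqF// powRr1 ?(ltW G0)//.
  by rewrite mulNr /q divfK ?gt_eqF// powRN powR_mulrn// ltW.
have rQ0 : (0 < r ^+ Q)%R by exact: exprn_gt0.
apply: le_trans (lee_wpmul2l _ (ball_integral_le _ t0 hG)) _.
- rewrite lee_fin; apply: mulr_ge0.
    by rewrite mulr_ge0 ?(ltW r0)// mulr_ge0 ?sqr_ge0.
  by rewrite mulr_ge0 ?(ltW kappa0)// exprn_ge0// mulr_ge0 ?(ltW r0)// mulr_ge0.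
- by rewrite mulr_ge0// ltW.
rewrite -EFinM lee_fin tp le_eqVlt; apply/orP; left; apply/eqP.
have rt : (r `^ sg * G `^ p^-1 = r * t)%R.
  rewrite /sg /t powRD; last by rewrite gt_eqF ?implybT.
  by rewrite powRr1 ?(ltW r0)//; ring.
have -> : (t / (G / r ^+ Q) * G = t * r ^+ Q)%R.
  by field; rewrite !gt_eqF.
rewrite /C1 [RHS](_ : _ = (24 * N ^+ 2 * (kappa * (4 * N) ^+ Q) *
  (kappa * B0 ^+ Q + 1) * (r ^+ Q * r ^+ Q) * (r `^ sg * G `^ p^-1))%R); last by ring.
rewrite rt !exprMn; ring.
Qed.

Lemma integral_box_cst x (r : R) (c : \bar R) : (0 <= r)%R ->
  \int[L]_(y in heis_box x r) c = (kappa * r ^+ Q)%:E * c.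
Proof.
move=> r0; have [Lbox _ _] := HL; rewrite muleC -(Lbox x r r0).
by rewrite -[LHS]/(integral L (heis_box x r) (cst c)) integral_cst//; exact: mbox.
Qed.

Definition box_deviation x (r : R) : \bar R :=
  \int[L]_(y in heis_box x r) `|u x - u y|%:E.

(** The difference of [u] at [x] and [y] is split at a third point [z], then integrated over [z] in
    the half box and [y] in the full one. The last term is enlarged to the full box in [z] as
    well. *)
Lemma box_deviation_half x (r : R) : (0 < r)%R ->
  (kappa * (r / 2) ^+ Q)%:E * box_deviation x r <=
  (kappa * r ^+ Q)%:E * box_deviation x (r / 2) +
  \int[L]_(z in heis_box x r) \int[L]_(y in heis_box x r) `|u z - u y|%:E.
Proof.
move=> r0; have [Lbox _ _] := HL.
have mu2 : measurable_fun setT (fun q : heisB R n * heisB R n => `|u q.1 - u q.2|%:E).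
  exact: mdu.
have mu1 y : measurable_fun setT (fun z : heisB R n => `|u y - u z|%:E).
  exact: mdu.
have mD (s : R) : measurable (heis_box x s : set (heisB R n)) by exact: mbox.
have mI : measurable_fun setT (fun z : heisB R n =>
    \int[L]_(y in heis_box x r) `|u z - u y|%:E).
  exact: (@measurable_fun_tonelli_in R _ _ (heisB R n) (heisB R n) L _
      (fun x y => `|u x - u y|%:E) (mD r) mu2 (fun _ _ => normr_ge0 _)).
have I0 z : 0 <= \int[L]_(y in heis_box x r) `|u z - u y|%:E.
  by apply: integral_ge0 => y _; rewrite lee_fin.
rewrite -(integral_box_cst x); last by rewrite divr_ge0// ltW.
apply: (@le_trans _ _ (\int[L]_(z in heis_box x (r / 2))
   ((kappa * r ^+ Q)%:E * `|u x - u z|%:E +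
    \int[L]_(y in heis_box x r) `|u z - u y|%:E))).
  apply: ge0_le_integralT => //.
  - by apply: emeasurable_funD => //; exact: measurable_funeM.
  - by move=> _; exact: I0.
  move=> z _; rewrite -(integral_box_cst x _ (ltW r0)).
  rewrite -ge0_integralDT//.
  apply: ge0_le_integralT => //; first exact: emeasurable_funD.
  by move=> y _; rewrite -EFinD lee_fin; exact: ler_distD.
rewrite ge0_integralDT//.
- apply: leeD.
    rewrite ge0_integralZl_EFin//; first exact: measurable_funTS.
    by rewrite mulr_ge0 ?(ltW kappa0)// exprn_ge0// ltW.
  apply: ge0_subset_integralT => //.
  move=> z [h1 h2]; have rr : (r / 2 <= r)%R by lra.
  split=> [k|]; first exact: le_trans (h1 k) rr.
  by apply: le_trans h2 _; nra.
- exact: measurable_funeM.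
- move=> z; rewrite -EFinM lee_fin mulr_ge0// mulr_ge0 ?(ltW kappa0)//.
  by rewrite exprn_ge0// ltW.
Qed.

Let C2 : R := (2 ^+ Q * C1 / kappa / (1 - (2^-1) `^ sg))%R.

Let den_gt0 : (0 < 1 - (2^-1 : R) `^ sg)%R.
Proof.
have one : ((1 : R) `^ sg = 1)%R by rewrite powR1.
rewrite subr_gt0 -[ltRHS]one; apply: gt0_ltr_powR => //; rewrite ?nnegrE//.
by rewrite invf_lt1// ltr1n.
Qed.

Let C2_ge0 : (0 <= C2)%R.
Proof.
by rewrite /C2 !divr_ge0 ?(ltW kappa0) ?(ltW den_gt0)// mulr_ge0// exprn_ge0.
Qed.

(* [C2] solves the recursion produced by [box_deviation_half] when the radius is
   halved; the error [e] absorbs the value at a scale where [u] is almost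
   constant. *)
Lemma box_deviation_step x (r e G : R) : (0 < r)%R -> (0 < G)%R ->
  \int[L]_(y in heis_ball x (B0 * r)) poweR (g y) p <= G%:E ->
  box_deviation x (r / 2) <=
    ((r / 2) ^+ Q * (e + C2 * G `^ p^-1 * (r / 2) `^ sg))%:E ->
  box_deviation x r <= (r ^+ Q * (e + C2 * G `^ p^-1 * r `^ sg))%:E.
Proof.
move=> r0 G0 hG h; pose K := (kappa * (r / 2) ^+ Q)%R.
have K0 : (0 < K)%R by rewrite mulr_gt0 ?exprn_gt0 ?divr_gt0.
rewrite -[leLHS]mul1e -[1%R](mulVf (lt0r_neq0 K0)) EFinM -muleA.
rewrite [leRHS](_ : _ = K^-1%:E * (K * (r ^+ Q * (e + C2 * G `^ p^-1 * r `^ sg)))%:E); last first.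
  by rewrite -EFinM mulKf// gt_eqF.
apply: lee_wpmul2l; first by rewrite lee_fin invr_ge0 ltW.
apply: le_trans (box_deviation_half x r0) _.
apply: le_trans (leeD (lee_wpmul2l _ h) (box_double_integral_le r0 G0 hG)) _.
  by rewrite lee_fin mulr_ge0 ?(ltW kappa0)// exprn_ge0// ltW.
rewrite -EFinM -EFinD lee_fin le_eqVlt; apply/orP; left; apply/eqP.
rewrite powRM ?(ltW r0) ?invr_ge0// /K /C2 expr_div_n.
set a := (2^-1 `^ sg)%R; set b := (r `^ sg)%R; set c := (G `^ _)%R.
have a1 : (1 - a != 0)%R by rewrite gt_eqF.
by field; rewrite a1 (gt_eqF kappa0) expf_neq0.
Qed.

Lemma box_deviation_small x (e : R) : (0 < e)%R ->
  exists2 d : R, (0 < d)%R & forall r : R, (0 < r)%R -> (r < d)%R ->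
    box_deviation x r <= (r ^+ Q * (kappa * e))%:E.
Proof.
move=> e0; have /cvgrPdist_lt/(_ e e0)/metric_nbhsP[d d0 dP] : u @ x --> u x by exact: cu.
exists (d / (4 * N))%R; first by rewrite divr_gt0// mulr_gt0// (lt_le_trans _ N1).
move=> r r0; rewrite ltr_pdivlMr; last by rewrite mulr_gt0// (lt_le_trans _ N1).
move=> rd; apply: (@le_trans _ _ (\int[L]_(y in heis_box x r) cst e%:E y)).
  apply: ge0_le_integral => //; first by apply: measurable_funTS; exact: mdu.
  move=> y xy; rewrite lee_fin; apply/ltW/dP => /=.
  rewrite -[mdist _ _]/(heis_dist x y); apply: le_lt_trans (heis_box_dist n0 (ltW r0) xy) _.
  have : (0 < r * N)%R by rewrite mulr_gt0// (lt_le_trans _ N1).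
  by lra.
rewrite integral_box_cst ?(ltW r0)// -EFinM lee_fin le_eqVlt; apply/orP; left; apply/eqP; ring.
Qed.

Lemma box_deviation_le x (r G : R) : (0 < r)%R -> (0 < G)%R ->
  \int[L]_(y in heis_ball x (B0 * r)) poweR (g y) p <= G%:E ->
  box_deviation x r <= (r ^+ Q * (C2 * G `^ p^-1 * r `^ sg))%:E.
Proof.
move=> r0 G0 hG; apply/lee_addgt0Pr => e e0.
have rQ0 : (0 < r ^+ Q)%R by rewrite exprn_gt0.
(* [e'] is fixed at the top radius and kept while the radius is halved, because the normalised error
   in [box_deviation_step] is the same at both scales. *)
pose e' := (e / r ^+ Q / kappa)%R.
have e'0 : (0 < e')%R by rewrite !divr_gt0.
have [d d0 dP] := box_deviation_small x e'0.
rewrite -EFinD [X in _ <= X%:E](_ : _ =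
    r ^+ Q * (kappa * e' + C2 * G `^ p^-1 * r `^ sg))%R; last first.
  by rewrite /e'; field; rewrite (gt_eqF kappa0) gt_eqF.
have [k kP] : exists k : nat, (r / 2 ^+ k < d)%R.
  have rd0 : (0 <= r / d)%R by rewrite divr_ge0// ltW.
  exists (Num.bound (r / d)); rewrite ltr_pdivrMr ?exprn_gt0// mulrC -ltr_pdivrMr//.
  apply: lt_trans (archi_boundP rd0) _.
  by rewrite -natrX ltr_nat ltn_expl.
have {e'0} ke'0 : (0 <= kappa * e')%R by rewrite mulr_ge0 ?(ltW kappa0)// ltW.
clearbody e'; elim: k r r0 hG {rQ0} kP => [|k IHk] s s0 hG ks.
  apply: le_trans (dP s s0 _) _; first by rewrite expr0 divr1 in ks.
  rewrite lee_fin ler_pM2l ?exprn_gt0// lerDl.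
  by apply: mulr_ge0; rewrite ?powR_ge0//; apply: mulr_ge0; rewrite ?powR_ge0.
apply: box_deviation_step => //; apply: IHk.
- by rewrite divr_gt0.
- apply: le_trans hG; apply: ge0_subset_integralT => //.
    by move=> y; exact: poweR_ge0.
  move=> y; rewrite /heis_ball /= => /lt_le_trans; apply.
  by rewrite ler_wpM2l// ler_pdivrMr// ler_peMr// ?ler1n// ltW.
- by rewrite -mulrA -invfM -exprS.
Qed.

(** A point of the box of radius r at [x] is within 2Nr of [x], hence within c1 r of any [y] at
    distance less than r from [x]. *)
Let c1 : R := (2 * N + 1)%R.

Definition morrey_dilation : R := (B0 * c1 + 1)%R.
Definition morrey_constant : R := (C2 / kappa * (1 + c1 ^+ Q * c1 `^ sg))%R.

(** Both [u x] and [u y] are compared with [u z], integrated over [z] in the box at [x]. This box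
    lies in the one of radius [c1 * r] at [y], so [box_deviation_le] serves at both centres; the
    dilation makes the ball needed at [y] fit into the one at [x]. *)
Theorem morrey x y (r G : R) : (0 < r)%R -> (0 < G)%R ->
  \int[L]_(z in heis_ball x (morrey_dilation * r)) poweR (g z) p <= G%:E ->
  (heis_dist x y < r)%R ->
  (`|u y - u x| <= morrey_constant * G `^ p^-1 * r `^ (1 - Q%:R / p))%R.
Proof.
move=> r0 G0 hG xyr.
have c10 : (1 <= c1)%R by have := N1; rewrite /c1; lra.
have c1gt0 : (0 < c1)%R by exact: lt_le_trans c10.
have c1r0 : (0 < c1 * r)%R by rewrite mulr_gt0.
have mu1 z : measurable_fun setT (fun y : heisB R n => `|u z - u y|%:E).
  exact: mdu.
have mono z (s : R) : heis_ball z s `<=` heis_ball x (morrey_dilation * r) ->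
    \int[L]_(z in heis_ball z s) poweR (g z) p <= G%:E.
  move=> zs; apply: le_trans hG; apply: ge0_subset_integralT => //.
  by move=> w; exact: poweR_ge0.
have Sx := box_deviation_le r0 G0 (mono x (B0 * r)%R _).
have {}Sx : box_deviation x r <= (r ^+ Q * (C2 * G `^ p^-1 * r `^ sg))%:E.
  apply: Sx => w; rewrite /heis_ball /= => /lt_le_trans; apply.
  rewrite ler_pM2r// /morrey_dilation -[leLHS]addr0; apply: lerD => //.
  by rewrite ler_peMr.
have Sy : box_deviation y (c1 * r) <=
    ((c1 * r) ^+ Q * (C2 * G `^ p^-1 * (c1 * r) `^ sg))%:E.
  apply: box_deviation_le => //; apply: mono => w; rewrite /heis_ball /= => yw.
  apply: le_lt_trans (heis_dist_triangle y _ _) _.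
  by rewrite /morrey_dilation mulrDl mul1r -mulrA addrC ltrD.
have key : (kappa * r ^+ Q)%:E * `|u y - u x|%:E <=
    box_deviation x r + box_deviation y (c1 * r).
  rewrite -(integral_box_cst x _ (ltW r0)).
  apply: (@le_trans _ _ (\int[L]_(z in heis_box x r)
      (`|u x - u z|%:E + `|u y - u z|%:E))).
    apply: ge0_le_integralT => //; first exact: emeasurable_funD.
    move=> z _; rewrite -EFinD lee_fin.
    by have := ler_distD (u z) (u y) (u x); rewrite (distrC (u z) (u x)); lra.
  rewrite ge0_integralDT//; apply: leeD => //.
  apply: ge0_subset_integralT => // z xz; apply: heis_dist_box.
  apply: le_trans (heis_dist_triangle x _ _) _; rewrite heis_dist_sym.
  by have := heis_box_dist n0 (ltW r0) xz; rewrite /c1; lra.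
have {key} := le_trans key (leeD Sx Sy).
rewrite -EFinM -EFinD lee_fin -ler_pdivlMl; last by rewrite mulr_gt0 ?exprn_gt0.
move=> /le_trans; apply; rewrite le_eqVlt; apply/orP; left; apply/eqP.
rewrite /morrey_constant -/sg powRM ?(ltW c1gt0) ?(ltW r0)// exprMn.
set a := (r `^ sg)%R; set b := (c1 `^ sg)%R; set c := (G `^ _)%R.
by field; rewrite (gt_eqF kappa0) expf_neq0// gt_eqF.
Qed.

End morrey.

(** * Hausdorff measure against Haar measure *)

Section ereal_tools.
Local Open Scope ereal_scope.
Context {R : realType}.

(** Used to refine the meshes of two Hausdorff measures independently. Finiteness of [c] makes every
    quantity finite, so that it can be moved across the inequality. *)
Lemma ereal_supD_le (S T : set \bar R) (c : \bar R) : c != +oo ->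
  S !=set0 -> T !=set0 -> (forall x, S x -> 0 <= x) -> (forall y, T y -> 0 <= y) ->
  (forall x y, S x -> T y -> x + y <= c) -> ereal_sup S + ereal_sup T <= c.
Proof.
move=> coo [x0 Sx0] [y0 Ty0] S0 T0 STc.
have c0 : 0 <= c.
  by apply: le_trans (STc _ _ Sx0 Ty0); apply: adde_ge0; [exact: S0|exact: T0].
have cfin : c \is a fin_num by rewrite ge0_fin_numE// ltey.
have Sfin x : S x -> x \is a fin_num.
  move=> Sx; rewrite ge0_fin_numE ?S0//; apply: (@le_lt_trans _ _ c); last by rewrite ltey.
  by apply: le_trans (STc _ _ Sx Ty0); rewrite leeDl// T0.
have Tc x : S x -> x + ereal_sup T <= c.
  move=> Sx; rewrite -leeBrDl ?Sfin//; apply: ge_ereal_sup => y Ty.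
  by rewrite leeBrDl ?Sfin//; exact: STc.
have Tfin : ereal_sup T \is a fin_num.
  rewrite ge0_fin_numE; last by apply: le_trans (T0 _ Ty0) _; exact: ereal_sup_ubound.
  apply: (@le_lt_trans _ _ c); last by rewrite ltey.
  by apply: le_trans (Tc _ Sx0); rewrite leeDr// S0.
rewrite -leeBrDr//; apply: ge_ereal_sup => x Sx.
by rewrite leeBrDr//; exact: Tc.
Qed.

Lemma nneseries_le_bound (f : nat -> \bar R) (c : \bar R) : (forall k, 0 <= f k) ->
  (forall K, \sum_(0 <= k < K) f k <= c) -> \sum_(k <oo) f k <= c.
Proof.
move=> f0 fc; apply: lime_le; first by apply: is_cvg_nneseries => k _ _.
exact: nearW.
Qed.

End ereal_tools.

(** * Caratheodory's criterion for metric outer measures *)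

Section metric_outer_measure.
Local Open Scope ereal_scope.
Context {R : realType} {X : metricType R}.
Variable mu : {outer_measure set X -> \bar R}.
Hypothesis mu_separated : forall (A B : set X) (e : R), (0 < e)%R ->
  (forall a b, A a -> B b -> (e <= mdist a b)%R) -> mu A + mu B <= mu (A `|` B).

Variables (C Y : set X).
Let D (k : nat) : set X := [set x | forall c, C c -> (k.+1%:R^-1 <= mdist x c)%R].
Let B k := Y `&` D k.
Let rings k := B k.+1 `\` B k.

Let B_mono k l : (k <= l)%N -> B k `<=` B l.
Proof.
move=> kl x [Yx Dx]; split => // c Cc; apply: le_trans (Dx c Cc).
by rewrite lef_pV2 ?posrE// ler_nat.
Qed.

(** [b] selects the parity. Between two rings of the same parity lies a whole ring, so they are a
    positive distance apart and their measures add up inside [Y]. *)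
Let sum_rings b K : (\sum_(0 <= k < K) mu (rings (b + k.*2)) <= mu Y).
Proof.
apply: (@le_trans _ _ (mu (\bigcup_(k in `I_K) rings (b + k.*2)))); last first.
  by apply: le_outer_measure => x [k _ [[]]].
elim: K => [|K IHK].
  by rewrite big_nil outer_measure_ge0.
rewrite big_nat_recr//=; apply: le_trans (leeD2r _ IHK) _.
(* Points of the earlier rings are at least 1/(b + 2K) from [C], points of the new one less than
   1/(b + 2K + 1) from some point of [C]; the gap is the difference. For [K = 0] there is no earlier
   ring. *)
have e0 : (0 < ((b + K.*2)%:R^-1 - (b + K.*2).+1%:R^-1 : R) \/ K = 0%N)%R.
  case: K {IHK} => [|K]; [by right|left].
  by rewrite subr_gt0 ltf_pV2 ?posrE// ?ltr_nat// addn_gt0 double_gt0 orbT.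
case: e0 => [e0|->]; last first.
  rewrite (_ : \bigcup_(k in `I_0) _ = set0) ?outer_measure0 ?add0e; last first.
    by apply/seteqP; split => // x [].
  by apply: le_outer_measure => x Rx; exists 0%N.
apply: le_trans (mu_separated e0 _) _.
  move=> x y [k /= kK [[Yx Dx] _]] [[Yy _] By].
  have : ~ D (b + K.*2) y by move=> Dy; apply: By.
  move=> /existsNP[c /not_implyP[Cc /negP]]; rewrite -ltNge => yc.
  have xc := Dx c Cc.
  have tri := metric_triangle x y c.
  have le1 : ((b + K.*2)%:R^-1 <= ((b + k.*2).+1).+1%:R^-1 :> R)%R.
    rewrite lef_pV2 ?posrE ?ler_nat// ?ltr0n ?addn_gt0 ?double_gt0; last first.
      by rewrite (leq_ltn_trans _ kK)// orbT.
    by rewrite -addnS -addnS leq_add2l -doubleS leq_double.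
  rewrite lerBlDr; apply: (le_trans le1); apply: (le_trans xc).
  by apply: (le_trans tri); rewrite lerD2l; exact: ltW.
by apply: le_outer_measure => x [[k /= kK Rx]|Rx]; [exists k => //=; exact: ltnW|exists K => /=].
Qed.

(* Caratheodory's argument: the odd and the even [rings] around [C] are separated
   from one another, so that their measures are summable. *)
Lemma metric_outer_measure_closed : (forall x, ~ C x ->
    exists2 e : R, (0 < e)%R & forall c, C c -> (e <= mdist x c)%R) ->
  mu (Y `&` C) + mu (Y `&` ~` C) <= mu Y.
Proof.
move=> closedC; have [->|Yoo] := eqVneq (mu Y) +oo; first by rewrite leey.
have muY0 : mu Y \is a fin_num by rewrite ge0_fin_numE ?outer_measure_ge0// ltey.
have Yfin A : A `<=` Y -> mu A \is a fin_num.
  move=> AY; rewrite ge0_fin_numE ?outer_measure_ge0//.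
  by apply: le_lt_trans (le_outer_measure mu _ _ AY) _; rewrite ltey.
have r0 k : 0 <= mu (rings k) by exact: outer_measure_ge0.
have sum_fin : \sum_(k <oo) mu (rings k) < +oo.
  apply: (@le_lt_trans _ _ (mu Y + mu Y)); last first.
    by rewrite lte_add_pinfty// ltey.
  apply: nneseries_le_bound => // K.
  apply: (@le_trans _ _ (\sum_(0 <= k < K.*2) mu (rings k))).
    by apply: lee_sum_nneg_natr => //; rewrite -addnn leq_addr.
  have -> : \sum_(0 <= k < K.*2) mu (rings k) =
    \sum_(0 <= k < K) mu (rings (0 + k.*2)) + \sum_(0 <= k < K) mu (rings (1 + k.*2)).
    elim: K => [|K IHK]; first by rewrite !big_nil adde0.
    by rewrite doubleS !big_nat_recr//= IHK add0n add1n; rewrite -!addeA; congr (_ + _);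
      rewrite addeCA addeA; congr (_ + _); rewrite addeC.
  by apply: leeD; exact: sum_rings.
have cover n : Y `&` ~` C `<=` B n `|` \bigcup_k rings (k + n).
  move=> x [Yx Cx]; have [e e0 eP] := closedC x Cx.
  have [k ke] : exists k : nat, (k.+1%:R^-1 < e)%R.
    have [k _ kP] := near_infty_natSinv_lt (PosNum e0).
    by exists k; apply: (kP k); exact: leqnn.
  have Bk : exists k, `[< B (k + n) x >].
    exists k; apply/asboolP; apply: (@B_mono k); first exact: leq_addr.
    by split => // c /eP; apply: le_trans; exact: ltW.
  case: (ex_minnP Bk) => -[|j] /asboolP Bj minj; first by left.
  right; exists j => //; split => // Bj'.
  by have := minj j (asboolT Bj'); rewrite ltnn.
(* [B n] is separated from [C], so additivity holds with [B n] in place of the complement; the error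
   is a tail of a convergent series. *)
have main n : mu (Y `&` C) + mu (Y `&` ~` C) <=
    mu Y + \sum_(n <= k <oo) mu (rings k).
  have sepn : mu (Y `&` C) + mu (B n) <= mu Y.
    apply: le_trans (mu_separated (e := n.+1%:R^-1) _ _) _; rewrite ?invr_gt0//.
      by move=> c x [_ Cc] [_ Dx]; rewrite metric_sym; exact: Dx.
    by apply: le_outer_measure => x [[]|[]].
  apply: (@le_trans _ _ (mu (Y `&` C) + (mu (B n) + \sum_(n <= k <oo) mu (rings k)))).
    apply: leeD2l; apply: le_trans (le_outer_measure mu _ _ (cover n)) _.
    apply: le_trans (outer_measureU2 _ _ _) _; apply: leeD2l.
    apply: le_trans (outer_measure_sigma_subadditive mu (fun k => rings (k + n))) _.
    by rewrite (nneseries_addn n (f := fun k => mu (rings k)))// .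
  by rewrite addeA; exact: leeD2r.
apply/lee_addgt0Pr => e e0.
have /fine_cvgP[+ /cvgrPdist_lt/(_ e e0)] := nneseries_tail_cvg sum_fin (fun k _ => r0 k).
move=> [n1 _ finP] [n2 _ ltP]; pose n := maxn n1 n2.
apply: le_trans (main n) _; apply: leeD2l.
have nfin := finP n (leq_maxl _ _).
have := ltP n (leq_maxr _ _); rewrite /= sub0r normrN => /ltW lte.
by rewrite -[leLHS]fineK// lee_fin; apply: le_trans lte; exact: ler_norm.
Qed.

End metric_outer_measure.

(** * Hausdorff measure: separated sets and null sets *)

Section hausdorff_facts.
Local Open Scope ereal_scope.
Context {R : realType} {T : Type}.
Variable d : T -> T -> R.
Implicit Types (A B F : set T) (s e : R).

Lemma diameter_le A (e : R) : (0 <= e)%R ->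
  (forall x y, A x -> A y -> (d x y <= e)%R) -> diameter d A <= e%:E.
Proof.
move=> e0 Ae; apply: ge_ereal_sup => _ /= [->|[x [y [Ax Ay ->]]]]; rewrite lee_fin//.
exact: Ae.
Qed.

Lemma diameter_ge0 A : 0 <= diameter d A.
Proof. by apply: ereal_sup_ubound; left. Qed.

Lemma dist_le_diameter A x y : A x -> A y -> (d x y)%:E <= diameter d A.
Proof. by move=> Ax Ay; apply: ereal_sup_ubound; right; exists x, y. Qed.

Lemma le_diameter A B : A `<=` B -> diameter d A <= diameter d B.
Proof.
move=> AB; apply: ge_ereal_sup => _ /= [->|[x [y [Ax Ay ->]]]]; first exact: diameter_ge0.
by apply: dist_le_diameter; exact: AB.
Qed.

Lemma hausdorff_gauge_le s A B : (0 <= s)%R -> A `<=` B ->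
  hausdorff_gauge d s A <= hausdorff_gauge d s B.
Proof.
move=> s0 AB; rewrite {1}/hausdorff_gauge.
case: asboolP => [[x Ax]|_]; last exact: hausdorff_gauge_ge0.
rewrite /hausdorff_gauge; case: asboolP => [_|[]]; last by exists x; exact: AB.
by apply: gt0_ler_poweR => //; rewrite ?in_itv /= ?leey ?diameter_ge0// le_diameter.
Qed.

Lemma hausdorff_gauge_le_powR s A (e : R) : (0 <= s)%R -> (0 <= e)%R ->
  (forall x y, A x -> A y -> (d x y <= e)%R) -> hausdorff_gauge d s A <= (e `^ s)%:E.
Proof.
move=> s0 e0 Ae; rewrite /hausdorff_gauge; case: asboolP => [_|_]; last first.
  by rewrite lee_fin powR_ge0.
rewrite -poweR_EFin; apply: gt0_ler_poweR => //.
- by rewrite in_itv /= leey diameter_ge0.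
- by rewrite in_itv /= leey lee_fin e0.
- exact: diameter_le.
Qed.

Lemma hausdorff_premeasure_mono s (e e' : R) A : (e <= e')%R ->
  hausdorff_premeasure d s e' A <= hausdorff_premeasure d s e A.
Proof.
move=> ee'; apply: ereal_inf_le_tmp => _ [F [Fd FA] <-]; exists F => //; split => // k.
by apply: le_trans (Fd k) _; rewrite lee_fin.
Qed.

Lemma hausdorff_separated s A B (e : R) : (0 <= s)%R -> (0 < e)%R ->
  (forall a b, A a -> B b -> (e <= d a b)%R) ->
  hausdorff_measure d s A + hausdorff_measure d s B <= hausdorff_measure d s (A `|` B).
Proof.
move=> s0 e0 sep; have [->|Hoo] := eqVneq (hausdorff_measure d s (A `|` B)) +oo.
  by rewrite leey.
apply: ereal_supD_le => //.
- by exists (hausdorff_premeasure d s 1 A); exists 1%R => /=.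
- by exists (hausdorff_premeasure d s 1 B); exists 1%R => /=.
- by move=> _ [f _ <-]; exact: hausdorff_premeasure_ge0.
- by move=> _ [f _ <-]; exact: hausdorff_premeasure_ge0.
move=> _ _ [d1 /= d10 <-] [d2 /= d20 <-].
(* With mesh below the separation [e], no covering set meets both [A] and [B], so each cover splits
   into a cover of [A] and one of [B] at no cost. *)
pose f := Num.min (Num.min d1 d2) (e / 2)%R.
have f0 : (0 < f)%R by rewrite !lt_min d10 d20 divr_gt0.
have f1 : (f <= d1)%R by rewrite !ge_min lexx.
have f2 : (f <= d2)%R by rewrite !ge_min lexx orbT.
have fe : (f < e)%R by rewrite gt_min [X in _ || X](_ : _ = true) ?orbT//; lra.
apply: (@le_trans _ _ (hausdorff_premeasure d s f A + hausdorff_premeasure d s f B)).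
  by apply: leeD; exact: hausdorff_premeasure_mono.
apply: (@le_trans _ _ (hausdorff_premeasure d s f (A `|` B))); last first.
  by apply: ereal_sup_ubound; exists f.
apply: le_ereal_inf_tmp => _ [F [Ff FAB] <-].
pose g := hausdorff_gauge d s.
have g0 G k : 0 <= g (F k `&` G) by exact: hausdorff_gauge_ge0.
apply: (@le_trans _ _ (\sum_(k <oo) (g (F k `&` A) + g (F k `&` B)))).
  rewrite nneseriesD//.
  have cov G : G `<=` A `|` B ->
      hausdorff_premeasure d s f G <= \sum_(k <oo) g (F k `&` G).
    move=> GAB; apply: ereal_inf_lbound; exists (fun k => F k `&` G) => //; split.
      by move=> k; apply: le_trans (Ff k); apply: le_diameter => x [].
    by move=> x Gx; have [k _ Fkx] := FAB _ (GAB _ Gx); exists k.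
  by apply: leeD; apply: cov => x; [left|right].
apply: lee_nneseries => [k _ _|k _]; first by rewrite adde_ge0.
have [[a [Fa Aa]]|FA] := pselect (F k `&` A !=set0).
  have [[b [Fb Bb]]|FB] := pselect (F k `&` B !=set0).
    have := le_trans (dist_le_diameter Fa Fb) (Ff k); rewrite lee_fin.
    by have := sep _ _ Aa Bb; move=> /le_trans /[apply]; rewrite leNgt fe.
  rewrite (_ : F k `&` B = set0); last by apply/seteqP; split => // x Fx; apply: FB; exists x.
  by rewrite /g hausdorff_gauge0 adde0; apply: hausdorff_gauge_le => // x [].
rewrite (_ : F k `&` A = set0); last by apply/seteqP; split => // x Fx; apply: FA; exists x.
by rewrite /g hausdorff_gauge0 add0e; apply: hausdorff_gauge_le => // x [].
Qed.

(* Each summand is at most [e], hence so are the diameters after taking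
   [s]-th roots: no separate control of the mesh of the cover is needed. *)
Lemma hausdorff_measure_eq0 s A : (0 < s)%R ->
  (forall e : R, (0 < e)%R -> exists (I : finType) (F : I -> set T) (D : I -> R),
    [/\ A `<=` \bigcup_i F i, forall i, (0 <= D i)%R,
        forall i x y, F i x -> F i y -> (d x y <= D i)%R &
        (\sum_i D i `^ s <= e)%R]) ->
  hausdorff_measure d s A = 0.
Proof.
move=> s0 cov; apply/eqP; rewrite eq_le hausdorff_measure_ge0 andbT.
apply: ge_ereal_sup => _ [f /= f0 <-]; apply/lee_addgt0Pr => e e0; rewrite add0e.
pose e' : R := Num.min e (f `^ s)%R.
have e'0 : (0 < e')%R by rewrite lt_min e0 powR_gt0.
have [I [F [D [AF D0 FD De]]]] := cov e' e'0.
have Ds i : (D i `^ s <= e')%R.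
  apply: le_trans De; rewrite (bigD1 i)//= lerDl; apply: sumr_ge0 => j _.
  exact: powR_ge0.
have Df i : (D i <= f)%R.
  have := Ds i; rewrite le_min => /andP[_]; apply: contraTle => fD.
  by rewrite -ltNge gt0_ltr_powR// ?nnegrE// ltW.
pose G k := if insub k is Some j then F (enum_val (j : 'I_#|I|)) else set0.
have G1 : \sum_(k <oo) hausdorff_gauge d s (G k) = \sum_(i in I) hausdorff_gauge d s (F i).
  rewrite (nneseries_split 0 #|I|) => [|k _]; last exact: hausdorff_gauge_ge0.
  rewrite add0n eseries0 ?adde0 => [|k]; last first.
    by rewrite /G => + _; case: insubP => [j jI _|_ _]; [rewrite leqNgt jI|rewrite hausdorff_gauge0].
  rewrite big_mkord (reindex_onto (@enum_rank I) (@enum_val I _)) /=; last first.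
    by move=> j _; rewrite enum_valK.
  by apply: eq_big => i; rewrite ?enum_rankK ?eqxx// => _; rewrite /G valK enum_rankK.
apply: (@le_trans _ _ (\sum_(k <oo) hausdorff_gauge d s (G k))).
  apply: ereal_inf_lbound; exists G => //; split => [k|x Ax].
    rewrite /G; case: insub => [j|]; last by rewrite diameter0 lee_fin ltW.
    apply: diameter_le; first exact: ltW.
    by move=> x y Fx Fy; apply: le_trans (Df _); exact: FD Fx Fy.
  have [i _ Fi] := AF x Ax; exists (enum_rank i) => //.
  by rewrite /G valK enum_rankK.
rewrite G1; apply: (@le_trans _ _ (\sum_(i in I) (D i `^ s)%:E)).
  by apply: lee_sum => i _; apply: hausdorff_gauge_le_powR => //; [exact: ltW|exact: FD].
by rewrite sumEFin lee_fin; apply: le_trans De _; rewrite ge_min lexx.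
Qed.

Lemma hausdorff_dim_le s A : (0 <= s)%R -> hausdorff_measure d s A = 0 ->
  hausdorff_dim d A <= s%:E.
Proof. by move=> s0 As; apply: ereal_inf_lbound; exists s. Qed.

Lemma hausdorff_measure_bigcup_eq0 s (A : (set T)^nat) :
  (forall k, hausdorff_measure d s (A k) = 0) -> hausdorff_measure d s (\bigcup_k A k) = 0.
Proof.
move=> A0; apply/eqP; rewrite eq_le hausdorff_measure_ge0 andbT.
by apply: le_trans (hausdorff_measure_sigma_subadditive _ _ _) _; rewrite eseries0.
Qed.

Lemma hausdorff_measure_sub_eq0 s A B : A `<=` B -> hausdorff_measure d s B = 0 ->
  hausdorff_measure d s A = 0.
Proof.
move=> AB B0; apply/eqP; rewrite eq_le hausdorff_measure_ge0 andbT -B0.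
exact: le_hausdorff_measure.
Qed.

End hausdorff_facts.

Section hausdorff_borel.
Local Open Scope ereal_scope.
Context {R : realType} {X : metricType R}.
Variable s : R.
Hypothesis s0 : (0 <= s)%R.

Lemma hausdorff_caratheodory_open (U : set X) : open U ->
  caratheodory_measurable (hausdorff_measure (@mdist R X) s) U.
Proof.
move=> /metric_openP oU; rewrite -(setCK U).
apply: caratheodory_measurable_setC; apply: le_caratheodory_measurable => Y.
apply: metric_outer_measure_closed => [A B e e0 AB|x /contrapT Ux].
  exact: hausdorff_separated AB.
have [e e0 xe] := oU x Ux; exists e => // c Uc; rewrite leNgt; apply/negP => xc.
exact/Uc/xe.
Qed.

End hausdorff_borel.

(** * Comparison of Haar and Hausdorff measure *)

Section lebesgue_hausdorff.
Local Open Scope ereal_scope.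
Context {R : realType} {n : nat}.
Local Notation Q := (n * 2).+2.
Let kappa : R := (2 ^+ (n * 2).+1)%R.
Variable L : {sigma_finite_measure set (heisB R n) -> \bar R}.
Hypothesis HL : heis_lebesgue L.

(** A set of diameter D lies in the box of radius D about any of its points, whose Haar measure is
    [kappa] times D^Q. *)
Lemma heis_lebesgue_le_hausdorff (A : set (heisB R n)) : measurable A ->
  L A <= kappa%:E * heis_measure (A : set (heis R n)).
Proof.
move=> mA; have [Lbox _ _] := HL.
have k0 : (0 < kappa)%R by exact: exprn_gt0.
pose d := @mdist R (heis R n); pose s : R := (2 * n + 2)%N%:R.
have sQ : s = Q%:R by rewrite /s mulnC addn2.
have s0 : (0 < s)%R by rewrite sQ.
(* A single mesh is enough, since it only serves to make the diameters finite. *)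
apply: (@le_trans _ _ (kappa%:E * hausdorff_premeasure d s 1 A)); last first.
  apply: lee_wpmul2l; first by rewrite lee_fin ltW.
  by apply: ereal_sup_ubound; exists 1%R => /=.
rewrite -lee_pdivrMl//; apply: le_ereal_inf_tmp => _ [F [F1 FA] <-].
rewrite lee_pdivrMl//.
have [B PB] : {B : nat -> set (heisB R n) & forall k, [/\ measurable (B k),
    F k `<=` B k & L (B k) <= kappa%:E * hausdorff_gauge d s (F k)]}.
  apply: (@choice _ _ (fun k B => [/\ measurable (B : set (heisB R n)),
    F k `<=` B & L B <= kappa%:E * hausdorff_gauge d s (F k)])) => k.
  have [[x Fx]|F0] := pselect (F k !=set0); last first.
    exists set0; split => //; first by move=> x Fx; case: F0; exists x.
    by rewrite measure0 mule_ge0 ?hausdorff_gauge_ge0// lee_fin ltW.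
  have Dfin : diameter d (F k) \is a fin_num.
    by rewrite ge0_fin_numE ?diameter_ge0//; apply: le_lt_trans (F1 k) _; rewrite ltry.
  pose D := fine (diameter d (F k)).
  have D0 : (0 <= D)%R by rewrite fine_ge0// diameter_ge0.
  exists (heis_box x D); split; first exact: measurable_heis_box.
    move=> y Fy; apply: heis_dist_box; rewrite -lee_fin /D fineK//.
    exact: (dist_le_diameter d).
  rewrite Lbox// /hausdorff_gauge asboolT; last by exists x.
  by rewrite -[diameter d _]fineK// poweR_EFin -EFinM sQ powR_mulrn.
apply: (@le_trans _ _ (\sum_(k <oo) L (B k))).
  apply: measure_sigma_subadditive => // [k|]; first by have [] := PB k.
  by move=> x /FA[k _ Fx]; exists k => //; have [_ + _] := PB k; exact.
rewrite -nneseriesZl; last by move=> k _; exact: hausdorff_gauge_ge0.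
by apply: lee_nneseries => [k _ _|k _]; [exact: measure_ge0|have [] := PB k].
Qed.

Lemma measurable_fun_caratheodory_borel :
  measurable_fun setT (id : caratheodory_type (@heis_measure R n) -> heisB R n).
Proof.
have := @measurability _ _ (caratheodory_type (@heis_measure R n)) (heisB R n) setT id
  (@open (heis R n)).
apply => // _ [U oU <-]; rewrite setTI.
by apply: (@hausdorff_caratheodory_open R (heis R n) _ _ U oU).
Qed.

(** The two measures live on different sigma-algebras. The Hausdorff measure is pushed along the
    identity to the Borel sets, where it can be compared with [L]. *)
Lemma heis_integral_ge (U : set (heis R n)) (h : heis R n -> \bar R) : open U ->
  measurable_fun setT (h : heisB R n -> _) -> (forall x, 0 <= h x) ->
  \int[L]_(x in U) h x <= kappa%:E * heis_integral U h.
Proof.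
move=> oU mh h0; have mU := measurable_heis_open oU.
pose hm : {outer_measure set (heis R n) -> \bar R} := [the {outer_measure set _ -> \bar R} of @heis_measure R n].
pose mc := OuterMeasure_sort__canonical__measure_function_Measure hm.
have [m [mE mI]] := pushforward_measure mc measurable_fun_caratheodory_borel.
have mhU : measurable_fun setT (h \_ U : heisB R n -> _).
  by apply/(measurable_restrictT _ mU); exact: measurable_funTS.
have hU0 x : 0 <= (h \_ U) x by rewrite /patch; case: ifP.
have -> : heis_integral U h = \int[mc]_x (h \_ U) x by exact: (@integral_mkcond _ _ R mc U h).
rewrite integral_mkcond -[X in _ <= _ * X](mI _ mhU hU0).
have k0 : (0 <= kappa)%R by exact: exprn_ge0.
rewrite -[kappa]/((NngNum k0)%:num) -(@ge0_integral_mscale _ _ _ m setT)//.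
apply: ge0_le_measure_integral => // A mA.
rewrite /= /mscale /= mE; exact: heis_lebesgue_le_hausdorff.
Qed.

End lebesgue_hausdorff.

(** * Horizontal segments as rectifiable paths *)

Section segments.
Local Open Scope ereal_scope.
Context {R : realType} {n : nat} {Y : metricType R}.
Variables (f : heis R n -> Y) (g : heis R n -> \bar R).
Hypothesis fg : upper_gradient f g.
Implicit Types (x : heis R n) (e : 'rV[R]_(n * 2)).

Section one_segment.
Variables (x : heis R n) (e : 'rV[R]_(n * 2)) (l : R).
Hypotheses (e1 : enorm e = 1%R) (l0 : (0 < l)%R).

Let gamma (t : R) : heis R n := heis_mul x ((t * l) *: e, 0%R).

Lemma segment_mdist (s t : R) : mdist (gamma s) (gamma t) = (`|t - s| * l)%R.
Proof.
rewrite -[LHS]/(heis_dist _ _) heis_dist_horizontal; last by rewrite !omega_simp !mulr0.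
by rewrite -scalerBl -mulrBl enormZ e1 mulr1 normrM (gtr0_norm l0).
Qed.

Lemma segment_variation (b a : R) (s : seq R) : path <%R a s ->
  path_variation a b gamma s = ((last a s - a) * l)%R.
Proof.
rewrite /path_variation; elim: s a => [a _|c s IHs a /= /andP[ac cs]].
  by rewrite /= big_nil subrr mul0r.
rewrite big_nat_recl//= IHs// segment_mdist gtr0_norm ?subr_gt0//; ring.
Qed.

Lemma segment_length (t : R) : (0 <= t)%R -> path_length 0 t gamma = (t * l)%:E.
Proof.
move=> t0; rewrite /path_length (_ : [set _ | _ in _] = [set (t * l)%:E]) ?ereal_sup1//.
apply/seteqP; split => [_ [s [ps /eqP lst] <-]|_ ->] /=.
  by rewrite segment_variation// lst subr0.
(* Partitions are strictly increasing, so at [t = 0] the witness is the empty list instead of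
   [[:: t]]. *)
have [t_eq0|t_neq0] := eqVneq t 0%R.
  exists [::]; first by split => //=; rewrite t_eq0.
  by rewrite segment_variation//= t_eq0 subrr.
have tgt0 : (0 < t)%R by rewrite lt_neqAle eq_sym t_neq0.
exists [:: t]; first by split => //=; rewrite tgt0.
by rewrite segment_variation/= ?tgt0// subr0.
Qed.

Lemma segment_arclength (s : R) : (0 <= s <= l)%R ->
  arclength_param gamma s = heis_mul x (s *: e, 0%R).
Proof.
move=> /andP[s0 sl]; rewrite /arclength_param.
have -> : inf [set t : R | (0 <= t <= 1)%R /\ s%:E <= path_length 0 t gamma] = (s / l)%R.
  rewrite (_ : [set _ | _] = [set` `[(s / l)%R, 1%R]]).
    by rewrite inf_itv// bnd_simp ler_pdivrMr// mul1r.
  apply/seteqP; split => t /=; rewrite in_itv /=.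
    by move=> [/andP[t0 t1]]; rewrite segment_length// lee_fin -ler_pdivrMr// => ->.
  move=> /andP[st t1]; have t0 : (0 <= t)%R by apply: le_trans st; rewrite divr_ge0// ltW.
  by rewrite t0 t1 segment_length// lee_fin -ler_pdivrMr.
by rewrite /gamma divfK ?gt_eqF.
Qed.

Lemma segment_rectifiable : rectifiable gamma.
Proof.
split; last by rewrite segment_length// ltry.
apply: continuous_subspaceT => t.
apply/(@cvg_ballP R (heis R n)) => /= d d0.
apply/nbhs_ballP; exists (d / l)%R => /=; first by rewrite divr_gt0.
move=> s ts; rewrite ballEmdist /= segment_mdist -ltr_pdivlMr//.
by move: ts; rewrite /ball/= distrC.
Qed.

Lemma segment_upper_gradient_pos :
  (mdist (f x) (f (heis_mul x (l *: e, 0%R))))%:E <=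
    \int[lebesgue_measure]_(s in `[0%R, l]) g (heis_mul x (s *: e, 0%R)).
Proof.
have [_ _ /(_ _ segment_rectifiable)] := fg.
rewrite /gamma mul0r mul1r scale0r heis_mul0 => /le_trans; apply.
rewrite /path_integral segment_length// mul1r /=.
rewrite le_eqVlt; apply/orP; left; apply/eqP; apply: eq_integral => s.
by rewrite inE /= in_itv /= => sl; rewrite segment_arclength.
Qed.

End one_segment.

Lemma segment_upper_gradient x e (l : R) : enorm e = 1%R -> (0 <= l)%R ->
  (mdist (f x) (f (heis_mul x (l *: e, 0%R))))%:E <=
    \int[lebesgue_measure]_(s in `[0%R, l]) g (heis_mul x (s *: e, 0%R)).
Proof.
move=> e1; rewrite le_eqVlt => /predU1P[<-|l0]; last exact: segment_upper_gradient_pos.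
rewrite scale0r heis_mul0 mdistxx; apply: integral_ge0 => s _.
by have [_ + _] := fg; exact.
Qed.

End segments.

(** * Covering a family of cosets by balls *)

Section horizontal_coordinates.
Context {R : realType} {n : nat}.
Local Notation N := (n * 2)%N.
Variable V : {vspace 'rV[R]_N}.

(* [b |-> b *m P] and [c |-> c *m S] parametrize [V] and its orthogonal complement,
   with inverses given by [Pc] and [Sc]. *)
Lemma horizontal_coordinates : exists (d : nat) (P : 'M[R]_(\dim V, N))
    (Pc : 'M[R]_(N, \dim V)) (S : 'M[R]_(d, N)) (Sc : 'M[R]_(N, d)),
  [/\ (\dim V + d)%N = N,
      P *m Pc = 1%:M,
      forall b : 'rV_(\dim V), b *m P \in V,
      forall v, v \in V -> v = v *m Pc *m P /\ v *m Sc = 0 &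
      forall z, (forall v, v \in V -> dotp z v = 0) -> z = z *m Sc *m S /\ z *m Pc = 0].
Proof.
pose P : 'M[R]_(\dim V, N) := \matrix_i tnth (vbasis V) i.
have PV (b : 'rV_(\dim V)) : b *m P \in V.
  rewrite mulmx_sum_row; apply: memv_suml => i _; apply: memvZ.
  by rewrite rowK; apply: vbasis_mem; exact: mem_tnth.
have VP v : v \in V -> exists b : 'rV_(\dim V), v = b *m P.
  move=> vV; exists (\row_i coord (vbasis V) i v).
  rewrite {1}(coord_vbasis vV) mulmx_sum_row; apply: eq_bigr => i _.
  by rewrite mxE rowK (tnth_nth 0).
have Pfree (b : 'rV_(\dim V)) : b *m P = 0 -> b = 0.
  move=> bP; have /freeP Vf := basis_free (vbasisP V).
  apply/rowP => i; rewrite mxE; apply: (Vf (fun i => b 0 i)).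
  rewrite -[RHS]bP mulmx_sum_row; apply: eq_bigr => j _.
  by rewrite rowK (tnth_nth 0).
have dotpE z w : dotp z w = (z *m w^T) 0 0.
  by rewrite mxE; apply: eq_bigr => k _; rewrite mxE.
pose S := row_base (kermx P^T).
exists (\rank (kermx P^T)).
have SP : S *m P^T = 0.
  by apply/sub_kermxP; rewrite eq_row_base.
pose B := col_mx P S.
have Brank : row_free B.
  rewrite -kermx_eq0; apply/rowV0P => w /sub_kermxP.
  rewrite -[w]hsubmxK mul_row_col; set b := lsubmx w; set c := rsubmx w => bc.
  (* [b *m P] is orthogonal to itself: it equals [- (c *m S)], and the rows of [S] are orthogonal to
     those of [P]. *)
  have bS : b *m P = 0.
    apply: dotp_eq0; rewrite dotpE trmx_mul.
    have -> : b *m P = - (c *m S) by apply/eqP; rewrite -addr_eq0 bc.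
    by rewrite mulNmx -mulmxA (mulmxA S) SP mul0mx mulmx0 oppr0 mxE.
  have cS : c *m S = 0 by move: bc; rewrite bS add0r.
  have c0 : c = 0.
    by apply: (row_free_inj (row_base_free (kermx P^T))); rewrite mul0mx.
  by rewrite (Pfree _ bS) c0 row_mx0.
have Pr : \rank P = \dim V.
  apply/eqP; rewrite -[_ == _]/(row_free P) -kermx_eq0; apply/rowV0P => w /sub_kermxP.
  exact: Pfree.
have dE : (\dim V + \rank (kermx P^T))%N = N.
  rewrite mxrank_ker mxrank_tr Pr subnKC//.
  by rewrite -{1}Pr rank_leq_col.
have Bfull : row_full B.
  by rewrite -col_leq_rank (eqP Brank) dE.
(* The stacked matrix [B] has full row and column rank; the two column blocks of its inverse are
   [Pc] and [Sc]. *)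
have BB := mulmxVp Brank; have BB' := mulVpmx Bfull.
rewrite -[pinvmx B]hsubmxK in BB BB'.
set Pc := lsubmx (pinvmx B) in BB BB'; set Sc := rsubmx (pinvmx B) in BB BB'.
move: BB; rewrite mul_col_row scalar_mx_block => /eq_block_mx[PPc PSc SPc SSc].
rewrite mul_row_col in BB'.
exists P, Pc, S, Sc; split => // [v /VP[b ->]|z zV].
  by rewrite -!mulmxA PSc mulmx0 (mulmxA P) PPc mul1mx.
have : (z <= S)%MS.
  rewrite eq_row_base; apply/sub_kermxP/rowP => i.
  rewrite [RHS]mxE -[LHS](_ : dotp z (tnth (vbasis V) i) = _).
    by apply: zV; apply: vbasis_mem; exact: mem_tnth.
  by rewrite /dotp mxE; apply: eq_bigr => k _; rewrite !mxE.
move=> /submxP[c ->]; split; last by rewrite -mulmxA SPc mulmx0.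
by rewrite -(mulmxA c) SSc mulmx1.
Qed.

End horizontal_coordinates.

(** * Counting grid points *)

Section grids.
Context {R : realType}.
Implicit Types (D r c x y : R).

Definition grid_point D r (k : nat) : R := - D + r * k%:R.

(** The successor provides the cell that contains the right end [D]. *)
Definition grid_size D r : nat := (Num.truncn (2 * D / r)).+1.

Lemma grid_size_le D r : 0 <= D -> 0 < r -> r <= 1 -> r * (grid_size D r)%:R <= 2 * D + 1.
Proof.
move=> D0 r0 r1; have x0 : 0 <= 2 * D / r by rewrite divr_ge0 ?mulr_ge0// ltW.
have e : (grid_size D r)%:R = (Num.truncn (2 * D / r))%:R + 1 :> R by rewrite natr1.
have /andP[+ _] := truncn_itv x0; rewrite e ler_pdivlMr//.
by rewrite mulrDr mulr1 mulrC; lra.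
Qed.

Lemma grid_cell D r x : 0 < r -> `|x| <= D ->
  exists k : 'I_(grid_size D r), `|x - grid_point D r k| <= r.
Proof.
move=> r0; rewrite ler_norml => /andP[Dx xD].
have x0 : 0 <= (x + D) / r by rewrite divr_ge0 ?(ltW r0)//; lra.
have D0 : 0 <= 2 * D / r by rewrite divr_ge0 ?(ltW r0)//; lra.
have kK : (Num.truncn ((x + D) / r) < grid_size D r)%N.
  by rewrite ltnS; apply: le_truncn; rewrite ler_pM2r ?invr_gt0//; lra.
exists (Ordinal kK); rewrite /grid_point /=.
have /andP[h1 h2] := truncn_itv x0.
have e : (Num.truncn ((x + D) / r)).+1%:R = (Num.truncn ((x + D) / r))%:R + 1 :> R.
  by rewrite natr1.
move: h1 h2; rewrite ler_pdivlMr// ltr_pdivrMr// e => h1 h2.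
by rewrite ler_norml; apply/andP; split; lra.
Qed.

(** Subtracting the least admissible index injects the admissible ones into the integers from 0 to
    the truncation of 2c/r. *)
Lemma grid_count K D r c y : 0 < r -> 0 <= c ->
  \sum_(k < K) (`|grid_point D r k - y| <= c)%R%:R <= 2 * c / r + 1 :> R.
Proof.
move=> r0 c0; pose A := [set k : 'I_K | `|grid_point D r k - y| <= c]%SET.
have x0 : 0 <= 2 * c / r by rewrite divr_ge0 ?mulr_ge0// ltW.
rewrite -natr_sum (_ : (\sum_(k < K) _)%N = #|A|); last first.
  by rewrite -sum1_card [RHS]big_mkcond; apply: eq_bigr => k _; rewrite inE; case: ifP.
have [A0|[k1 k1A]] := set_0Vmem A; first by rewrite A0 cards0; lra.
case: (@arg_minnP _ k1 (mem A) (fun k => val k) k1A) => k0 k0A k0min.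
pose T := Num.truncn (2 * c / r); have /andP[Tle ltT] := truncn_itv x0.
suff : (#|A| <= T.+1)%N.
  rewrite -(ler_nat R) => /le_trans; apply.
  by rewrite -[T.+1%:R]natr1 lerD2r; exact: Tle.
have kT (k : 'I_K) : k \in A -> (k - k0 < T.+1)%N.
  move=> kA; have kk0 := k0min _ kA.
  rewrite ltnS -(ler_nat R) natrB//; move: kA k0A.
  rewrite !inE /grid_point => kA k0A.
  rewrite leNgt; apply/negP => Tk.
  have Tk' : T.+1%:R <= k%:R - k0%:R :> R.
    by rewrite -natrB// ler_nat -(ltr_nat R) natrB.
  have := lt_le_trans ltT Tk'; rewrite ltr_pdivrMr//.
  by move: kA k0A; rewrite !ler_norml => /andP[? ?] /andP[? ?]; lra.
rewrite -[T.+1]card_ord -(@card_in_imset _ _ (fun k : 'I_K => inord (k - k0) : 'I_T.+1)).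
  exact: max_card.
move=> k l kA lA /(congr1 val); rewrite /= !inordK ?kT// => kl.
apply: val_inj; rewrite /= -(subnK (k0min _ kA)) -(subnK (k0min _ lA)).
by rewrite /= kl.
Qed.

Lemma grid_count_ffun d K D r c (y : 'I_d -> R) : 0 < r -> 0 <= c ->
  \sum_(f : {ffun 'I_d -> 'I_K}) \prod_l (`|grid_point D r (f l) - y l| <= c)%R%:R
    <= (2 * c / r + 1) ^+ d :> R.
Proof.
move=> r0 c0.
rewrite -(bigA_distr_bigA (fun l k => (`|grid_point D r (nat_of_ord k) - y l| <= c)%R%:R)).
rewrite -[in leRHS](card_ord d) -prodr_const.
apply: ler_prod => l _; rewrite grid_count// andbT.
by apply: sumr_ge0 => k _; exact: ler0n.
Qed.

End grids.

Section matrix_bounds.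
Context {R : realType} {n : nat}.
Local Notation N := (n * 2)%N.

Lemma enorm_mulmx_bound a (A : 'M[R]_(a, N)) : exists2 K : R, 0 <= K &
  forall (w : 'rV_a) (e : R), (forall i, `|w ord0 i| <= e) -> 0 <= e ->
    enorm (w *m A) <= K * e.
Proof.
exists (\sum_i enorm (row i A)); first by apply: sumr_ge0 => i _; exact: enorm_ge0.
move=> w e we e0; rewrite mulmx_sum_row.
apply: le_trans (enorm_sum _) _; rewrite mulr_suml; apply: ler_sum => i _.
by rewrite enormZ mulrC ler_wpM2l ?enorm_ge0.
Qed.

Lemma coord_mulmx_bound a (A : 'M[R]_(N, a)) : exists2 K : R, 0 <= K &
  forall (z : 'rV_N) i, `|(z *m A) ord0 i| <= K * enorm z.
Proof.
exists (\sum_k \sum_i `|A k i|).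
  by apply: sumr_ge0 => k _; apply: sumr_ge0 => i _.
move=> z i; rewrite mxE; apply: le_trans (ler_norm_sum _ _ _) _.
rewrite mulr_suml; apply: ler_sum => k _; rewrite normrM mulrC.
apply: ler_pM => //; last exact: coord_le_enorm.
by rewrite (bigD1 i)//= lerDl sumr_ge0.
Qed.

End matrix_bounds.

(** * Overlap of the tubes over distinct cells *)

Section covering.
Context {R : realType} {n : nat}.
Local Notation N := (n * 2)%N.
Variable V : {vspace 'rV[R]_N}.
Local Notation m := (\dim V).
Hypothesis isoV : isotropic V.
Variables (d : nat) (P : 'M[R]_(m, N)) (Pc : 'M[R]_(N, m)) (S : 'M[R]_(d, N))
  (Sc : 'M[R]_(N, d)).
Hypotheses (PPc : P *m Pc = 1%:M) (PV : forall b : 'rV_m, b *m P \in V).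
Hypothesis VP : forall v, v \in V -> v = v *m Pc *m P /\ v *m Sc = 0.
Hypothesis perpS : forall z, (forall v, v \in V -> dotp z v = 0) ->
  z = z *m Sc *m S /\ z *m Pc = 0.
Implicit Types (a x y : heis R n).

Definition grid_vector (D r : R) K (i : {ffun 'I_m -> 'I_K}) : 'rV[R]_N :=
  (\row_l grid_point D r (i l)) *m P.

Definition coset_point a (v : 'rV[R]_N) : heis R n := heis_mul a (v, 0).

Definition in_cell (D rho : R) K (j : {ffun 'I_d -> 'I_K} * 'I_K) a : Prop :=
  (forall l, `|(a.1 *m Sc) ord0 l - grid_point D rho (j.1 l)| <= rho) /\
  `|a.2 - grid_point D rho j.2| <= rho.

Section overlap.
Variables (D lam : R).
Hypotheses (D0 : 0 <= D) (lam0 : 0 <= lam).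

(* Given the horizontal data of a cell, the vertical coordinate of a point of
   the ball is determined up to [r ^+ 2 <= rho], so it lies in boundedly many
   vertical slots; only the [d] horizontal ones contribute [r / rho]. *)
Lemma overlap_count : exists2 C : R, 0 <= C & forall (r rho : R) K1 K2
    (bad : pred ({ffun 'I_d -> 'I_K2} * 'I_K2)) (a : {ffun 'I_d -> 'I_K2} * 'I_K2 -> heis R n) y,
  0 < r -> r <= 1 -> 0 < rho -> rho <= r -> r ^+ 2 <= rho -> r * K1%:R <= 2 * D + 1 ->
  (forall j, bad j -> [/\ vertical_complement V (a j), in_cell D rho j (a j) &
     forall l, `|((a j).1 *m Sc) ord0 l| <= D]) ->
  \sum_(i : {ffun 'I_m -> 'I_K1}) \sum_(j | bad j)
     (heis_dist (coset_point (a j) (grid_vector D r i)) y < lam * r)%R%:R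
  <= C * (r / rho) ^+ d.
Proof.
have [KP KP0 hP] := enorm_mulmx_bound P.
have [KS KS0 hS] := enorm_mulmx_bound S.
have [KPc KPc0 hPc] := coord_mulmx_bound Pc.
have [KSc KSc0 hSc] := coord_mulmx_bound Sc.
(* [vmax] bounds the grid vectors, whose coordinates lie between -D and D + 1, and [W] bounds [y.1].
   The terms of [c3] are the height of the ball, the cost of replacing the base point by a corner of
   its cell, and the size of a slot. *)
pose vmax := KP * (D + 1); pose W := KS * D + vmax + lam.
pose c1 := KPc * lam; pose c2 := KSc * lam + 1.
pose c3 := lam ^+ 2 + 2 * KS * (vmax + W) + 1.
have vmax0 : 0 <= vmax by rewrite mulr_ge0// addr_ge0.
have W0 : 0 <= W by rewrite !addr_ge0// mulr_ge0.
have c10 : 0 <= c1 by rewrite mulr_ge0.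
have c20 : 0 <= c2 by rewrite addr_ge0// mulr_ge0.
have c30 : 0 <= c3.
  by rewrite !addr_ge0 ?sqr_ge0// mulr_ge0 ?addr_ge0// mulr_ge0.
exists ((2 * c1 + 1) ^+ m * ((2 * c2 + 1) ^+ d * (2 * c3 + 1))).
  rewrite mulr_ge0 ?exprn_ge0 ?addr_ge0 ?mulr_ge0 ?exprn_ge0 ?addr_ge0 ?mulr_ge0//.
have b1 (b : bool) : b -> b%:R = 1 :> R by move=> ->.
have rowB k (w w' : 'rV[R]_k) l : (w - w') ord0 l = w ord0 l - w' ord0 l.
  by rewrite !mxE.
move=> r rho K1 K2 bad a y r0 r1 rho0 rhor r2rho rK1 badP.
pose corner (jc : {ffun 'I_d -> 'I_K2}) : 'rV[R]_d := \row_l grid_point D rho (jc l).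
pose v (i : {ffun 'I_m -> 'I_K1}) := grid_vector D r i.
(* The height of the base point for which the vertical term of the distance from the [i]-th coset
   point to [y] vanishes, with the horizontal part of the base point replaced by the corner of its
   cell. *)
pose T i jc := y.2 - 2 * omega (corner jc *m S) (v i)
  - 2 * omega (corner jc *m S + v i) y.1.
pose A (i : {ffun 'I_m -> 'I_K1}) : R :=
  \prod_l (`|grid_point D r (i l) - (y.1 *m Pc) ord0 l| <= c1 * r)%R%:R.
pose B (jc : {ffun 'I_d -> 'I_K2}) : R :=
  \prod_l (`|grid_point D rho (jc l) - (y.1 *m Sc) ord0 l| <= c2 * r)%R%:R.
pose E i jc (jt : 'I_K2) : R := (`|grid_point D rho jt - T i jc| <= c3 * rho)%R%:R.
have A0 i : 0 <= A i by apply: prodr_ge0 => l _.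
have B0 jc : 0 <= B jc by apply: prodr_ge0 => l _.
have v_le i : enorm (v i) <= vmax.
  apply: hP; last by rewrite addr_ge0.
  move=> l; rewrite mxE /grid_point.
  have h1 : r * (i l)%:R <= r * K1%:R by rewrite ler_pM2l// ler_nat ltnW.
  have h2 : 0 <= r * (i l)%:R by rewrite mulr_ge0// ltW.
  by rewrite ler_norml; apply/andP; split; lra.
have vPc i l : (v i *m Pc) ord0 l = grid_point D r (i l).
  by rewrite /v /grid_vector -mulmxA PPc mulmx1 mxE.
(* The indicator of the ball is bounded by a product of three indicators, each restricting one group
   of indices, so that the sum over [i] and [j] can be carried out group by group. *)
have key i j : bad j ->
    (heis_dist (coset_point (a j) (v i)) y < lam * r)%R%:R <= A i * (B j.1 * E i j.1 j.2).
  move=> bj; case: (boolP (heis_dist _ _ < _)) => [xy|_]; last first.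
    by rewrite mulr_ge0// mulr_ge0// ler0n.
  have [perp [cellc cellt] cD] := badP j bj.
  have [zS zPc] := perpS perp.
  set z := (a j).1 in zS zPc cellc cD.
  pose x := coset_point (a j) (v i).
  have x1 : x.1 = z + v i by [].
  have x2 : x.2 = (a j).2 + 2 * omega z (v i) by rewrite /x /coset_point /= addr0.
  have [vvP vSc] := VP (PV (\row_l grid_point D r (i l))).
  rewrite -/(grid_vector D r i) -/(v i) in vvP vSc.
  have xye : enorm (y.1 - x.1) <= lam * r.
    by apply: le_trans (enorm_le_heis_dist _ _) (ltW xy).
  have Ai : A i = 1.
    apply: big1 => l _; apply: b1.
    have -> : grid_point D r (i l) - (y.1 *m Pc) ord0 l = - ((y.1 - x.1) *m Pc) ord0 l.
      by rewrite x1 mulmxBl mulmxDl zPc add0r rowB vPc opprB.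
    rewrite normrN; apply: le_trans (hPc _ _) _; rewrite /c1 -mulrA.
    exact: ler_wpM2l.
  have zc l : `|grid_point D rho (j.1 l) - (z *m Sc) ord0 l| <= rho.
    by rewrite distrC; exact: cellc.
  have Bj : B j.1 = 1.
    apply: big1 => l _; apply: b1.
    have h : `|(z *m Sc) ord0 l - (y.1 *m Sc) ord0 l| <= KSc * lam * r.
      have -> : (z *m Sc) ord0 l - (y.1 *m Sc) ord0 l = - ((y.1 - x.1) *m Sc) ord0 l.
        by rewrite x1 mulmxBl mulmxDl vSc addr0 rowB opprB.
      rewrite normrN; apply: le_trans (hSc _ _) _; rewrite -mulrA.
      exact: ler_wpM2l.
    apply: le_trans (ler_distD ((z *m Sc) ord0 l) _ _) _.
    by have := zc l; rewrite /c2; lra.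
  rewrite Ai Bj !mul1r /E [leRHS]b1//.
  have zle : enorm z <= KS * D by rewrite zS; apply: hS.
  have yW : enorm y.1 <= W.
    rewrite -[y.1](subrK x.1); apply: le_trans (enormD _ _) _.
    have : enorm x.1 <= KS * D + vmax.
      by rewrite x1; apply: le_trans (enormD _ _) (lerD _ _).
    have : lam * r <= lam by rewrite ler_piMr.
    by rewrite /W; lra.
  pose e := z - corner j.1 *m S.
  have eS : enorm e <= KS * rho.
    rewrite /e {1}zS -mulmxBl; apply: hS; last exact: ltW.
    by move=> l; rewrite rowB [X in _ - X]mxE; exact: cellc.
  have ev : `|omega e (v i)| <= KS * rho * vmax.
    by apply: le_trans (normr_omega_le _ _) _; apply: ler_pM; rewrite ?enorm_ge0.
  have ey : `|omega e y.1| <= KS * rho * W.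
    by apply: le_trans (normr_omega_le _ _) _; apply: ler_pM; rewrite ?enorm_ge0.
  have vert : `|y.2 - x.2 - 2 * omega x.1 y.1| <= lam ^+ 2 * rho.
    apply: le_trans (vert_le_heis_dist _ _) _.
    apply: (@le_trans _ _ ((lam * r) ^+ 2)).
      have lr0 : 0 <= lam * r by rewrite mulr_ge0// ltW.
      by apply: lerXn2r; rewrite ?nnegrE ?heis_dist_ge0// ltW.
    by rewrite exprMn ler_wpM2l ?sqr_ge0.
  have TE : T i j.1 - (a j).2 = (y.2 - x.2 - 2 * omega x.1 y.1)
      + 2 * omega e (v i) + 2 * omega e y.1.
    by rewrite /T x1 x2 /e !omega_simp; ring.
  move: vert ev ey cellt; rewrite !ler_norml.
  move=> /andP[? ?] /andP[? ?] /andP[? ?] /andP[? ?]; apply/andP.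
  rewrite /c3; have -> : T i j.1 = T i j.1 - (a j).2 + (a j).2 by rewrite subrK.
  by rewrite TE; split; lra.
apply: (@le_trans _ _ (\sum_i \sum_j A i * (B j.1 * E i j.1 j.2))).
  apply: ler_sum => i _; rewrite big_mkcond /=; apply: ler_sum => j _.
  by case: ifPn => [bj|_]; [exact: key|rewrite mulr_ge0// mulr_ge0// ler0n].
have Esum i jc : \sum_jt E i jc jt <= 2 * c3 + 1.
  apply: le_trans (grid_count _ _ _ _ _) _ => //; first by rewrite mulr_ge0// ltW.
  by rewrite mulrA mulfK ?gt_eqF.
have Bsum : \sum_jc B jc <= (2 * c2 + 1) ^+ d * (r / rho) ^+ d.
  apply: le_trans (grid_count_ffun _ _ _ rho0 _) _; first by rewrite mulr_ge0// ltW.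
  rewrite -exprMn; have rr : 1 <= r / rho by rewrite ler_pdivlMr// mul1r.
  have c20' : 0 <= c2 * (r / rho) by rewrite mulr_ge0// (le_trans _ rr).
  have e : 2 * (c2 * r) / rho = 2 * (c2 * (r / rho)) by ring.
  by apply: lerXn2r; rewrite ?nnegrE ?e; lra.
have Asum : \sum_i A i <= (2 * c1 + 1) ^+ m.
  apply: le_trans (grid_count_ffun _ _ _ r0 _) _; first by rewrite mulr_ge0// ltW.
  by rewrite mulrA mulfK ?gt_eqF.
apply: (@le_trans _ _ (\sum_i A i * ((2 * c2 + 1) ^+ d * (r / rho) ^+ d * (2 * c3 + 1)))).
  apply: ler_sum => i _; rewrite -mulr_sumr; apply: ler_wpM2l => //.
  rewrite -(pair_bigA _ (fun jc jt => B jc * E i jc jt)) /=.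
  apply: (@le_trans _ _ (\sum_jc B jc * (2 * c3 + 1))).
    by apply: ler_sum => jc _; rewrite -mulr_sumr; exact: ler_wpM2l.
  rewrite -mulr_suml; apply: ler_wpM2r => //; lra.
rewrite -mulr_suml.
apply: (@le_trans _ _ ((2 * c1 + 1) ^+ m *
    ((2 * c2 + 1) ^+ d * (r / rho) ^+ d * (2 * c3 + 1)))).
  apply: ler_wpM2r => //; rewrite mulr_ge0//; last lra.
  apply: mulr_ge0; apply: exprn_ge0; first by rewrite addr_ge0// mulr_ge0.
  by apply: divr_ge0; exact: ltW.
rewrite le_eqVlt; apply/orP; left; apply/eqP; ring.
Qed.

End overlap.

End covering.

Section bad_cover.
Local Open Scope ereal_scope.
Context {R : realType} {n : nat}.
Local Notation N := (n * 2)%N.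
Variable V : {vspace 'rV[R]_N}.
Local Notation m := (\dim V).
Variables (d : nat) (P : 'M[R]_(m, N)) (Pc : 'M[R]_(N, m)) (S : 'M[R]_(d, N))
  (Sc : 'M[R]_(N, d)).
Hypotheses (PPc : P *m Pc = (1%:M)%R) (PV : forall b : 'rV_m, b *m P \in V).
Hypothesis VP : forall v, v \in V -> v = v *m Pc *m P /\ v *m Sc = 0%R.
Hypothesis perpS : forall z, (forall v, v \in V -> dotp z v = 0%R) ->
  z = z *m Sc *m S /\ z *m Pc = 0%R.

Variables (L : {measure set (heisB R n) -> \bar R}) (h : heisB R n -> \bar R) (M : R).
Hypotheses (mh : measurable_fun setT h) (h0 : forall y, 0 <= h y).
Hypothesis hM : \int[L]_y h y <= M%:E.
Variables (D lam s : R).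
Hypotheses (D0 : (0 <= D)%R) (lam0 : (0 <= lam)%R) (s0 : (0 < s)%R).

Definition piece_mass a (r : R) K (i : {ffun 'I_m -> 'I_K}) : \bar R :=
  \int[L]_(y in heis_ball (coset_point a (grid_vector P D r i)) (lam * r)) h y.

Lemma euclid_dist_le (a b : heis R n) :
  (euclid_dist a b <= enorm (a.1 - b.1) + `|a.2 - b.2|)%R.
Proof.
rewrite /euclid_dist -(@ler_pXn2r _ 2)// ?nnegrE ?sqrtr_ge0 ?addr_ge0 ?enorm_ge0//.
rewrite sqr_sqrtr ?addr_ge0 ?sqr_ge0// [leRHS]sqrrD real_normK ?num_real//.
by rewrite lerD2r lerDl mulrn_wge0// mulr_ge0 ?enorm_ge0.
Qed.

(** Double counting: one point of [A] is chosen in each cell that meets [A], and carries mass at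
    least r^tau along its tube. The sum of these masses is at most the overlap number times [M],
    which bounds the number of cells. *)
Lemma bad_cover : exists2 C : R, (0 <= C)%R & forall (r rho tau : R) K1 (A : set (heis R n)),
  (0 < r)%R -> (r <= 1)%R -> (0 < rho)%R -> (rho <= r)%R -> (r ^+ 2 <= rho)%R ->
  (r * K1%:R <= 2 * D + 1)%R ->
  (forall a, A a -> [/\ vertical_complement V a,
     (forall l, `|(a.1 *m Sc) ord0 l| <= D)%R, (`|a.2| <= D)%R &
     (r `^ tau)%:E <= \sum_(i : {ffun 'I_m -> 'I_K1}) piece_mass a r i]) ->
  exists (I : finType) (F : I -> set (heis R n)) (E : I -> R),
    [/\ A `<=` \bigcup_i F i, forall i, (0 <= E i)%R,
        forall i x y, F i x -> F i y -> (euclid_dist x y <= E i)%R &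
        (\sum_i E i `^ s <= C * r `^ (- tau) * (r / rho) ^+ d * rho `^ s)%R].
Proof.
have [KS KS0 hS] := enorm_mulmx_bound S.
have [C C0 hC] := overlap_count PPc PV VP perpS D0 lam0.
(* Two points of one cell differ by at most 2 rho in each coordinate; the horizontal difference is
   mapped back by [S], the vertical one is added. *)
pose k := (2 * KS + 2)%R.
have k0 : (0 <= k)%R by rewrite addr_ge0// mulr_ge0.
exists (C * `|M| * k `^ s)%R; first by rewrite !mulr_ge0 ?powR_ge0.
move=> r rho tau K1 A r0 r1 rho0 rhor r2 rK1 hA.
pose K2 := grid_size D rho.
pose J := ({ffun 'I_d -> 'I_K2} * 'I_K2)%type.
pose F (j : J) : set (heis R n) := [set a | A a /\ in_cell Sc D rho j a].
pose bad (j : J) : bool := `[< F j !=set0 >].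
have [a aP] : {a : J -> heis R n & forall j, bad j -> F j (a j)}.
  apply: (@choice _ _ (fun j x => bad j -> F j x)) => j.
  have [/asboolP[x Fx]|/negbTE jF] := boolP (bad j); first by exists x.
  by exists (0, 0)%R.
(* Cells missing [A] get size 0, whose power vanishes because [s] is positive. *)
pose E (j : J) : R := (if bad j then k * rho else 0)%R.
have krho : (0 <= k * rho)%R by rewrite mulr_ge0// ltW.
exists J, F, E; split.
- move=> x Ax; have [_ xD xtD _] := hA x Ax.
  have [jc jcP] := @choice _ _ (fun (l : 'I_d) (q : 'I_K2) =>
    `|(x.1 *m Sc) ord0 l - grid_point D rho q| <= rho)%R
    (fun l => grid_cell rho0 (xD l)).
  have [jt jtP] := grid_cell rho0 xtD.
  exists ([ffun l => jc l], jt) => //; split => //; split => //= l.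
  by rewrite ffunE.
- by move=> j; rewrite /E; case: ifP.
- move=> j x y Fx Fy; rewrite /E ifT; last by apply/asboolP; exists x.
  case: Fx Fy => Ax [xc xt] [Ay [yc yt]].
  have [xV _ _ _] := hA x Ax; have [yV _ _ _] := hA y Ay.
  have [xS _] := perpS xV; have [yS _] := perpS yV.
  apply: le_trans (euclid_dist_le _ _) _.
  have h1 : (enorm (x.1 - y.1) <= KS * (2 * rho))%R.
    rewrite xS yS -mulmxBl; apply: hS; last by rewrite mulr_ge0// ltW.
    move=> l; have rowB (w w' : 'rV[R]_d) : ((w - w') ord0 l = w ord0 l - w' ord0 l)%R.
      by rewrite !mxE.
    rewrite rowB; have := xc l; have := yc l; rewrite !ler_norml.
    by move=> /andP[? ?] /andP[? ?]; apply/andP; split; lra.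
  move: h1 xt yt; rewrite /k !ler_norml => h1 /andP[? ?] /andP[? ?].
  have : (`|x.2 - y.2| <= 2 * rho)%R by rewrite ler_norml; apply/andP; split; lra.
  by lra.
pose nb : R := (\sum_(j | bad j) 1)%R.
have nbE : (\sum_j E j `^ s = nb * (k * rho) `^ s)%R.
  rewrite /nb mulr_suml big_mkcond [RHS]big_mkcond /=; apply: eq_bigr => j _.
  by rewrite /E; case: ifP => _; rewrite ?mul1r// powR0 ?gt_eqF.
have rt0 : (0 < r `^ tau)%R by exact: powR_gt0.
have nb0 : (0 <= nb)%R by apply: sumr_ge0.
have rr0 : (0 <= (r / rho) ^+ d)%R by rewrite exprn_ge0// divr_ge0// ltW.
have mball x (t : R) : measurable (heis_ball x t : set (heisB R n)).
  exact: measurable_heis_ball.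
suff nbM : (nb * r `^ tau <= C * (r / rho) ^+ d * `|M|)%R.
  rewrite nbE powRM ?(ltW rho0)// powRN.
  have -> : (C * `|M| * k `^ s * (r `^ tau)^-1 * (r / rho) ^+ d * rho `^ s =
    (C * (r / rho) ^+ d * `|M| / r `^ tau) * (k `^ s * rho `^ s))%R by ring.
  apply: ler_wpM2r; first by rewrite mulr_ge0 ?powR_ge0.
  by rewrite ler_pdivlMr.
rewrite -lee_fin.
pose B j (i : {ffun 'I_m -> 'I_K1}) : set (heisB R n) :=
  heis_ball (coset_point (a j) (grid_vector P D r i)) (lam * r).
have mhB j i : measurable_fun setT (h \_ (B j i)).
  by apply/(measurable_restrictT _ (mball _ _)); exact: measurable_funTS.
have hB0 j i y : 0 <= (h \_ (B j i)) y by rewrite /patch; case: ifP.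
have step1 : (nb * r `^ tau)%:E <= \sum_(j | bad j) \sum_i \int[L]_y (h \_ (B j i)) y.
  rewrite /nb mulr_suml -sumEFin; apply: lee_sum => j bj; rewrite mul1r.
  have [Aa _] := aP j bj; have [_ _ _ /le_trans] := hA _ Aa; apply.
  apply: lee_sum => i _; by rewrite /piece_mass integral_mkcond.
apply: le_trans step1 _.
have step2 : \sum_(j | bad j) \sum_i \int[L]_y (h \_ (B j i)) y =
    \int[L]_y \sum_(j | bad j) \sum_i (h \_ (B j i)) y.
  rewrite -big_filter; under [RHS]eq_integral do rewrite -big_filter.
  rewrite ge0_integral_sum//.
  - by apply: eq_bigr => j _; rewrite ge0_integral_sum.
  - by move=> j; apply: emeasurable_sum => i.
  - by move=> j y _; exact: sume_ge0.
rewrite step2.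
have ind y : \sum_(j | bad j) \sum_i (h \_ (B j i)) y <= (C * (r / rho) ^+ d)%:E * h y.
  have e j i : (h \_ (B j i)) y = h y *
      ((heis_dist (coset_point (a j) (grid_vector P D r i)) y < lam * r)%R%:R)%:E.
    rewrite /patch; case: (boolP (heis_dist _ _ < _)%R) => by_.
      by rewrite mem_set// mule1.
    by rewrite memNset ?mule0//; exact/negP.
  under eq_bigr do under eq_bigr do rewrite e.
  under eq_bigr do rewrite -ge0_sume_distrr//.
  rewrite -ge0_sume_distrr; last by move=> j _; exact: sume_ge0.
  rewrite muleC; apply: lee_wpmul2r => //.
  under eq_bigr do rewrite sumEFin.
  rewrite sumEFin lee_fin exchange_big /=.
  apply: (hC r rho K1 K2 bad a y) => // j bj.
  by have [Aa ja] := aP j bj; have [? ? _ _] := hA _ Aa.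
apply: (@le_trans _ _ (\int[L]_y ((C * (r / rho) ^+ d)%:E * h y))).
  apply: ge0_le_integralT => //.
  - under eq_fun do rewrite -big_filter.
    by apply: emeasurable_sum => j; apply: emeasurable_sum => i.
  - exact: measurable_funeM.
  - by move=> y; apply: sume_ge0 => j _; exact: sume_ge0.
rewrite ge0_integralZl_EFin//; last by rewrite mulr_ge0.
rewrite [leRHS]EFinM; apply: lee_wpmul2l; first by rewrite lee_fin mulr_ge0.
by apply: le_trans hM _; rewrite lee_fin; exact: ler_norm.
Qed.

End bad_cover.

(** * Exceptional cosets *)

Lemma powR_eventually_le {R : realType} (C k e : R) : 0 <= C -> 0 < k -> 0 < e ->
  exists2 r1 : R, 0 < r1 & forall r, 0 < r -> r < r1 -> C * r `^ k <= e.
Proof.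
move=> C0 k0 e0; have C1 : 0 < C + 1 by lra.
have eC : 0 < e / (C + 1) by rewrite divr_gt0.
exists ((e / (C + 1)) `^ k^-1); first exact: powR_gt0.
move=> r r0 rr1; have : r `^ k <= e / (C + 1).
  rewrite -[leRHS]powRr1 ?(ltW eC)// -[X in _ <= _ `^ X](mulVf (lt0r_neq0 k0)) powRrM.
  by apply: ge0_ler_powR; rewrite ?nnegrE ?powR_ge0 ?(ltW k0) ?(ltW r0) ?(ltW rr1).
rewrite ler_pdivlMr// mulrDr mulr1 mulrC.
by have := powR_ge0 r k; lra.
Qed.

Lemma mulr_squeeze {R : realType} (A B X Y Z : R) :
  0 <= A * B -> X <= Y * Z -> A * X * B <= A * B * Z * Y.
Proof.
move=> AB XYZ; rewrite -[leRHS]mulrA [Z * Y]mulrC [leLHS]mulrAC.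
exact: ler_wpM2l.
Qed.

Section local.
Local Open Scope ereal_scope.
Context {R : realType} {n : nat}.
Hypothesis n0 : (0 < n)%N.
Local Notation N := (n * 2)%N.
Local Notation Q := (n * 2).+2.
Variable V : {vspace 'rV[R]_N}.
Local Notation m := (\dim V).
Hypothesis isoV : isotropic V.
Variables (d : nat) (P : 'M[R]_(m, N)) (Pc : 'M[R]_(N, m)) (S : 'M[R]_(d, N))
  (Sc : 'M[R]_(N, d)).
Hypotheses (PPc : P *m Pc = (1%:M)%R) (PV : forall b : 'rV_m, b *m P \in V).
Hypothesis VP : forall v, v \in V -> v = v *m Pc *m P /\ v *m Sc = 0%R.
Hypothesis perpS : forall z, (forall v, v \in V -> dotp z v = 0%R) ->
  z = z *m Sc *m S /\ z *m Pc = 0%R.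

Variable L : {sigma_finite_measure set (heisB R n) -> \bar R}.
Hypothesis HL : heis_lebesgue L.
Variables (Y : metricType R) (f : heis R n -> Y) (g : heis R n -> \bar R) (p : R).
Hypotheses (Qp : (Q%:R < p)%R) (cf : continuous f) (fg : upper_gradient f g).

Variables (q0 : heis R n) (R0 : R).
Hypothesis R00 : (0 < R0)%R.
Hypothesis gfin : \int[L]_(x in heis_ball q0 R0) poweR (g x) p < +oo.

Let mg : measurable_fun setT (g : heisB R n -> \bar R). Proof. by case: fg. Qed.
Let g0 x : 0 <= g x. Proof. by case: fg. Qed.

(** Cutting off outside the ball gives a finite total mass, so the overlap bound can be integrated
    over the whole group. *)
Let h : heisB R n -> \bar R := (fun x => poweR (g x) p) \_ (heis_ball q0 R0).

Let mh : measurable_fun setT h.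
Proof.
apply/(measurable_restrictT _ (measurable_heis_ball _ _)); apply: measurable_funTS.
exact: measurableT_comp (measurable_poweR p) mg.
Qed.

Let h0 y : 0 <= h y.
Proof. by rewrite /h /patch; case: ifP => // _; exact: poweR_ge0. Qed.

Let M : R := fine (\int[L]_y h y).

Let hM : \int[L]_y h y = M%:E.
Proof.
rewrite /M fineK// ge0_fin_numE; last by apply: integral_ge0 => y _.
by rewrite /h -integral_mkcond.
Qed.

(** The distance of [f z] to the fixed point [f x] is a real function of [z] with upper gradient
    [g]; this reduces maps into [Y] to [morrey]. *)
Lemma oscillation x (r G : R) y y' : (0 < r)%R -> (0 < G)%R ->
  \int[L]_(z in heis_ball x (@morrey_dilation R n * r)) poweR (g z) p <= G%:E ->
  (heis_dist x y < r)%R -> (heis_dist x y' < r)%R ->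
  (mdist (f y) (f y') <= `|2 * @morrey_constant R n p| * G `^ p^-1 * r `^ (1 - Q%:R / p))%R.
Proof.
move=> r0 G0 hG xy xy'; pose u (z : heis R n) := mdist (f x) (f z).
have cu : continuous u.
  by move=> z; apply: continuous_comp; [exact: cf|exact: metric_continuous_mdist].
have ug z e (l : R) : enorm e = 1%R -> (0 <= l)%R ->
    `|u z - u (heis_mul z (l *: e, 0%R))|%:E <=
      \int[lebesgue_measure]_(s in `[0%R, l]) g (heis_mul z (s *: e, 0%R)).
  move=> e1 l0; apply: le_trans (segment_upper_gradient fg z e1 l0).
  rewrite lee_fin /u ler_norml; set a := f z; set b := f (heis_mul _ _).
  have := metric_triangle (f x) a b; have := metric_triangle (f x) b a.
  by rewrite (metric_sym b a); lra.
have bound z : (heis_dist x z < r)%R ->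
    (mdist (f x) (f z) <= @morrey_constant R n p * G `^ p^-1 * r `^ (1 - Q%:R / p))%R.
  move=> xz; have := morrey n0 HL Qp mg g0 cu ug r0 G0 hG xz.
  by rewrite /u mdistxx subr0 ger0_norm// mdist_ge0.
apply: le_trans (metric_triangle _ (f x) _) _; rewrite (metric_sym (f y)).
apply: le_trans (lerD (bound y xy) (bound y' xy')) _.
have : (2 * @morrey_constant R n p <= `|2 * @morrey_constant R n p|)%R by exact: ler_norm.
have t0 : (0 <= G `^ p^-1 * r `^ (1 - Q%:R / p))%R by rewrite mulr_ge0 ?powR_ge0.
by move=> /(ler_wpM2r t0); lra.
Qed.

Lemma local_bounds : exists2 D : R, (0 <= D)%R & forall a v,
  vertical_complement V a -> v \in V -> (heis_dist q0 (coset_point a v) < R0)%R ->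
  [/\ forall l, (`|(a.1 *m Sc) ord0 l| <= D)%R, (`|a.2| <= D)%R &
      forall l, (`|(v *m Pc) ord0 l| <= D)%R].
Proof.
have [KP KP0 hP] := enorm_mulmx_bound P.
have [KS KS0 hS] := enorm_mulmx_bound S.
have [KPc KPc0 hPc] := coord_mulmx_bound Pc.
have [KSc KSc0 hSc] := coord_mulmx_bound Sc.
pose X := (enorm q0.1 + R0)%R.
have X0 : (0 <= X)%R by rewrite addr_ge0 ?enorm_ge0// ltW.
have KSX : (0 <= KSc * X)%R by rewrite mulr_ge0.
have KPX : (0 <= KPc * X)%R by rewrite mulr_ge0.
pose D2 := (`|q0.2| + R0 ^+ 2 + 2 * enorm q0.1 * R0 + 2 * (KS * (KSc * X)) * (KP * (KPc * X)))%R.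
have D20 : (0 <= D2)%R.
  rewrite /D2; apply: addr_ge0; last by apply: mulr_ge0; rewrite !mulr_ge0.
  apply: addr_ge0; last by rewrite mulr_ge0 ?(ltW R00)// mulr_ge0 ?enorm_ge0.
  by rewrite addr_ge0 ?sqr_ge0.
exists (KSc * X + D2 + KPc * X)%R; first by rewrite (addr_ge0 (addr_ge0 KSX D20) KPX).
move=> a v perp vV xR; set x := coset_point a v in xR.
have [aS aPc] := perpS perp; have [vP vSc] := VP vV.
have x1 : x.1 = (a.1 + v)%R by [].
have xX : (enorm x.1 <= X)%R.
  rewrite -[x.1](subrK q0.1) addrC; apply: le_trans (enormD _ _) _.
  by rewrite lerD2l; apply: le_trans (enorm_le_heis_dist _ _) (ltW xR).
have aSc l : (`|(a.1 *m Sc) ord0 l| <= KSc * X)%R.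
  rewrite (_ : a.1 *m Sc = x.1 *m Sc)%R; last by rewrite x1 mulmxDl vSc addr0.
  by apply: le_trans (hSc _ _) _; exact: ler_wpM2l.
have vPc l : (`|(v *m Pc) ord0 l| <= KPc * X)%R.
  rewrite (_ : v *m Pc = x.1 *m Pc)%R; last by rewrite x1 mulmxDl aPc add0r.
  by apply: le_trans (hPc _ _) _; exact: ler_wpM2l.
have a2 : (`|a.2| <= D2)%R.
  have -> : a.2 = (x.2 - 2 * omega a.1 v)%R by rewrite /x /coset_point /=; ring.
  have hx := vert_dist_le q0 x.
  have ha : (enorm a.1 <= KS * (KSc * X))%R by rewrite aS; exact: hS.
  have hv : (enorm v <= KP * (KPc * X))%R by rewrite vP; exact: hP.
  have ho : (`|omega a.1 v| <= KS * (KSc * X) * (KP * (KPc * X)))%R.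
    by apply: le_trans (normr_omega_le _ _) _; apply: ler_pM; rewrite ?enorm_ge0.
  have d0 := heis_dist_ge0 q0 x.
  have h1 : (heis_dist q0 x ^+ 2 <= R0 ^+ 2)%R by apply: lerXn2r; rewrite ?nnegrE ?d0 ?(ltW R00) ?(ltW xR).
  have h2 : (enorm q0.1 * heis_dist q0 x <= enorm q0.1 * R0)%R.
    by rewrite ler_wpM2l ?enorm_ge0 ?(ltW xR).
  have hq : (`|x.2 - q0.2| <= R0 ^+ 2 + 2 * (enorm q0.1 * R0))%R.
    by rewrite distrC; apply: le_trans hx _; lra.
  have h3 := ler_norm q0.2; have h4 := ler_norm (- q0.2)%R; rewrite normrN in h4.
  move: hq ho; rewrite /D2 !ler_norml => /andP[? ?] /andP[? ?].
  by apply/andP; split; lra.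
split => [l||l].
- by apply: le_trans (aSc l) _; lra.
- by apply: le_trans a2 _; lra.
- by apply: le_trans (vPc l) _; lra.
Qed.

(** Half the radius leaves room for the enlarged balls of the Morrey estimate inside the region
    where [g] is integrable. *)
Definition coset_part a : set (heis R n) :=
  [set y | (heis_dist q0 y < R0 / 2)%R /\ exists2 v, v \in V & y = coset_point a v].

Definition bounded_coords (D : R) : Prop := forall a v,
  vertical_complement V a -> v \in V -> (heis_dist q0 (coset_point a v) < R0)%R ->
  [/\ forall l, (`|(a.1 *m Sc) ord0 l| <= D)%R, (`|a.2| <= D)%R &
      forall l, (`|(v *m Pc) ord0 l| <= D)%R].

Let good (D lam tau : R) a (r : R) : Prop :=
  \sum_(i : {ffun 'I_m -> 'I_(grid_size D r)}) piece_mass P L h D lam a r i < (r `^ tau)%:E.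

(** The positive exponent in the hypothesis is the power of r that bounds the al-th powers of the
    image diameters at a good scale; arbitrarily small good scales thus make the image null. *)
Lemma good_coset_null : exists2 lam : R, (0 <= lam)%R & forall D tau al : R,
  (0 <= D)%R -> bounded_coords D -> (0 < al)%R -> (al < p)%R ->
  (0 < al * (1 - Q%:R / p) + (tau + m%:R) * (al / p) - m%:R)%R ->
  forall a, vertical_complement V a ->
    (forall r1 : R, (0 < r1)%R -> exists r : R, [/\ (0 < r)%R, (r < r1)%R & good D lam tau a r]) ->
  hausdorff_measure (@mdist R Y) al (f @` coset_part a) = 0.
Proof.
have [KP KP0 hP] := enorm_mulmx_bound P.
pose s1 := (KP + 1)%R; have s10 : (0 < s1)%R by rewrite /s1; lra.
pose lam := (`|@morrey_dilation R n| * s1)%R.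
have lam0 : (0 <= lam)%R by rewrite mulr_ge0// ltW.
exists lam => // D tau al D0 bD al0 alp eta0 a perp agood.
have p0 : (0 < p)%R by exact: lt_trans alp.
pose Cm := (`|2 * @morrey_constant R n p|)%R; pose sg := (1 - Q%:R / p)%R.
have Cm0 : (0 <= Cm)%R by exact: normr_ge0.
pose th := (al / p)%R; pose eta := (al * sg + (tau + m%:R) * th - m%:R)%R.
pose C0 := (Cm `^ al * (s1 `^ sg) `^ al * (1 + (2 * D + 1) ^+ m))%R.
have D1 : (0 <= 2 * D + 1)%R by rewrite addr_ge0// mulr_ge0.
have C00 : (0 <= C0)%R.
  by rewrite /C0 mulr_ge0 ?addr_ge0 ?exprn_ge0// mulr_ge0 ?powR_ge0.
apply: hausdorff_measure_eq0 => // e e0.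
have [r1 r10 r1P] := powR_eventually_le C00 eta0 e0.
have sl0 : (0 < s1 + lam)%R by exact: ltr_wpDr.
(* The last bound keeps the ball of radius [lam * r] about a grid point inside the ball of radius
   [R0], as soon as some point of [coset_part] is within [s1 * r] of that grid point. *)
pose r2 : R := (Num.min (Num.min r1 1) (R0 / 2 / (s1 + lam)))%R.
have r20 : (0 < r2)%R.
  by rewrite !lt_min r10 ltr01 /= !divr_gt0.
have [r [r0 rr2 rgood]] := agood r2 r20.
move: rr2; rewrite !lt_min -andbA => /and3P[rr1 rle1 rR0].
have {}rR0 : ((s1 + lam) * r < R0 / 2)%R.
  by move: rR0; rewrite ltr_pdivlMr// mulrC.
pose K := grid_size D r; pose I : finType := {ffun 'I_m -> 'I_K}.
pose vi (i : I) := grid_vector P D r i.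
(* [mu] is the average mass per ball. Adding it to each mass costs at most a constant factor in the
   total r^tau and gives every [G i] a positive lower bound. *)
pose mu := (r `^ (tau + m%:R))%R; have mu0 : (0 < mu)%R by exact: powR_gt0.
have Gsum : \sum_(i : I) piece_mass P L h D lam a r i < (r `^ tau)%:E by exact: rgood.
have pm0 (i : I) : 0 <= piece_mass P L h D lam a r i by apply: integral_ge0 => y _.
have pmfin (i : I) : piece_mass P L h D lam a r i \is a fin_num.
  rewrite ge0_fin_numE//; apply: le_lt_trans (_ : _ <= (r `^ tau)%:E) _; last exact: ltry.
  apply: le_trans (ltW Gsum); rewrite (bigD1 i)//= leeDl//.
  by apply: sume_ge0 => j _.
pose G (i : I) := (fine (piece_mass P L h D lam a r i) + mu)%R.
have Gmu (i : I) : (mu <= G i)%R by rewrite /G lerDr fine_ge0.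
have G0 (i : I) : (0 < G i)%R by exact: lt_le_trans (Gmu i).
pose F (i : I) : set Y := f @` [set y | (heis_dist q0 y < R0 / 2)%R /\
  exists2 v, v \in V & y = coset_point a v /\
    forall l, (`|(v *m Pc) ord0 l - grid_point D r (i l)| <= r)%R].
pose E (i : I) := (Cm * G i `^ p^-1 * (s1 * r) `^ sg)%R.
have E0 i : (0 <= E i)%R by rewrite /E mulr_ge0 ?powR_ge0// mulr_ge0 ?powR_ge0.
exists I, F, E; split => //.
- move=> _ [y [yR [v vV ya]] <-].
  have yR0 : (heis_dist q0 (coset_point a v) < R0)%R.
    by rewrite -ya; apply: lt_trans yR _; rewrite ltr_pdivrMr// ltr_pMr// ltr1n.
  have [_ _ vD] := bD a v perp vV yR0.
  have [ic icP] := @choice _ _ (fun (l : 'I_m) (k : 'I_K) =>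
    `|(v *m Pc) ord0 l - grid_point D r k| <= r)%R (fun l => grid_cell r0 (vD l)).
  exists [ffun l => ic l] => //; exists y => //; split => //; exists v => //; split => //.
  by move=> l; rewrite ffunE.
- move=> i _ _ [y [yR [v vV [ya vc]]] <-] [y' [yR' [v' vV' [ya' vc']]] <-].
  pose x := coset_point a (vi i).
  have near w b : w \in V -> b = coset_point a w ->
      (forall l, (`|(w *m Pc) ord0 l - grid_point D r (i l)| <= r)%R) ->
      (heis_dist x b < s1 * r)%R.
    move=> wV -> wc; rewrite /x /coset_point heis_dist_horizontal; last first.
      by apply: isoV => //; exact: PV.
    have [wP _] := VP wV; rewrite wP /vi /grid_vector -mulmxBl.
    apply: (@le_lt_trans _ _ (KP * r)%R); last by rewrite ltr_pM2r// ltrDl.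
    apply: hP; last exact: ltW.
    by move=> l; have := wc l; rewrite !mxE.
  have xy := near v y vV ya vc; have xy' := near v' y' vV' ya' vc'.
  apply: (oscillation (x := x)) => //; first by rewrite mulr_gt0.
  have mball := @measurable_heis_ball R n.
  have sub : heis_ball x (lam * r) `<=` heis_ball q0 R0.
    move=> z; rewrite /heis_ball /= => xz.
    apply: le_lt_trans (heis_dist_triangle y _ _) _.
    have yxz : (heis_dist y z < s1 * r + lam * r)%R.
      by apply: le_lt_trans (heis_dist_triangle x _ _) _; rewrite heis_dist_sym ltrD.
    apply: lt_le_trans (ltrD yR yxz) _.
    by rewrite [leRHS]splitr lerD2l -mulrDl ltW.
  have <- : piece_mass P L h D lam a r i + mu%:E = (G i)%:E by rewrite /G EFinD fineK.
  apply: (@le_trans _ _ (piece_mass P L h D lam a r i)); last by rewrite leeDl// lee_fin ltW.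
  apply: (@le_trans _ _ (\int[L]_(z in heis_ball x (lam * r)) poweR (g z) p)).
    apply: ge0_subset_integralT => //.
    - exact: measurableT_comp (measurable_poweR p) mg.
    - by move=> z; exact: poweR_ge0.
    - move=> z; rewrite /heis_ball /= => /lt_le_trans; apply.
      by rewrite /lam -mulrA ler_wpM2r ?ler_norm// mulr_ge0// ltW.
  rewrite le_eqVlt; apply/orP; left; apply/eqP; apply: eq_integral => z.
  by rewrite inE => /sub zR; rewrite /h /patch mem_set.
(* This replaces Hoelder's inequality: since [th < 1] and [G i] is at least [mu], the concave power
   is bounded by a linear function, which can be summed. *)
have Gth (i : I) : ((G i `^ p^-1) `^ al <= G i * mu `^ (th - 1))%R.
  rewrite -powRrM [(p^-1 * al)%R]mulrC -/th.
  have -> : (G i `^ th = G i * G i `^ (th - 1))%R.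
    rewrite -[X in (_ = X * _)%R]powRr1 ?(ltW (G0 i))// -powRD; last first.
      by rewrite (gt_eqF (G0 i)) implybT.
    by congr (_ `^ _)%R; ring.
  apply: ler_wpM2l; first exact: ltW.
  have -> : (th - 1 = - (1 - th))%R by ring.
  rewrite !powRN lef_pV2 ?posrE ?powR_gt0//.
  apply: ge0_ler_powR; rewrite ?nnegrE ?(ltW mu0) ?(ltW (G0 i))//.
  by rewrite subr_ge0 /th ler_pdivrMr// mul1r ltW.
have sumG : (\sum_i G i <= (1 + (2 * D + 1) ^+ m) * r `^ tau)%R.
  rewrite big_split /= sumr_const mulrDl mul1r; apply: lerD.
    rewrite -lee_fin -sumEFin; apply: le_trans (ltW Gsum).
    by apply: lee_sum => i _; rewrite fineK.
  rewrite card_ffun !card_ord -[leLHS]mulr_natl /mu powRD; last by rewrite (gt_eqF r0) implybT.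
  rewrite powR_mulrn ?(ltW r0)// natrX mulrCA mulrC -exprMn ler_wpM2r ?powR_ge0//.
  apply: lerXn2r; rewrite ?nnegrE ?mulr_ge0 ?(ltW r0)//.
  by rewrite mulrC; exact: grid_size_le (ltW rle1).
apply: le_trans (r1P r r0 rr1).
apply: (@le_trans _ _ (\sum_i (Cm `^ al * ((s1 * r) `^ sg) `^ al * mu `^ (th - 1)) * G i)%R).
  apply: ler_sum => i _; rewrite /E.
  rewrite (powRM _ (mulr_ge0 Cm0 (powR_ge0 _ _)) (powR_ge0 _ _)).
  rewrite (powRM _ Cm0 (powR_ge0 _ _)).
  by apply: mulr_squeeze (Gth i); rewrite mulr_ge0 ?powR_ge0.
rewrite -mulr_sumr.
apply: (@le_trans _ _ ((Cm `^ al * ((s1 * r) `^ sg) `^ al * mu `^ (th - 1)) *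
    ((1 + (2 * D + 1) ^+ m) * r `^ tau))%R).
  apply: (ler_wpM2l _ sumG); apply: mulr_ge0; last exact: powR_ge0.
  by apply: mulr_ge0; exact: powR_ge0.
have -> : (r `^ (al * (1 - Q%:R / p) + (tau + m%:R) * (al / p) - m%:R) =
    (r `^ sg) `^ al * mu `^ (th - 1) * r `^ tau)%R.
  rewrite /mu -!powRrM -!powRD; try by rewrite (gt_eqF r0) implybT.
  by congr (_ `^ _)%R; rewrite /th /sg; ring.
rewrite powRM ?(ltW s10) ?(ltW r0)// [X in (_ * X * _ * _ <= _)%R]powRM ?powR_ge0//.
have rearrange (a' b' c' d' e' t' : R) :
  (a' * (b' * c') * d' * (e' * t') = a' * b' * e' * (c' * d' * t'))%R by ring.
by rewrite le_eqVlt; apply/orP; left; apply/eqP; exact: rearrange.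
Qed.

(* The two alternatives come from covering with cells of size [r] and [r ^+ 2]. *)
Lemma local_exceptional_null (tau al s : R) : (0 < al)%R -> (al < p)%R ->
  (0 < al * (1 - Q%:R / p) + (tau + m%:R) * (al / p) - m%:R)%R ->
  (0 < s)%R -> (tau < s)%R \/ (tau + d%:R < 2 * s)%R ->
  hausdorff_measure (@euclid_dist R n) s
    [set a | vertical_complement V a /\
       hausdorff_measure (@mdist R Y) al (f @` coset_part a) <> 0] = 0.
Proof.
move=> al0 alp eta0 s0 ts.
have [D D0 bD] := local_bounds; have [lam lam0 goodP] := good_coset_null.
(* Splitting by the scale below which a coset is bad makes this scale uniform on each of countably
   many pieces, so one small [r] serves a whole piece. *)
pose A k : set (heis R n) := [set a | [/\ vertical_complement V a,
  (forall l, `|(a.1 *m Sc) ord0 l| <= D)%R, (`|a.2| <= D)%R &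
  forall r : R, (0 < r)%R -> (r < k.+1%:R^-1)%R -> ~ good D lam tau a r]].
apply: (@hausdorff_measure_sub_eq0 _ _ _ _ _ (\bigcup_k A k)).
  move=> a [perp Ha].
  have [v vV vR] : exists2 v, v \in V & (heis_dist q0 (coset_point a v) < R0)%R.
    apply: contra_notP Ha => noV.
    rewrite (_ : coset_part a = set0) ?image_set0 ?hausdorff_measure0//.
    apply/seteqP; split => // y [yR [v vV yav]]; apply: noV; exists v => //.
    by rewrite -yav; apply: lt_trans yR _; rewrite ltr_pdivrMr// ltr_pMr// ltr1n.
  have [ac at_ _] := bD a v perp vV vR.
  have [r1 r10 r1P] : exists2 r1 : R, (0 < r1)%R & forall r : R, (0 < r)%R -> (r < r1)%R ->
      ~ good D lam tau a r.
    apply: contra_notP Ha => bad; apply: (goodP D tau al) => // r1 r10.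
    apply: contra_notP bad => noGood; exists r1 => // r r0 rr1 gr.
    by apply: noGood; exists r.
  have [k _ kP] := near_infty_natSinv_lt (PosNum r10).
  exists k => //; split => // r r0 rk; apply: r1P => //.
  by apply: lt_trans rk _; apply: (kP k); exact: leqnn.
apply: hausdorff_measure_bigcup_eq0 => k; apply: hausdorff_measure_eq0 => // e e0.
have hM' : \int[L]_y h y <= M%:E by rewrite hM.
have [C C0 cover] := bad_cover PPc PV VP perpS mh h0 hM' D0 lam0 s0.
(* [pw] is [s - tau] for cells of size r and [2 * s - (tau + d)] for cells of size r^2, so the
   alternative [ts] says exactly that it is positive. *)
have [pw [pw0 pwP]] : exists pw : R, (0 < pw)%R /\ forall r : R, (0 < r)%R -> (r < 1)%R ->
    exists rho : R, [/\ (0 < rho)%R, (rho <= r)%R, (r ^+ 2 <= rho)%R &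
      (C * r `^ (- tau) * (r / rho) ^+ d * rho `^ s = C * r `^ pw)%R].
  case: ts => ts.
    exists (s - tau)%R; split; first by rewrite subr_gt0.
    move=> r r0 r1; exists r; split => //.
      by rewrite expr2 ler_piMr// ltW.
    rewrite divff ?gt_eqF// expr1n mulr1 -mulrA -powRD ?(gt_eqF r0) ?implybT//.
    by congr (_ * _ `^ _)%R; ring.
  exists (2 * s - (tau + d%:R))%R; split; first by rewrite subr_gt0.
  move=> r r0 r1; exists (r ^+ 2)%R; split => //; first exact: exprn_gt0.
    by rewrite expr2 ler_piMr// ltW.
  rewrite [(r / r ^+ 2)%R](_ : _ = r^-1)%R; last by field; rewrite gt_eqF.
  have -> : (r ^+ 2 = r `^ 2%:R)%R by rewrite powR_mulrn// ltW.
  have -> : (r^-1 ^+ d = r `^ (- d%:R))%R.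
    by rewrite powRN powR_mulrn ?(ltW r0)// exprVn.
  rewrite -powRrM -!mulrA -!powRD ?(gt_eqF r0) ?implybT//.
  by congr (_ * _ `^ _)%R; ring.
have [r1 r10 r1P] := powR_eventually_le C0 pw0 e0.
pose r := (Num.min (Num.min r1 1) (k.+1%:R^-1) / 2)%R.
have min0 : (0 < Num.min (Num.min r1 1) (k.+1%:R^-1))%R.
  by rewrite !lt_min r10 ltr01 invr_gt0 ltr0n.
have r0 : (0 < r)%R by rewrite divr_gt0.
have rmin : (r < Num.min (Num.min r1 1) (k.+1%:R^-1))%R.
  by rewrite /r ltr_pdivrMr// ltr_pMr// ltr1n.
move: rmin; rewrite !lt_min -andbA => /and3P[rr1 rlt1 rk].
have [rho [rho0 rhor r2 E]] := pwP r r0 rlt1.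
have Ksz := grid_size_le D0 r0 (ltW rlt1).
have AkP a : A k a -> [/\ vertical_complement V a,
    (forall l, `|(a.1 *m Sc) ord0 l| <= D)%R, (`|a.2| <= D)%R &
    (r `^ tau)%:E <= \sum_(i : {ffun 'I_m -> 'I_(grid_size D r)}) piece_mass P L h D lam a r i].
  move=> [perp ac a2 bad]; split => //.
  by rewrite leNgt; apply/negP; exact: bad.
have [I [F [G [AF G0 FG sumG]]]] := cover r rho tau _ (A k) r0 (ltW rlt1) rho0 rhor r2 Ksz AkP.
exists I, F, G; split => //; apply: le_trans sumG _; rewrite E.
exact: r1P.
Qed.

End local.

Lemma hausdorff_measure_bigcup_countable_eq0 {R : realType} {T : Type} (d : T -> T -> R)
    (s : R) (I : countType) (A : I -> set T) :
  (forall i, hausdorff_measure d s (A i) = 0%E) ->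
  hausdorff_measure d s (\bigcup_i A i) = 0%E.
Proof.
move=> A0; apply: (@hausdorff_measure_sub_eq0 _ _ _ _ _
  (\bigcup_k if unpickle k is Some i then A i else set0)).
  by move=> x [i _ Ax]; exists (pickle i) => //; rewrite pickleK.
apply: hausdorff_measure_bigcup_eq0 => k.
by case: unpickle => [i|]; [exact: A0|exact: hausdorff_measure0].
Qed.

(** * From small balls to the whole group *)

Section exceptional_set.
Context {R : realType} {n : nat}.
Hypothesis n0 : (0 < n)%N.
Local Notation N := (n * 2)%N.
Variables (Y : metricType R) (f : heis R n -> Y) (p : R).
Hypotheses (Qp : (n * 2).+2%:R < p) (cf : continuous f) (sf : sobolev_loc p f).
Variable V : {vspace 'rV[R]_N}.
Hypothesis isoV : isotropic V.
Local Notation m := (\dim V).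

(** Countably many rational balls with integrable [g] to the power p have half-balls that cover the
    group. If the image of a coset is not null, then neither is that of its part in one of these
    half-balls. *)
Lemma exceptional_set_null (tau al s : R) : 0 < al -> al < p ->
  0 < al * (1 - (n * 2).+2%:R / p) + (tau + m%:R) * (al / p) - m%:R ->
  0 < s -> tau < s \/ tau + (N - m)%N%:R < 2 * s ->
  hausdorff_measure (@euclid_dist R n) s
    [set a | vertical_complement V a /\
       hausdorff_measure (@mdist R Y) al
         (f @` left_coset a (horizontal_subgroup V)) <> 0%E] = 0%E.
Proof.
move=> al0 alp eta0 s0 ts.
have [d [P [Pc [S [Sc [mdN PPc PV VP perpS]]]]]] := horizontal_coordinates V.
have dE : d = (N - m)%N := etrans (esym (addKn m d)) (congr1 (subn^~ m) mdN).
have [g fg gloc] := sf; have [L HL] := @heis_lebesgue_exists R n.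
pose radius (k : nat) : R := k.+1%:R^-1.
have radius0 k : 0 < radius k by rewrite invr_gt0.
pose fin (i : ('rV[rat]_N * rat) * nat) : Prop :=
  (\int[L]_(x in heis_ball (rat_heis i.1) (radius i.2)) poweR (g x) p < +oo)%E.
have mgp : measurable_fun setT (fun x : heisB R n => poweR (g x) p).
  by case: fg => mg _ _; exact: measurableT_comp (measurable_poweR p) mg.
have gp0 x : (0 <= poweR (g x) p)%E by exact: poweR_ge0.
have lindelof x : exists i, fin i /\ heis_dist (rat_heis i.1) x < radius i.2 / 2.
  have [U [oU Ux] Ufin] := gloc x.
  have [e e0 xeU] := (metric_openP U).1 oU x Ux.
  have e20 : 0 < e / 2 by rewrite divr_gt0.
  have [k _ kP] := near_infty_natSinv_lt (PosNum e20).
  have ke : radius k < e / 2 by apply: (kP k); exact: leqnn.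
  have k20 : 0 < radius k / 2 by rewrite divr_gt0.
  have [q qx] := rat_heis_dense x k20; exists (q, k); split => //.
  rewrite /fin /=; apply: (@le_lt_trans _ _ (\int[L]_(y in U) poweR (g y) p)%E).
    apply: ge0_subset_integralT => //.
    - exact: measurable_heis_ball.
    - exact: measurable_heis_open.
    - move=> y qy; apply: xeU => /=; rewrite -[mdist x y]/(heis_dist x y).
      apply: le_lt_trans (heis_dist_triangle (rat_heis q) _ _) _.
      rewrite (heis_dist_sym x); move: qy; rewrite /heis_ball /=.
      by have := radius0 k; lra.
  apply: le_lt_trans (heis_integral_ge HL oU mgp gp0) _.
  by rewrite lte_mul_pinfty// lee_fin exprn_ge0.
pose part a i : set (heis R n) := coset_part V (rat_heis i.1) (radius i.2) a.
pose E i : set (heis R n) := [set a | [/\ fin i, vertical_complement V a &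
  hausdorff_measure (@mdist R Y) al (f @` part a i) <> 0%E]].
apply: (@hausdorff_measure_sub_eq0 _ _ _ _ _ (\bigcup_i E i)).
  move=> a [perp Ha]; apply: contra_notP Ha => noE.
  apply: (@hausdorff_measure_sub_eq0 _ _ _ _ _
    (\bigcup_i if pselect (fin i) then f @` part a i else set0)).
    move=> _ [_ [v [vV v2] <-] <-].
    have [i [fi qi]] := lindelof (heis_mul a v); exists i => //.
    case: pselect => //= fi'; exists (heis_mul a v) => //; split => //.
    by exists v.1 => //; rewrite /coset_point -v2 -surjective_pairing.
  apply: hausdorff_measure_bigcup_countable_eq0 => i.
  case: pselect => /= [fi|_]; last exact: hausdorff_measure0.
  by apply: contra_notP noE => Hi; exists i.
apply: hausdorff_measure_bigcup_countable_eq0 => i.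
have [fi|nfi] := pselect (fin i); last first.
  rewrite (_ : E i = set0) ?hausdorff_measure0//.
  by apply/seteqP; split => // a [/nfi].
rewrite -dE in ts.
apply: (@hausdorff_measure_sub_eq0 _ _ _ _ _ _ _
  (local_exceptional_null n0 isoV PPc PV VP perpS HL Qp cf fg (radius0 i.2) fi
    al0 alp eta0 s0 ts)).
by move=> a [].
Qed.

End exceptional_set.

(** * Choice of the exponents *)

Theorem theorem1p4 (R : realType) (n : nat) (hn : (1 <= n)%N)
    (Y : metricType R) (p : R) (hp : 2 * n%:R + 2 < p)
    (f : heis R n -> Y) (hcont : continuous f) (hf : sobolev_loc p f)
    (m : nat) (hm : (1 <= m <= n)%N)
    (V : {vspace 'rV[R]_(n * 2)}) (hV : isotropic V) (hdim : (\dim V = m)%N)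
    (alpha : R)
    (halpha : m%:R <= alpha <= p * m%:R / (p - (2 * n%:R + 2 - m%:R))) :
  (hausdorff_dim (@euclid_dist R n)
     [set a | vertical_complement V a /\
        (alpha%:E <= hausdorff_dim (@mdist R Y)
           (f @` left_coset a (horizontal_subgroup V)))%E]
   <= (beta n p m alpha)%:E)%E.
Proof.
pose Qr : R := 2 * n%:R + 2; rewrite -/Qr in hp.
have QE : (n * 2).+2%:R = Qr by rewrite /Qr -addn2 natrD natrM mulrC.
have Qp : (n * 2).+2%:R < p by rewrite QE.
have n1 : 1 <= n%:R :> R by rewrite ler1n.
have /andP[m1 mn] : (1 <= m%:R :> R) && (m%:R <= n%:R :> R) by rewrite ler1n ler_nat.
move: halpha => /andP[ma]; rewrite -/Qr => aup.
have Q4 : 4 <= Qr by rewrite /Qr; lra.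
have mQ : m%:R + 3 <= Qr by rewrite /Qr; lra.
have p0 : 0 < p by lra.
have a0 : 0 < alpha by lra.
have pm0 : 0 < p - (Qr - m%:R) by lra.
have {}aup : alpha * (p - (Qr - m%:R)) <= p * m%:R by rewrite -ler_pdivlMr.
have ap : alpha < p.
  rewrite -(ltr_pM2r pm0); apply: le_lt_trans aup _.
  by rewrite ltr_pM2l//; lra.
pose w := m%:R / alpha; have wa : w * alpha = m%:R by rewrite divfK ?gt_eqF.
(* The critical mass exponent, at which the image exponent [m%:R / c] below equals [alpha]. The
   upper bound on [alpha] says exactly that it is nonnegative. *)
pose tau0 : R := (Qr - m%:R) - p * (1 - w).
have dE : (n * 2 - m)%N%:R = Qr - 2 - m%:R :> R.
  rewrite natrB; last first.
    by have /andP[_ mn'] := hm; rewrite (leq_trans mn')// leq_pmulr.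
  by rewrite /Qr natrM; ring.
have pw : p * w * alpha = p * m%:R by rewrite -mulrA wa.
have tau0_ge0 : 0 <= tau0.
  by rewrite -(pmulr_lge0 _ a0) /tau0; nra.
pose b := beta n p m alpha.
(* The first branch of [beta] is half of [tau0 + (2n - m)] and the second is [tau0]. The sign is
   required because [hausdorff_dim] ranges over nonnegative exponents. *)
have bE : 0 <= b /\ forall s : R, b < s -> tau0 < s \/ tau0 + (n * 2 - m)%N%:R < 2 * s.
  rewrite /b /beta -/w dE; case: ifPn => [hle|_]; last first.
    split; first by have := tau0_ge0; rewrite /tau0 /Qr; lra.
    by move=> s bs; left; rewrite /tau0 /Qr; lra.
  split; last by move=> s bs; right; rewrite /tau0 /Qr; lra.
  have {}hle : alpha * (p - 2) <= p * m%:R by rewrite -ler_pdivlMr//; lra.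
  have : p - p * w <= 2 by rewrite -(ler_pM2r a0); nra.
  by lra.
have [b0 bs] := bE; apply/lee_addgt0Pr => e e0; rewrite -EFinD.
set s := b + e; have s0 : 0 < s by rewrite ltr_wpDl.
have [tau tau0t ts] : exists2 tau : R,
    tau0 < tau & tau < s \/ tau + (n * 2 - m)%N%:R < 2 * s.
  have /bs[h|h] : b < s by rewrite ltrDl.
    by exists ((tau0 + s) / 2); [lra|left; lra].
  by exists ((tau0 + (2 * s - (n * 2 - m)%N%:R)) / 2); [lra|right; lra].
(* The condition of [exceptional_set_null] reads [m < al * c], and [tau > tau0] puts [m%:R / c]
   strictly below [alpha]. *)
pose c : R := (p - Qr + tau + m%:R) / p.
have c0 : 0 < c by rewrite divr_gt0//; lra.
have cp : c * p = p - Qr + tau + m%:R by rewrite divfK ?gt_eqF.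
have mc : m%:R / c < alpha.
  rewrite ltr_pdivrMr// -(ltr_pM2r p0) -mulrA cp mulrC -pw -subr_gt0.
  rewrite (_ : _ - _ = (tau - tau0) * alpha) ?mulr_gt0 ?subr_gt0//.
  by rewrite /tau0; ring.
(* Strictly below [alpha], so that an image of dimension at least [alpha] cannot be null for the
   exponent [al], and strictly above [m%:R / c], so that the previous results apply. *)
pose al := (alpha + m%:R / c) / 2.
have mc0 : 0 < m%:R / c by rewrite divr_gt0//; lra.
have al0 : 0 < al by rewrite /al; lra.
have ala : al < alpha by rewrite /al; lra.
have eta0 : 0 < al * (1 - (n * 2).+2%:R / p) + (tau + m%:R) * (al / p) - m%:R.
  rewrite QE (_ : _ - _ = al * c - m%:R).
    by rewrite subr_gt0 -ltr_pdivrMr// /al; lra.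
  by rewrite /c; field; rewrite gt_eqF.
subst m; apply: hausdorff_dim_le (ltW s0) _.
apply: (@hausdorff_measure_sub_eq0 _ _ _ _ _ _ _
  (exceptional_set_null hn Qp hcont hf hV al0 (lt_trans ala ap) eta0 s0 ts)).
move=> a [perp aH]; split => // /(hausdorff_dim_le (ltW al0)) Hal.
by have := le_trans aH Hal; rewrite lee_fin leNgt ala.
Qed.
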